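(* Let $D\in\{1,2,3\}$, $x\in\mathbb{R}^D$ (with $x\ne0$ if $D\in\{2,3\}$), $h>0$, $\xi>0$, and $n\ge1$, with the Runge–Kutta method, $\mathbf{e}_n$, $K$ and $\boldsymbol{\omega}_n(x)$ as in the context. Let $\Gamma_\pm=\{-\xi\pm\mathrm{i}y:\ y>0\}$. Then \[ \boldsymbol{\omega}_n(x)=\frac{h}{2\pi\mathrm{i}}\int_{\Gamma_+\cup\Gamma_-}K(z,x)\,\mathbf{e}_n(hz)\,dz+\frac{h}{2\pi\mathrm{i}}\int_0^{\xi}\big(K(\lambda e^{-\mathrm{i}\pi},x)-K(\lambda e^{\mathrm{i}\pi},x)\big)\,\mathbf{e}_n(-h\lambda)\,d\lambda, \] where $K(\lambda e^{\pm\mathrm{i}\pi},x)$ denotes the boundary value $\lim_{\epsilon\to0^+}K(-\lambda\pm\mathrm{i}\epsilon,x)$ of $K(\cdot,x)$ on the negative real axis from the upper/lower half-plane. Moreover, $G(\lambda,x):=K(\lambda e^{-\mathrm{i}\pi},x)-K(\lambda e^{\mathrm{i}\pi},x)$ is given for $\lambda>0$ by \[ G(\lambda,x)=\begin{cases}\dfrac{\mathrm{i}e^{\mathrm{i}\pi/4}}{\sqrt\lambda}\cosh\big(|x|e^{\mathrm{i}\pi/4}\sqrt\lambda\big),& D=1,\\[1em] \dfrac{\mathrm{i}}{2}J_0\big(e^{-\mathrm{i}\pi/4}\sqrt\lambda\,\|x\|\big),& D=2,\\[1em] \dfrac{1}{2\pi\|x\|}\sinh\big(\|x\|e^{\mathrm{i}\pi/4}\sqrt\lambda\big),&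 D=3,\end{cases} \] where $J_0$ is the Bessel function of the first kind of order $0$.
   Context: Runge–Kutta method: $s$-stage, Butcher tableau $(\mathbf{A},\mathbf{b},\mathbf{c})$, assumed $A$-stable with order $p\ge1$, $|r(\mathrm{i}y)|<1$ for real $y\ne0$, $\mathbf{A}$ invertible, and stiffly accurate ($\mathbf{b}^T\mathbf{A}^{-1}=(0,\dots,0,1)$). Stability function $r(z)=1+z\mathbf{b}^T(I-z\mathbf{A})^{-1}\mathbb{1}$, $\mathbb{1}=(1,\dots,1)^T$; $\mathbf{q}(z)=\mathbf{b}^T(I-z\mathbf{A})^{-1}$; $\mathbf{e}_n(z)=r(z)^n\mathbf{q}(z)$. Transfer function: with $\sqrt{z/\mathrm{i}}:=e^{-\mathrm{i}\pi/4}\sqrt z$, $\sqrt z$ principal branch (cut along $(-\infty,0]$), $K(z,x)=\frac{1}{2\sqrt{z/\mathrm{i}}}e^{-|x|\sqrt{z/\mathrm{i}}}$ for $D=1$; $K(z,x)=\frac1{2\pi}K_0(\|x\|\sqrt{z/\mathrm{i}})$ for $D=2$ ($K_0$ principal branch of the modified Bessel function of the second kind); $K(z,x)=\frac1{4\pi\|x\|}e^{-\|x\|\sqrt{z/\mathrm{i}}}$ for $D=3$; these are analytic in $z\in\mathbb{C}\setminus(-\infty,0]$. With $\boldsymbol{\Delta}(\zeta)=(\mathbf{A}+\frac{\zeta}{1-\zeta}\mathbb{1}\mathbf{b}^T)^{-1}$, define $\mathbf{W}_n(x)$ by $\sum_{n\ge0}\mathbf{W}_n(x)\zeta^n=K(\boldsymbol{\Delta}(\zeta)/h,x)$,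 and let $\boldsymbol{\omega}_n(x)$ be the last row of $\mathbf{W}_n(x)$. *)

(* Defs.v *)
From HB Require Import structures.
From mathcomp Require Import all_boot all_order all_algebra.
From mathcomp Require Import complex.
From mathcomp Require Import all_classical all_reals all_analysis.
Set Implicit Arguments. Unset Strict Implicit. Unset Printing Implicit Defensive.
Import Order.TTheory GRing.Theory Num.Theory.
Import numFieldTopology.Exports numFieldNormedType.Exports.
Local Open Scope classical_set_scope.
Local Open Scope ring_scope.
Local Open Scope complex_scope.

(* the complex numbers R[i], seen as a numFieldType (hence a normed space
   over itself, with its topology) *)
Definition CC (R : realType) : numFieldType := R[i].

Definition cabs {R : realType} (z : CC R) : R := Num.sqrt (complex.Re z ^+ 2 + complex.Im z ^+ 2).

Definition cexp {R : realType} (z : CC R) : CC R :=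
  (expR (complex.Re z))%:C * ((cos (complex.Im z))%:C + 'i * (sin (complex.Im z))%:C).

Definition ccosh {R : realType} (z : CC R) : CC R := (cexp z + cexp (- z)) / 2.
Definition csinh {R : realType} (z : CC R) : CC R := (cexp z - cexp (- z)) / 2.

(* principal square root (branch cut along (-oo,0]; on the cut it takes the
   value with argument pi, irrelevant for the statement) *)
Definition psqrt {R : realType} (z : CC R) : CC R :=
  Num.sqrt ((cabs z + complex.Re z) / 2)
  +i* ((if complex.Im z < 0 then -1 else 1) * Num.sqrt ((cabs z - complex.Re z) / 2)).

(* principal argument, valid on C \ (-oo,0] *)
Definition cArg {R : realType} (z : CC R) : R := 2 * atan (complex.Im z / (cabs z + complex.Re z)).

(* principal logarithm, valid on C \ (-oo,0] *)
Definition cLog {R : realType} (z : CC R) : CC R := (ln (cabs z))%:C + 'i * (cArg z)%:C.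

Definition cseries {R : realType} (u : nat -> CC R) : CC R :=
  lim ((fun N : nat => \sum_(k < N) u k) @ \oo).

Definition Hnum {R : realType} (k : nat) : R := \sum_(i < k) (i.+1%:R)^-1.

Definition euler_gamma {R : realType} : R :=
  lim ((fun n : nat => (Hnum n : R) - ln (n%:R)) @ \oo).

Definition besselJ0 {R : realType} (w : CC R) : CC R :=
  cseries (fun k => (-1) ^+ k * (w ^+ 2 / 4) ^+ k / ((k`!)%:R ^+ 2)).

Definition besselI0 {R : realType} (w : CC R) : CC R :=
  cseries (fun k => (w ^+ 2 / 4) ^+ k / ((k`!)%:R ^+ 2)).

(* modified Bessel function of the second kind of order 0, principal branch
   (|arg w| < pi), DLMF 10.31.2 *)
Definition besselK0 {R : realType} (w : CC R) : CC R :=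
  - (cLog (w / 2) + (euler_gamma : R)%:C) * besselI0 w
  + cseries (fun k => (Hnum k : R)%:C * (w ^+ 2 / 4) ^+ k / ((k`!)%:R ^+ 2)).

Definition eipi4 {R : realType} : CC R := cexp ('i * (pi / 4 : R)%:C).

Definition sqrt_zi {R : realType} (z : CC R) : CC R := cexp (- ('i * (pi / 4 : R)%:C)) * psqrt z.

Definition enorm {R : realType} {D : nat} (x : 'rV[R]_D) : R :=
  Num.sqrt (\sum_(i < D) x 0 i ^+ 2).

(* transfer function K(z,x) of the Schroedinger-type problem, D = 1,2,3 *)
Definition Ktrans {R : realType} (D : nat) (z : CC R) (x : 'rV[R]_D) : CC R :=
  match D with
  | 1 => cexp (- ((enorm x)%:C * sqrt_zi z)) / (2 * sqrt_zi z)
  | 2 => (2 * (pi : R))%:C ^-1 * besselK0 ((enorm x)%:C * sqrt_zi z)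
  | _ => (4 * (pi : R) * enorm x)%:C ^-1 * cexp (- ((enorm x)%:C * sqrt_zi z))
  end.

Definition Gjump {R : realType} (D : nat) (l : R) (x : 'rV[R]_D) : CC R :=
  match D with
  | 1 => 'i * eipi4 / (Num.sqrt l)%:C * ccosh ((enorm x)%:C * eipi4 * (Num.sqrt l)%:C)
  | 2 => 'i / 2 * besselJ0 (cexp (- ('i * (pi / 4 : R)%:C)) * (Num.sqrt l)%:C * (enorm x)%:C)
  | _ => (2 * (pi : R) * enorm x)%:C ^-1
         * csinh ((enorm x)%:C * eipi4 * (Num.sqrt l)%:C)
  end.

Definition Cmx {R : realType} {m n : nat} (M : 'M[R]_(m, n)) : 'M[CC R]_(m, n) :=
  map_mx (fun a => a%:C) M.

Definition rk_q {R : realType} {s : nat} (A : 'M[R]_s.+1) (b : 'rV[R]_s.+1) (z : CC R)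
  : 'rV[CC R]_s.+1 := Cmx b *m invmx (1%:M - z *: Cmx A).

Definition rk_r {R : realType} {s : nat} (A : 'M[R]_s.+1) (b : 'rV[R]_s.+1) (z : CC R)
  : CC R := 1 + z * (rk_q A b z *m (const_mx 1 : 'cV[CC R]_s.+1)) 0 0.

Definition rk_e {R : realType} {s : nat} (A : 'M[R]_s.+1) (b : 'rV[R]_s.+1) (n : nat)
  (z : CC R) : 'rV[CC R]_s.+1 := rk_r A b z ^+ n *: rk_q A b z.

Definition rk_Delta {R : realType} {s : nat} (A : 'M[R]_s.+1) (b : 'rV[R]_s.+1)
  (zeta : CC R) : 'M[CC R]_s.+1 :=
  invmx (Cmx A + (zeta / (1 - zeta)) *: ((const_mx 1 : 'cV[CC R]_s.+1) *m Cmx b)).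

Definition cderiv_n {R : realType} (j : nat) (f : CC R -> CC R) : CC R -> CC R :=
  derive1n j f.

Definition hermite_interp {R : realType} {m : nat} (f : CC R -> CC R)
  (M : 'M[CC R]_m.+1) (p : {poly CC R}) : Prop :=
  forall l : CC R, root (char_poly M) l ->
  forall j : nat, (j < mup l (char_poly M))%N ->
    (p^`(j)).[l] = cderiv_n j f l.

(* primary matrix function f(M) (standard definition via Hermite interpolation,
   cf. Higham, Functions of Matrices, Def. 1.4) *)
Definition matfun {R : realType} {m : nat} (f : CC R -> CC R) (M : 'M[CC R]_m.+1)
  : 'M[CC R]_m.+1 :=
  horner_mx M (xget 0 [set p | hermite_interp f M p]).

Definition Wcoef {R : realType} {s : nat} (A : 'M[R]_s.+1) (b : 'rV[R]_s.+1)
  (D : nat) (x : 'rV[R]_D) (h : R) (n : nat) : 'M[CC R]_s.+1 :=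
  \matrix_(i, j) (cderiv_n n
     (fun zeta => matfun (fun z => Ktrans z x) ((h%:C)^-1 *: rk_Delta A b zeta) i j) 0
     / (n`!)%:R).

Definition omega {R : realType} {s : nat} (A : 'M[R]_s.+1) (b : 'rV[R]_s.+1)
  (D : nat) (x : 'rV[R]_D) (h : R) (n : nat) : 'rV[CC R]_s.+1 :=
  row ord_max (Wcoef A b x h n).

Definition cintegrable {R : realType} (E : set R) (f : R -> CC R) : Prop :=
  (@lebesgue_measure R).-integrable E (EFin \o (fun t => complex.Re (f t))) /\
  (@lebesgue_measure R).-integrable E (EFin \o (fun t => complex.Im (f t))).

Definition cint {R : realType} (E : set R) (f : R -> CC R) : CC R :=
  (Rintegral (@lebesgue_measure R) E (fun t => complex.Re (f t)))
  +i* (Rintegral (@lebesgue_measure R) E (fun t => complex.Im (f t))).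

(* Main.v *)
Require Import Defs.
From HB Require Import structures.
From mathcomp Require Import all_boot all_order all_algebra.
From mathcomp Require Import complex.
From mathcomp Require Import all_classical all_reals all_analysis.
From mathcomp Require Import ring lra.
Import Order.TTheory GRing.Theory Num.Theory.
Import numFieldTopology.Exports numFieldNormedType.Exports.
Local Open Scope classical_set_scope.
Local Open Scope ring_scope.
Local Open Scope complex_scope.
Set Implicit Arguments. Unset Strict Implicit. Unset Printing Implicit Defensive.


(* Substituting [z = u ^+ 2] maps the cut plane onto the half plane [0 < Re u],
   where [2 u K(u^2, x)] is holomorphic with a continuous extension to the
   closed half plane.  Cauchy's formula therefore represents [K] inside the
   keyhole contour made of the two rays [Re z = - xi], of the two sides of the
   slit [[- xi, 0]] and of a far closing arc.  By Newton interpolation at the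
   eigenvalues the formula extends to the primary matrix function
   [K(Delta(zeta) / h, x)], and the last row of the resolvent of
   [Delta(zeta) / h] is a multiple of [q(h z) / (1 - zeta r(h z))].  Since
   [|r| <= 1] on the contour one may differentiate in [zeta] under the integral,
   which produces [e_n(h z)].  The closing arc disappears in the limit because
   [K(z, x) = O(|z|^(1/2))] to the right of the rays, while [e_n(h z) = O(|z|^-2)]
   for [1 <= n].

   The bound on [K] in dimension 2 is obtained without asymptotic expansions.
   On the positive axis the Wronskian shows that [K_0 / I_0] is monotone, and
   [I_0] is bounded below by the exponential; the bound is then transported
   along circular arcs up to the cut by an energy estimate. *)

(** * Complex numbers and complex differentiability *)

(** The variable [u] removes two obstacles at once. At [z = 0] the function [K] is branched, and for
    [D = 1, 2] unbounded; the factor [2 u] of [dz = 2 u du] absorbs this. The two boundary values at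
    [- l] become ordinary values at [i sqrt l] and [- i sqrt l], so the contour may run along the
    slit itself. On the imaginary axis only continuity is left, so Cauchy's formula is proved by
    contracting the contour towards an interior point: the intermediate contours lie in the open
    half plane.

    On the rays and the slit [|r| <= 1] is A-stability. On the closing arc, in the right half plane,
    it comes from stiff accuracy: [b] is the last row of [A], so [r] vanishes at infinity. An
    eigenvalue of [Delta(zeta)] satisfies [zeta r = 1] wherever [1 - w A] is invertible, so for
    [|zeta| < 1] it lies inside the contour, and one contour serves all these [zeta].

    On the lower ray the argument [w] of [K_0] has a negative real part. The estimate of [K_0] must
    therefore reach beyond the right half plane, and there it only gives a bounded exponential
    factor, not decay; all decay comes from [e_n]. *)

Lemma complexP {R : realType} (z w : CC R) :
  complex.Re z = complex.Re w -> complex.Im z = complex.Im w -> z = w.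
Proof. by move: z w => [a b] [c d] /= -> ->. Qed.

Lemma ReD {R : realType} (z w : CC R) : complex.Re (z + w) = complex.Re z + complex.Re w.
Proof. by move: z w => [a b] [c d]. Qed.
Lemma ImD {R : realType} (z w : CC R) : complex.Im (z + w) = complex.Im z + complex.Im w.
Proof. by move: z w => [a b] [c d]. Qed.
Lemma ReN {R : realType} (z : CC R) : complex.Re (- z) = - complex.Re z.
Proof. by move: z => [a b]. Qed.
Lemma ImN {R : realType} (z : CC R) : complex.Im (- z) = - complex.Im z.
Proof. by move: z => [a b]. Qed.
Lemma ReM {R : realType} (z w : CC R) :
  complex.Re (z * w) = complex.Re z * complex.Re w - complex.Im z * complex.Im w.
Proof. by move: z w => [a b] [c d]. Qed.
Lemma ImM {R : realType} (z w : CC R) :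
  complex.Im (z * w) = complex.Re z * complex.Im w + complex.Im z * complex.Re w.
Proof. by move: z w => [a b] [c d]. Qed.
Definition ReImE {R : realType} := (@ReD R, @ImD R, @ReN R, @ImN R, @ReM R, @ImM R).

Lemma normC_cabs {R : realType} (z : CC R) : `|z| = (cabs z)%:C.
Proof. exact: normc_def. Qed.

Lemma cabs_ge0 {R : realType} (z : CC R) : 0 <= cabs z.
Proof. exact: sqrtr_ge0. Qed.

Lemma cabsM {R : realType} (z w : CC R) : cabs (z * w) = cabs z * cabs w.
Proof. by apply: complexI; rewrite rmorphM /= -!normC_cabs normrM. Qed.

Lemma cabsD {R : realType} (z w : CC R) : cabs (z + w) <= cabs z + cabs w.
Proof. by rewrite -lecR rmorphD /= -!normC_cabs ler_normD. Qed.

Lemma cabsN {R : realType} (z : CC R) : cabs (- z) = cabs z.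
Proof. by apply: complexI; rewrite -!normC_cabs normrN. Qed.

Lemma cabsB {R : realType} (z w : CC R) : cabs (z - w) = cabs (w - z).
Proof. by rewrite -cabsN opprB. Qed.

Lemma cabs_dist {R : realType} (z w : CC R) : `|cabs z - cabs w| <= cabs (z - w).
Proof.
have h1 : cabs z <= cabs (z - w) + cabs w by rewrite -[X in cabs X <= _](addrNK w) cabsD.
have h2 : cabs w <= cabs (z - w) + cabs z.
  by rewrite cabsB -[X in cabs X <= _](addrNK z) cabsD.
by rewrite ler_norml; apply/andP; split; lra.
Qed.

Lemma cabs0 {R : realType} : cabs (0 : CC R) = 0.
Proof. by apply: complexI; rewrite -normC_cabs normr0. Qed.

Lemma cabs1 {R : realType} : cabs (1 : CC R) = 1.
Proof. by apply: complexI; rewrite -normC_cabs normr1. Qed.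

Lemma cabs_eq0 {R : realType} (z : CC R) : (cabs z == 0) = (z == 0).
Proof. by rewrite -(inj_eq (@complexI R)) -normC_cabs normr_eq0. Qed.

Lemma cabs_gt0 {R : realType} (z : CC R) : (0 < cabs z) = (z != 0).
Proof. by rewrite lt_def cabs_ge0 andbT cabs_eq0. Qed.

Lemma cabsV {R : realType} (z : CC R) : cabs z^-1 = (cabs z)^-1.
Proof. by apply: complexI; rewrite fmorphV /= -!normC_cabs normfV. Qed.

Lemma cabsX {R : realType} (z : CC R) n : cabs (z ^+ n) = cabs z ^+ n.
Proof. by apply: complexI; rewrite rmorphXn /= -!normC_cabs normrX. Qed.

Lemma cabsR {R : realType} (x : R) : cabs (x%:C : CC R) = `|x|.
Proof. by rewrite /cabs /= expr0n addr0 sqrtr_sqr. Qed.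

Lemma cabsi {R : realType} : cabs ('i : CC R) = 1.
Proof. by rewrite /cabs /= expr0n add0r expr1n sqrtr1. Qed.

Lemma cabs_Re {R : realType} (z : CC R) : `|complex.Re z| <= cabs z.
Proof. by rewrite -sqrtr_sqr /cabs ler_wsqrtr// lerDl sqr_ge0. Qed.

Lemma cabs_Im {R : realType} (z : CC R) : `|complex.Im z| <= cabs z.
Proof. by rewrite -sqrtr_sqr /cabs ler_wsqrtr// lerDr sqr_ge0. Qed.

Lemma complexRI {R : realType} (z : CC R) :
  z = (complex.Re z)%:C + 'i * (complex.Im z)%:C.
Proof. exact: complexE. Qed.

Lemma cabs_le {R : realType} (z : CC R) : cabs z <= `|complex.Re z| + `|complex.Im z|.
Proof. by rewrite {1}[z]complexRI (le_trans (cabsD _ _))// cabsM cabsi mul1r !cabsR. Qed.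

Lemma cabs_sqr {R : realType} (z : CC R) :
  cabs z ^+ 2 = complex.Re z ^+ 2 + complex.Im z ^+ 2.
Proof. by rewrite sqr_sqrtr// addr_ge0 ?sqr_ge0. Qed.

Lemma cabs_sum {R : realType} (I : Type) (r : seq I) (P : pred I) (F : I -> CC R) :
  cabs (\sum_(i <- r | P i) F i) <= \sum_(i <- r | P i) cabs (F i).
Proof.
elim/big_rec2 : _ => [|i y x _ le]; first by rewrite cabs0.
by rewrite (le_trans (cabsD _ _))// lerD2l.
Qed.

Lemma cabs_nat {R : realType} n : cabs (n%:R : CC R) = n%:R.
Proof. by rewrite -(rmorph_nat (real_complex R)) /= cabsR normr_nat. Qed.

Lemma ltC0 {R : realType} (e : CC R) : 0 < e -> exists2 d : R, 0 < d & e = d%:C.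
Proof.
rewrite ltcE /= => /andP[/eqP Ie Re]; exists (complex.Re e) => //.
by apply: complexP.
Qed.

Lemma cvgCP {R : realType} {T : Type} (F : set_system T) {FF : Filter F}
  (f : T -> CC R) (l : CC R) :
  f @ F --> l <-> forall e : R, 0 < e -> \forall x \near F, cabs (l - f x) < e.
Proof.
split=> [/cvgrPdist_lt fl e e0|H].
  have /fl : (0 : CC R) < e%:C by rewrite ltcR.
  by apply: filterS => x; rewrite normC_cabs ltcR.
apply/cvgrPdist_lt => e /ltC0[d d0 ->].
by apply: filterS (H d d0) => x; rewrite normC_cabs ltcR.
Qed.

Lemma nbhsCP {R : realType} (z : CC R) (A : set (CC R)) :
  nbhs z A <-> exists2 d : R, 0 < d & forall w, cabs (w - z) < d -> A w.
Proof.
split=> [/nbhs_ballP[e /= /ltC0[d d0 ->] zA]|[d d0 zA]].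
  exists d => // w wz; apply: zA.
  by rewrite -ball_normE /ball_ /= normC_cabs ltcR cabsB.
apply/nbhs_ballP; exists d%:C; first by rewrite /= ltcR.
by move=> w; rewrite -ball_normE /ball_ /= normC_cabs ltcR cabsB; exact: zA.
Qed.

Lemma cvgC_ReIm {R : realType} {T : Type} (F : set_system T) {FF : Filter F}
  (f : T -> CC R) (l : CC R) :
  f @ F --> l <->
  ((fun x => complex.Re (f x)) @ F --> complex.Re l /\
   (fun x => complex.Im (f x)) @ F --> complex.Im l).
Proof.
split=> [/cvgCP fl|[fr fi]].
  split; apply/cvgrPdist_lt => e /fl; apply: filterS => x; apply: le_lt_trans.
    by rewrite -ReN -ReD cabs_Re.
  by rewrite -ImN -ImD cabs_Im.
apply/cvgCP => e e0.
have e20 : 0 < e / 2 by rewrite divr_gt0.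
move/cvgrPdist_lt : fr => /(_ _ e20) fr; move/cvgrPdist_lt : fi => /(_ _ e20) fi.
apply: filterS2 fr fi => x fr fi; rewrite (le_lt_trans (cabs_le _))//.
by rewrite ReD ImD ReN ImN (splitr e) ltrD.
Qed.

Lemma cvg_Re {R : realType} {T : Type} (F : set_system T) {FF : Filter F}
  (f : T -> CC R) (l : CC R) :
  f @ F --> l -> (fun x => complex.Re (f x)) @ F --> complex.Re l.
Proof. by move=> /cvgC_ReIm[]. Qed.

Lemma cvg_Im {R : realType} {T : Type} (F : set_system T) {FF : Filter F}
  (f : T -> CC R) (l : CC R) :
  f @ F --> l -> (fun x => complex.Im (f x)) @ F --> complex.Im l.
Proof. by move=> /cvgC_ReIm[]. Qed.

Lemma cvg_real {R : realType} {T : Type} (F : set_system T) {FF : Filter F}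
  (f : T -> R) (l : R) : f @ F --> l -> (fun x => (f x)%:C : CC R) @ F --> (l%:C : CC R).
Proof. by move=> fl; apply/cvgC_ReIm; split => //=; exact: cvg_cst. Qed.

Lemma cvg_cabs {R : realType} {T : Type} (F : set_system T) {FF : Filter F}
  (f : T -> CC R) (l : CC R) :
  f @ F --> l -> (fun x => cabs (f x)) @ F --> cabs l.
Proof.
move=> /cvgCP fl; apply/cvgrPdist_lt => e /fl; apply: filterS => x; apply: le_lt_trans.
exact: cabs_dist.
Qed.

(** The remainder is compared with [e * cabs h] by a non-strict inequality, so the increment [0] is
    allowed and the chain rule needs no case distinction. The radii are real; [cdiffP] identifies
    this with the derivative over the field [CC R], that is, with complex differentiability. *)
Definition cdiff {R : realType} (f : CC R -> CC R) (z d : CC R) :=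
  forall e : R, 0 < e -> exists2 del : R, 0 < del & forall h : CC R,
    cabs h < del -> cabs (f (z + h) - f z - d * h) <= e * cabs h.

Lemma cdiffP {R : realType} (f : CC R -> CC R) (z d : CC R) :
  is_derive z 1 f d <-> cdiff f z d.
Proof.
split=> [[+ <-] e e0|H].
  move=> /cvgCP /= /(_ _ e0) /nbhsCP[del del0 H].
  exists del => // h hd.
  have [->|h0] := eqVneq h 0; first by rewrite addr0 subrr mulr0 subrr cabs0 mulr0.
  have := H h; rewrite subr0 => /(_ hd h0).
  rewrite /derive; set L := lim _.
  rewrite /GRing.scale /= mulr1 => /ltW Hh.
  rewrite -[X in cabs X](divfK h0) cabsM ler_wpM2r ?cabs_ge0//.
  rewrite -cabsN; apply: le_trans Hh; rewrite le_eqVlt; apply/orP; left; apply/eqP.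
  by congr cabs; rewrite (addrC h z); field.
suff fd : h^-1 *: (f (h *: 1 + z) - f z) @[h --> 0^'] --> d.
  have fdv : derivable f z 1 by apply/cvg_ex; exists d.
  have dE : 'D_1 f z = d by exact: (cvg_lim (@norm_hausdorff _ _) fd).
exact: (@DeriveDef _ _ _ z 1 f d fdv dE).
apply/cvgCP => e e0.
have [del del0 Hd] := H (e / 2) (divr_gt0 e0 (ltr0n _ 2)).
apply/nbhsCP; exists del => // h; rewrite subr0 => hd h0.
rewrite /GRing.scale /= mulr1.
have := Hd _ hd; rewrite -ler_pdivrMr ?cabs_gt0// => hle.
apply: (@le_lt_trans _ _ (e / 2)); last by rewrite ltr_pdivrMr// ltr_pMr// ltr1n.
apply: le_trans hle; rewrite -cabsV -cabsM -cabsN le_eqVlt; apply/orP; left; apply/eqP.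
by congr cabs; rewrite (addrC h z); field.
Qed.

(** [CC R] is a normed space over itself and not over [R], so the derivative along a real parameter
    is spelled out; [pderP] reduces it to the two coordinates, where the real theory applies. *)
Definition pder {R : realType} (f : R -> CC R) (t : R) (d : CC R) :=
  forall e : R, 0 < e -> exists2 del : R, 0 < del & forall h : R,
    `|h| < del -> cabs (f (t + h) - f t - d * h%:C) <= e * `|h|.

Lemma is_deriveP {R : realType} (f : R -> R) (t d : R) :
  is_derive t 1 f d <-> (forall e : R, 0 < e -> exists2 del : R, 0 < del & forall h : R,
    `|h| < del -> `|f (t + h) - f t - d * h| <= e * `|h|).
Proof.
split=> [[+ <-] e e0|H].
  move=> /cvgrPdist_lt /= /(_ _ e0) /nbhs_ballP[del /= del0 H].
  exists del => // h hd.
  have [->|h0] := eqVneq h 0; first by rewrite addr0 subrr mulr0 subrr normr0 mulr0.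
  have := H h; rewrite /ball /= sub0r normrN => /(_ hd h0).
  rewrite /derive; set L := lim _.
  rewrite /GRing.scale /= mulr1 => /ltW Hh.
  rewrite -[X in `|X|](divfK h0) normrM ler_wpM2r//.
  rewrite -normrN; apply: le_trans Hh; rewrite le_eqVlt; apply/orP; left; apply/eqP.
  by congr `|_|; rewrite (addrC h t); field.
suff fd : h^-1 *: (f (h *: 1 + t) - f t) @[h --> 0^'] --> d.
  have fdv : derivable f t 1 by apply/cvg_ex; exists d.
  by apply: DeriveDef => //; apply/cvg_lim.
apply/cvgrPdist_lt => e e0.
have [del del0 Hd] := H (e / 2) (divr_gt0 e0 (ltr0n _ 2)).
apply/nbhs_ballP; exists del => // h; rewrite /ball /= sub0r normrN => hd h0.
rewrite /GRing.scale /= mulr1.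
have := Hd _ hd; rewrite -ler_pdivrMr ?normr_gt0// => hle.
apply: (@le_lt_trans _ _ (e / 2)); last by rewrite ltr_pdivrMr// ltr_pMr// ltr1n.
apply: le_trans hle; rewrite -normfV -normrM -normrN le_eqVlt; apply/orP; left; apply/eqP.
by congr `|_|; rewrite (addrC h t); field.
Qed.

Lemma pderP {R : realType} (f : R -> CC R) (t : R) (d : CC R) :
  pder f t d <-> (is_derive t 1 (fun s => complex.Re (f s)) (complex.Re d) /\
                  is_derive t 1 (fun s => complex.Im (f s)) (complex.Im d)).
Proof.
have Ree (h : R) (z : CC R) : complex.Re z * h = complex.Re (z * h%:C).
  by rewrite ReM /= mulr0 subr0.
have Ime (h : R) (z : CC R) : complex.Im z * h = complex.Im (z * h%:C).
  by rewrite ImM /= mulr0 add0r.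
split=> [H|[/is_deriveP Hr /is_deriveP Hi] e e0].
  split; apply/is_deriveP => e /H[del del0 {}H]; exists del => // h /H; apply: le_trans.
    by rewrite Ree -!ReN -!ReD cabs_Re.
  by rewrite Ime -!ImN -!ImD cabs_Im.
have e20 : 0 < e / 2 by rewrite divr_gt0.
have [d1 d10 H1] := Hr _ e20; have [d2 d20 H2] := Hi _ e20.
exists (Num.min d1 d2); first by rewrite lt_min d10.
move=> h; rewrite lt_min => /andP[/H1 {}H1 /H2 {}H2].
rewrite (le_trans (cabs_le _))// (splitr e) mulrDl !ReD !ImD !ReN !ImN -Ree -Ime.
exact: lerD.
Qed.

Section complex_derivative.
Context {R : realType}.
Implicit Types (f g F : CC R -> CC R) (z d : CC R).

Lemma cdiff_eq f z d d' : cdiff f z d -> d = d' -> cdiff f z d'.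
Proof. by move=> ? <-. Qed.

Lemma cdiff_cst (c z : CC R) : cdiff (fun=> c) z 0.
Proof. by apply/cdiffP; exact: is_derive_cst. Qed.

Lemma cdiff_id z : cdiff id z 1.
Proof. by apply/cdiffP; exact: is_derive_id. Qed.

Lemma cdiffD f g z df dg : cdiff f z df -> cdiff g z dg ->
  cdiff (fun w => f w + g w) z (df + dg).
Proof. by move=> /cdiffP hf /cdiffP hg; apply/cdiffP; exact: (is_deriveD hf hg). Qed.

Lemma cdiffN f z df : cdiff f z df -> cdiff (fun w => - f w) z (- df).
Proof. by move=> /cdiffP hf; apply/cdiffP; exact: (is_deriveN hf). Qed.

Lemma cdiffB f g z df dg : cdiff f z df -> cdiff g z dg ->
  cdiff (fun w => f w - g w) z (df - dg).
Proof. by move=> hf hg; apply: cdiffD => //; exact: cdiffN. Qed.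

Lemma cdiffM f g z df dg : cdiff f z df -> cdiff g z dg ->
  cdiff (fun w => f w * g w) z (f z * dg + g z * df).
Proof. by move=> /cdiffP hf /cdiffP hg; apply/cdiffP; exact: (is_deriveM hf hg). Qed.

Lemma cdiffZ (c : CC R) f z df : cdiff f z df -> cdiff (fun w => c * f w) z (c * df).
Proof.
move=> hf; apply: cdiff_eq (cdiffM (cdiff_cst c z) hf) _.
by rewrite mulr0 addr0.
Qed.

Lemma cdiff_lip f z d : cdiff f z d -> exists2 del : R, 0 < del &
  forall h, cabs h < del -> cabs (f (z + h) - f z) <= (cabs d + 1) * cabs h.
Proof.
move=> /(_ 1 ltr01)[del del0 H]; exists del => // h /H; rewrite mul1r => {}H.
rewrite -[X in cabs X](subrK (d * h)) (le_trans (cabsD _ _))// cabsM mulrDl mul1r.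
by rewrite addrC lerD2l.
Qed.

Lemma cdiff_cont f z d : cdiff f z d -> f @ z --> f z.
Proof.
move=> /cdiff_lip[del del0 H]; apply/(@cvgCP _ _ (nbhs z) (nbhs_filter z)) => e e0; apply/nbhsCP.
have K0 : 0 < cabs d + 1 by rewrite ltr_wpDl ?cabs_ge0.
exists (Num.min del (e / (cabs d + 1))); first by rewrite lt_min del0 divr_gt0.
move=> w; rewrite lt_min ltr_pdivlMr// => /andP[wd we].
have := H _ wd; rewrite [z + _]addrC subrK cabsB => /le_lt_trans; apply.
by rewrite mulrC.
Qed.

Lemma cdiff_comp F f z d D : cdiff F (f z) D -> cdiff f z d ->
  cdiff (fun w => F (f w)) z (D * d).
Proof.
move=> hF hf e e0; have [d1 d10 H1] := cdiff_lip hf.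
set K := cabs d + 1 in H1 *.
have K0 : 0 < K by rewrite ltr_wpDl ?cabs_ge0.
have [d2 d20 H2] := hF (e / 2 / K) (divr_gt0 (divr_gt0 e0 (ltr0n _ 2)) K0).
set L := cabs D + 1.
have L0 : 0 < L by rewrite ltr_wpDl ?cabs_ge0.
have [d3 d30 H3] := hf (e / 2 / L) (divr_gt0 (divr_gt0 e0 (ltr0n _ 2)) L0).
exists (Num.min (Num.min d1 d3) (d2 / K)); first by rewrite !lt_min d10 d30 divr_gt0.
move=> h; rewrite !lt_min ltr_pdivlMr// => /andP[/andP[/H1 {}H1 /H3 {}H3] hK].
have kd2 : cabs (f (z + h) - f z) < d2 by rewrite (le_lt_trans H1)// mulrC.
have := H2 _ kd2; rewrite [f z + _]addrC subrK => {}H2.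
rewrite -[X in cabs X](subrK (D * (f (z + h) - f z - d * h))).
have -> : F (f (z + h)) - F (f z) - D * d * h - D * (f (z + h) - f z - d * h) =
  F (f (z + h)) - F (f z) - D * (f (z + h) - f z) by ring.
rewrite (le_trans (cabsD _ _))// (splitr e) mulrDl lerD//.
  rewrite (le_trans H2)// -mulrA ler_pM2l ?divr_gt0//.
  by rewrite mulrC ler_pdivrMr// mulrC.
rewrite cabsM (le_trans (ler_wpM2l _ H3)) ?cabs_ge0//.
rewrite mulrA ler_wpM2r ?cabs_ge0// mulrCA ler_piMr ?divr_ge0 ?ltW//.
by rewrite ltr_pdivrMr// mul1r ltrDl.
Qed.

Lemma cdiffX f z d n : cdiff f z d -> cdiff (fun w => f w ^+ n) z (n%:R * f z ^+ n.-1 * d).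
Proof.
move=> hf; elim: n => [|n IH].
  by rewrite !mul0r; under eq_fun do rewrite expr0; exact: cdiff_cst.
under eq_fun do rewrite exprS.
apply: cdiff_eq (cdiffM hf IH) _; case: n {IH} => [|n] /=; first by rewrite expr0; ring.
by rewrite exprS -[in RHS]natr1; ring.
Qed.

Lemma cdiff_near f g z d : (\forall w \near z, f w = g w) -> cdiff f z d -> cdiff g z d.
Proof.
move=> /nbhsCP[d1 d10 fg] hf e e0; have [d2 d20 H] := hf e e0.
exists (Num.min d1 d2); first by rewrite lt_min d10.
move=> h; rewrite lt_min => /andP[h1 h2]; rewrite -!fg ?subrr ?cabs0//; first exact: H.
by rewrite addrAC subrr add0r.
Qed.

Lemma cdiff_inv z : z != 0 -> cdiff (fun w => w^-1) z (- (z ^- 2)).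
Proof.
move=> z0 e e0; have z0' : 0 < cabs z by rewrite cabs_gt0.
(* The remainder is [h^2 / (z^2 (z + h))]. The first bound gives [|z + h| >= |z| / 2], the second
   then makes [2 |h| / |z|^3] at most [e]. *)
set d := Num.min (cabs z / 2) (e * (cabs z ^+ 3) / 2).
exists d; first by rewrite lt_min !divr_gt0// mulr_gt0// exprn_gt0.
move=> h; rewrite lt_min => /andP[h1 h2].
have zh : cabs z / 2 <= cabs (z + h).
  have : cabs z <= cabs (z + h) + cabs h.
    by rewrite -(cabsN h) (le_trans _ (cabsD _ _))// addrK.
  by move: h1; set a := cabs _; set b := cabs _; set c := cabs _; lra.
have zh0 : z + h != 0 by rewrite -cabs_gt0 (lt_le_trans _ zh)// divr_gt0.
have -> : (z + h)^-1 - z^-1 - - (z ^- 2) * h = h * (h / (z ^+ 2 * (z + h))).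
  by field; rewrite z0 zh0.
rewrite cabsM mulrC ler_wpM2r ?cabs_ge0// cabsM cabsV cabsM cabsX.
rewrite ler_pdivrMr; last by rewrite mulr_gt0 ?exprn_gt0// cabs_gt0.
apply: (le_trans (ltW h2)).
rewrite -mulrA ler_pM2l// exprSr -mulrA ler_wpM2l// exprn_ge0//.
by rewrite ltW.
Qed.

Lemma cdiffV f z d : f z != 0 -> cdiff f z d ->
  cdiff (fun w => (f w)^-1) z (- (f z ^- 2) * d).
Proof. by move=> fz0 hf; apply: (@cdiff_comp (fun w => w^-1)) => //; exact: cdiff_inv. Qed.

Lemma cdiff_horner (p : {poly CC R}) z : cdiff (fun w => p.[w]) z p^`().[z].
Proof.
elim/poly_ind: p => [|p c IH].
  by under eq_fun do rewrite horner0; rewrite deriv0 horner0; exact: cdiff_cst.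
under eq_fun do rewrite hornerMXaddC.
apply: cdiff_eq (cdiffD (cdiffM IH (cdiff_id z)) (cdiff_cst c z)) _.
by rewrite derivMXaddC hornerD hornerMX; ring.
Qed.

(** A derivative can be iterated only when its predecessor is known on a neighbourhood; hence the
    candidates [F k] are tested on an open set. This turns [derive1n] into an explicit sequence,
    both for [K] and for the convolution weights. *)
Lemma derive1n_seq (U : set (CC R)) (f : CC R -> CC R) (F : nat -> CC R -> CC R) :
  open U -> (forall z, U z -> f z = F 0%N z) ->
  (forall k z, U z -> cdiff (F k) z (F k.+1 z)) ->
  forall n z, U z -> cderiv_n n f z = F n z.
Proof.
move=> oU fF0 dF; elim=> [|n IH] z Uz; first exact: fF0.
rewrite /cderiv_n derive1nS derive1E.
have zU : \forall w \near z, U w by exact: open_nbhs_nbhs.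
have /cdiffP H : cdiff (cderiv_n n f) z (F n.+1 z).
  apply: cdiff_near (dF n z Uz); apply: filterS zU => w Uw.
  by rewrite IH.
exact: (@derive_val _ _ _ _ _ _ _ H).
Qed.

End complex_derivative.

Section path_derivative.
Context {R : realType}.
Implicit Types (f g : R -> CC R) (t : R) (d : CC R).

Lemma pder_eq f t d d' : pder f t d -> d = d' -> pder f t d'.
Proof. by move=> ? <-. Qed.

Lemma pder_cst (c : CC R) t : pder (fun=> c) t 0.
Proof. by apply/pderP; split; exact: is_derive_cst. Qed.

Lemma pder_real (f : R -> R) t (d : R) : is_derive t 1 f d -> pder (fun s => (f s)%:C) t d%:C.
Proof. by move=> fd; apply/pderP; split => //=; exact: is_derive_cst. Qed.

Lemma pderD f g t df dg : pder f t df -> pder g t dg ->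
  pder (fun w => f w + g w) t (df + dg).
Proof.
move=> /pderP[f1 f2] /pderP[g1 g2]; apply/pderP; rewrite ReD ImD; split.
  under eq_fun do rewrite ReD.
  exact: (is_deriveD f1 g1).
under eq_fun do rewrite ImD.
exact: (is_deriveD f2 g2).
Qed.

Lemma pderN f t df : pder f t df -> pder (fun w => - f w) t (- df).
Proof.
move=> /pderP[f1 f2]; apply/pderP; rewrite ReN ImN; split.
  under eq_fun do rewrite ReN.
  exact: (is_deriveN f1).
under eq_fun do rewrite ImN.
exact: (is_deriveN f2).
Qed.

Lemma pderB f g t df dg : pder f t df -> pder g t dg ->
  pder (fun w => f w - g w) t (df - dg).
Proof. by move=> hf hg; apply: pderD => //; exact: pderN. Qed.

Lemma pderM f g t df dg : pder f t df -> pder g t dg ->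
  pder (fun w => f w * g w) t (f t * dg + g t * df).
Proof.
move=> /pderP[f1 f2] /pderP[g1 g2]; apply/pderP; split.
  under eq_fun do rewrite ReM.
  apply: is_derive_eq (is_deriveB (is_deriveM f1 g1) (is_deriveM f2 g2)) _.
  by rewrite /GRing.scale /= !ReImE; ring.
under eq_fun do rewrite ImM.
apply: is_derive_eq (is_deriveD (is_deriveM f1 g2) (is_deriveM f2 g1)) _.
by rewrite /GRing.scale /= !ReImE; ring.
Qed.

Lemma pderZ (c : CC R) f t df : pder f t df -> pder (fun w => c * f w) t (c * df).
Proof.
move=> hf; apply: pder_eq (pderM (pder_cst c t) hf) _.
by rewrite mulr0 addr0.
Qed.

Lemma pder_lip f t d : pder f t d -> exists2 del : R, 0 < del &
  forall h : R, `|h| < del -> cabs (f (t + h) - f t) <= (cabs d + 1) * `|h|.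
Proof.
move=> /(_ 1 ltr01)[del del0 H]; exists del => // h /H; rewrite mul1r => {}H.
rewrite -[X in cabs X](subrK (d * h%:C)) (le_trans (cabsD _ _))// cabsM cabsR mulrDl mul1r.
by rewrite addrC lerD2l.
Qed.

Lemma pder_cont f t d : pder f t d -> f @ t --> f t.
Proof.
move=> /pder_lip[del del0 H]; apply/cvgCP => e e0; apply/nbhs_ballP.
have K0 : 0 < cabs d + 1 by rewrite ltr_wpDl ?cabs_ge0.
exists (Num.min del (e / (cabs d + 1))); first by rewrite /= lt_min del0 divr_gt0.
move=> w; rewrite /ball /= lt_min ltr_pdivlMr// => /andP[wd we].
rewrite distrC in wd; rewrite distrC in we.
have := H _ wd; rewrite [t + _]addrC subrK cabsB => /le_lt_trans; apply.
by rewrite mulrC.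
Qed.

Lemma pder_comp (F : CC R -> CC R) f t d D : cdiff F (f t) D -> pder f t d ->
  pder (fun w => F (f w)) t (D * d).
Proof.
move=> hF hf e e0; have [d1 d10 H1] := pder_lip hf.
set K := cabs d + 1 in H1 *.
have K0 : 0 < K by rewrite ltr_wpDl ?cabs_ge0.
have [d2 d20 H2] := hF (e / 2 / K) (divr_gt0 (divr_gt0 e0 (ltr0n _ 2)) K0).
set L := cabs D + 1.
have L0 : 0 < L by rewrite ltr_wpDl ?cabs_ge0.
have [d3 d30 H3] := hf (e / 2 / L) (divr_gt0 (divr_gt0 e0 (ltr0n _ 2)) L0).
exists (Num.min (Num.min d1 d3) (d2 / K)); first by rewrite !lt_min d10 d30 divr_gt0.
move=> h; rewrite !lt_min ltr_pdivlMr// => /andP[/andP[/H1 {}H1 /H3 {}H3] hK].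
have kd2 : cabs (f (t + h) - f t) < d2 by rewrite (le_lt_trans H1)// mulrC.
have := H2 _ kd2; rewrite [f t + _]addrC subrK => {}H2.
rewrite -[X in cabs X](subrK (D * (f (t + h) - f t - d * h%:C))).
have -> : F (f (t + h)) - F (f t) - D * d * h%:C - D * (f (t + h) - f t - d * h%:C) =
  F (f (t + h)) - F (f t) - D * (f (t + h) - f t) by ring.
rewrite (le_trans (cabsD _ _))// (splitr e) mulrDl lerD//.
  rewrite (le_trans H2)// -mulrA ler_pM2l ?divr_gt0//.
  by rewrite mulrC ler_pdivrMr// mulrC.
rewrite cabsM (le_trans (ler_wpM2l _ H3)) ?cabs_ge0//.
rewrite mulrA ler_wpM2r// mulrCA ler_piMr ?divr_ge0 ?ltW//.
by rewrite ltr_pdivrMr// mul1r ltrDl.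
Qed.

Lemma pder_sum (I : Type) (r : seq I) (F : I -> R -> CC R) (d : I -> CC R) t :
  (forall i, pder (F i) t (d i)) ->
  pder (fun x => \sum_(i <- r) F i x) t (\sum_(i <- r) d i).
Proof.
move=> dF; elim: r => [|i r IH].
  have -> : (fun x => \sum_(i <- [::]) F i x) = (fun=> 0) by apply/funext => x; rewrite big_nil.
  by rewrite big_nil; exact: pder_cst.
have -> : (fun x => \sum_(j <- i :: r) F j x) = (fun x => F i x + \sum_(j <- r) F j x).
  by apply/funext => x; rewrite big_cons.
by rewrite big_cons; exact: pderD (dF i) IH.
Qed.

End path_derivative.

(** * Path integrals *)

Section complex_limits.
Context {R : realType} {T : Type} (F : set_system T) {FF : Filter F}.
Implicit Types (f g : T -> CC R) (a b : CC R).

Lemma cvgC_cst a : (fun=> a) @ F --> a.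
Proof. exact: cvg_cst. Qed.

Lemma cvgCM f g a b : f @ F --> a -> g @ F --> b -> (fun x => f x * g x) @ F --> a * b.
Proof. by move=> fa gb; exact: (cvgM fa gb). Qed.

Lemma cvgCD f g a b : f @ F --> a -> g @ F --> b -> (fun x => f x + g x) @ F --> a + b.
Proof. by move=> fa gb; exact: (cvgD fa gb). Qed.

Lemma cvgCN f a : f @ F --> a -> (fun x => - f x) @ F --> - a.
Proof. by move=> fa; exact: (cvgN fa). Qed.

Lemma cvgCB f g a b : f @ F --> a -> g @ F --> b -> (fun x => f x - g x) @ F --> a - b.
Proof. by move=> fa gb; exact: (cvgB fa gb). Qed.

Lemma cvgCV f a : a != 0 -> f @ F --> a -> (fun x => (f x)^-1) @ F --> a^-1.
Proof. by move=> a0 fa; exact: (cvgV a0 fa). Qed.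

Lemma cvgCX f a n : f @ F --> a -> (fun x => f x ^+ n) @ F --> a ^+ n.
Proof.
move=> fa; elim: n => [|n IH]; first by rewrite expr0; exact: cvg_cst.
by rewrite exprS; under eq_fun do rewrite exprS; exact: cvgCM.
Qed.

Lemma cvgC_horner (p : {poly CC R}) f a : f @ F --> a -> (fun x => p.[f x]) @ F --> p.[a].
Proof.
move=> fa; elim/poly_ind: p => [|p c IH].
  by rewrite horner0; under eq_fun do rewrite horner0; exact: cvg_cst.
rewrite hornerMXaddC; under eq_fun do rewrite hornerMXaddC.
by apply: cvgCD; [exact: cvgCM|exact: cvg_cst].
Qed.

Lemma cvgC_sum (I : Type) (r : seq I) (P : pred I) (G : I -> T -> CC R) (l : I -> CC R) :
  (forall i, P i -> G i @ F --> l i) ->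
  (fun x => \sum_(i <- r | P i) G i x) @ F --> \sum_(i <- r | P i) l i.
Proof.
move=> Gl; elim: r => [|i r IH].
  by rewrite big_nil; under eq_fun do rewrite big_nil; exact: cvg_cst.
rewrite big_cons; under eq_fun do rewrite big_cons.
case: ifPn => Pi; last exact: IH.
exact: (cvgCD (Gl i Pi) IH).
Qed.

End complex_limits.

Lemma cvgC_cst_at {R : realType} (c u : CC R) : (fun=> c) @ u --> c.
Proof. exact: (@cvgC_cst R (CC R) (nbhs u) (nbhs_filter u) c). Qed.

Lemma cvgC_id_at {R : realType} (u : CC R) : (fun v => v) @ u --> u.
Proof. exact: cvg_id. Qed.

Section continuity_at_point.
Context {R : realType}.
Implicit Types (f g : CC R -> CC R) (u a b : CC R).
Let FF u := nbhs_filter u.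

Lemma cvgCM_at f g u a b : f @ u --> a -> g @ u --> b -> (fun x => f x * g x) @ u --> a * b.
Proof. exact: (@cvgCM R _ _ (FF u)). Qed.

Lemma cvgCD_at f g u a b : f @ u --> a -> g @ u --> b -> (fun x => f x + g x) @ u --> a + b.
Proof. exact: (@cvgCD R _ _ (FF u)). Qed.

Lemma cvgCN_at f u a : f @ u --> a -> (fun x => - f x) @ u --> - a.
Proof. exact: (@cvgCN R _ _ (FF u)). Qed.

Lemma cvgCB_at f g u a b : f @ u --> a -> g @ u --> b -> (fun x => f x - g x) @ u --> a - b.
Proof. exact: (@cvgCB R _ _ (FF u)). Qed.

Lemma cvgCV_at f u a : a != 0 -> f @ u --> a -> (fun x => (f x)^-1) @ u --> a^-1.
Proof. exact: (@cvgCV R _ _ (FF u)). Qed.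

Lemma cvgCX_at f u a n : f @ u --> a -> (fun x => f x ^+ n) @ u --> a ^+ n.
Proof. exact: (@cvgCX R _ _ (FF u)). Qed.

Lemma cvgC_horner_at (p : {poly CC R}) f u a : f @ u --> a -> (fun x => p.[f x]) @ u --> p.[a].
Proof. exact: (@cvgC_horner R _ _ (FF u)). Qed.

Lemma cvgC_sum_at (I : Type) (r : seq I) (P : pred I) (G : I -> CC R -> CC R) (l : I -> CC R) u :
  (forall i, P i -> G i @ u --> l i) ->
  (fun x => \sum_(i <- r | P i) G i x) @ u --> \sum_(i <- r | P i) l i.
Proof. exact: (@cvgC_sum R _ _ (FF u)). Qed.

Lemma cvgC_comp (g : CC R -> CC R) (T : Type) (F : set_system T) (FT : Filter F)
  (f : T -> CC R) (a b : CC R) :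
  f @ F --> a -> g @ a --> b -> (fun x => g (f x)) @ F --> b.
Proof. by move=> fa gb; exact: cvg_comp fa gb. Qed.

End continuity_at_point.

(** Continuity is two-sided even at the end points, which the integrands below satisfy; subspace
    topologies are thereby avoided. *)
Definition pcont {R : realType} (a b : R) (f : R -> CC R) :=
  forall s, a <= s <= b -> f @ s --> f s.

Section path_integral.
Context {R : realType}.
Implicit Types (a b : R) (f g : R -> CC R) (E : set R) (c : CC R).
Let mu := @lebesgue_measure R.

Lemma pcont_integrable a b f : pcont a b f -> cintegrable `[a, b] f.
Proof.
move=> cf; split; apply: continuous_compact_integrable; try exact: segment_compact.
  apply: continuous_in_subspaceT => s /set_mem /=; rewrite in_itv /= => /cf fs.
  exact: cvg_Re.
apply: continuous_in_subspaceT => s /set_mem /=; rewrite in_itv /= => /cf fs.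
exact: cvg_Im.
Qed.

Lemma cintegrableD E f g : measurable (E : set (measurableTypeR R)) -> cintegrable E f -> cintegrable E g ->
  cintegrable E (fun s => f s + g s).
Proof.
move=> mE [f1 f2] [g1 g2]; split.
  apply: (eq_integrable mE _ _ _ (integrableD mE f1 g1)) => s _ /=.
  by rewrite ReD EFinD.
apply: (eq_integrable mE _ _ _ (integrableD mE f2 g2)) => s _ /=.
by rewrite ImD EFinD.
Qed.

Lemma integrable_scale E (h : R -> R) (k : R) : measurable (E : set (measurableTypeR R)) -> mu.-integrable E (EFin \o h) ->
  mu.-integrable E (EFin \o (fun s => k * h s)).
Proof.
move=> mE h1; apply: (eq_integrable mE _ _ _ (integrableZl mE k h1)) => s _ /=.
by rewrite EFinM.
Qed.

Lemma cintegrableZ E c f : measurable (E : set (measurableTypeR R)) -> cintegrable E f ->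
  cintegrable E (fun s => c * f s).
Proof.
move=> mE [f1 f2]; have Z1 k := integrable_scale k mE f1.
have Z2 k := integrable_scale k mE f2.
split.
  apply: (eq_integrable mE _ _ _ (integrableB mE (Z1 (complex.Re c)) (Z2 (complex.Im c)))) => s _ /=.
  by rewrite ReM EFinB.
apply: (eq_integrable mE _ _ _ (integrableD mE (Z2 (complex.Re c)) (Z1 (complex.Im c)))) => s _ /=.
by rewrite ImM EFinD.
Qed.

Lemma cintD E f g : measurable (E : set (measurableTypeR R)) -> cintegrable E f -> cintegrable E g ->
  cint E (fun s => f s + g s) = cint E f + cint E g.
Proof.
move=> mE [f1 f2] [g1 g2]; apply: complexP => /=.
  rewrite -RintegralD//; apply: eq_Rintegral => s _; exact: ReD.
rewrite -RintegralD//; apply: eq_Rintegral => s _; exact: ImD.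
Qed.

Lemma cintZ E c f : measurable (E : set (measurableTypeR R)) -> cintegrable E f ->
  cint E (fun s => c * f s) = c * cint E f.
Proof.
move=> mE [f1 f2]; have Z1 k := integrable_scale k mE f1.
have Z2 k := integrable_scale k mE f2.
apply: complexP; rewrite ?ReM ?ImM /=.
  rewrite -!RintegralZl// -RintegralB//; apply: eq_Rintegral => s _; exact: ReM.
rewrite -!RintegralZl// -RintegralD//; apply: eq_Rintegral => s _; exact: ImM.
Qed.

Lemma eq_cint E f g : {in E, f =1 g} -> cint E f = cint E g.
Proof. by move=> fg; apply: complexP => /=; apply: eq_Rintegral => s sE; rewrite fg. Qed.

Lemma cintB E f g : measurable (E : set (measurableTypeR R)) -> cintegrable E f -> cintegrable E g ->
  cint E (fun s => f s - g s) = cint E f - cint E g.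
Proof.
move=> mE fi gi.
rewrite -[in RHS](mulN1r (cint E g)) -cintZ// -cintD//; last exact: cintegrableZ.
by apply: eq_cint => s _; rewrite mulN1r.
Qed.

(** Real and imaginary parts are estimated separately, whence the factor 2; only orders of magnitude
    matter later. *)
Lemma cint_le E f (g : R -> R) : measurable (E : set (measurableTypeR R)) -> cintegrable E f ->
  mu.-integrable E (EFin \o g) -> (forall s, E s -> cabs (f s) <= g s) ->
  cabs (cint E f) <= 2 * \int[mu]_(s in E) g s.
Proof.
move=> mE [f1 f2] gi fg; rewrite (le_trans (cabs_le _))// mulr_natl mulr2n /=.
have nf (h : R -> R) : mu.-integrable E (EFin \o h) ->
    mu.-integrable E (EFin \o (fun s => `|h s|)).
  by move=> hi; apply: (eq_integrable mE _ _ _ (integrable_abse hi)).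
apply: lerD; (apply: le_trans (le_normr_Rintegral mE _) _ => //);
  apply: le_Rintegral => //; try exact: nf; move=> s /fg; apply: le_trans.
  exact: cabs_Re.
exact: cabs_Im.
Qed.

Lemma cint_bound a b f (M : R) : a <= b -> pcont a b f ->
  (forall s, a <= s <= b -> cabs (f s) <= M) ->
  cabs (cint `[a, b] f) <= 2 * (M * (b - a)).
Proof.
move=> ab cf fM.
have Mi : mu.-integrable `[a, b] (EFin \o (fun=> M)).
  apply: continuous_compact_integrable; first exact: segment_compact.
  by apply: continuous_subspaceT => s; exact: cst_continuous.
have fM' s : `[a, b]%classic s -> cabs (f s) <= M by rewrite /= in_itv /=; exact: fM.
apply: le_trans (cint_le _ (pcont_integrable cf) Mi fM') _ => //.
rewrite Rintegral_cst//.
have mab : (mu `[a, b] = if (a%:E < b%:E)%E then b%:E - a%:E else 0)%E.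
  exact: (lebesgue_measure_itv `[a, b]).
set X := fine _; have -> : X = b - a.
  transitivity (fine (mu `[a, b])); first by [].
  rewrite mab lte_fin; case: ltP => //= ba.
  by apply/esym/eqP; rewrite subr_eq0 eq_le ab ba.
by [].
Qed.

Lemma cint_FTC a b f F : a <= b -> pcont a b f ->
  (forall s, a <= s <= b -> pder F s (f s)) -> cint `[a, b] f = F b - F a.
Proof.
rewrite le_eqVlt => /predU1P[<- _ _|ab cf dF].
  by rewrite subrr; apply: complexP => /=; rewrite set_itv1 Rintegral_set1.
have sub t : t \in `]a, b[ -> a <= t <= b.
  by rewrite in_itv /= => /andP[/ltW -> /ltW ->].
have ea : a <= a <= b by rewrite lexx ltW.
have eb : a <= b <= b by rewrite lexx ltW.
have key (p : CC R -> R) :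
    (forall t, a <= t <= b -> is_derive t 1 (fun s => p (F s)) (p (f t))) ->
    (forall t, a <= t <= b -> (fun s => p (f s)) @ t --> p (f t)) ->
    \int[mu]_(t in `[a, b]) p (f t) = p (F b) - p (F a).
  move=> dp cp.
  have cpF t : a <= t <= b -> (fun s => p (F s)) @ t --> p (F t).
    move=> /dp H; apply: differentiable_continuous.
    by apply/derivable1_diffP; exact: ex_derive.
  rewrite /Rintegral (@continuous_FTC2 _ (fun t => p (f t)) (fun t => p (F t)))//.
  - apply: continuous_in_subspaceT => s /set_mem /=; rewrite in_itv /=; exact: cp.
  - split.
    + by move=> t /sub /dp H; exact: ex_derive.
    + by apply: cvg_at_right_filter; exact: cpF.
    + by apply: cvg_at_left_filter; exact: cpF.
  - by move=> t /sub /dp H; rewrite derive1E; exact: derive_val.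
apply: complexP => /=.
  rewrite ReD ReN; apply: key => [t /dF /pderP[]//|t /cf]; exact: cvg_Re.
rewrite ImD ImN; apply: key => [t /dF /pderP[]//|t /cf]; exact: cvg_Im.
Qed.

End path_integral.

Lemma pder_near {R : realType} (f g : R -> CC R) (t : R) (d : CC R) :
  (\forall y \near t, f y = g y) -> pder f t d -> pder g t d.
Proof.
move=> /nbhs_ballP[d1 /= d10 fg] hf e e0; have [d2 d20 H] := hf e e0.
exists (Num.min d1 d2); first by rewrite lt_min d10.
move=> h; rewrite lt_min => /andP[h1 h2].
rewrite -!fg; first exact: H.
- by rewrite /ball /= subrr normr0.
- by rewrite /ball /= opprD addrA subrr add0r normrN.
Qed.

Lemma compact_cbound {R : realType} (T : topologicalType) (K : set T) (f : T -> CC R) :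
  compact K -> (forall x, K x -> f @ x --> f x) ->
  exists2 M : R, 0 < M & forall x, K x -> cabs (f x) <= M.
Proof.
move=> cK cf; have [->|/set0P K0] := eqVneq K set0; first by exists 1.
have cfK : {within K, continuous (cabs \o f)}.
  by apply: continuous_in_subspaceT => x /set_mem Kx; exact: cvg_cabs (cf x Kx).
have [c _ H] := compact_EVT_max K0 cK cfK.
exists (cabs (f c) + 1); first by rewrite ltr_wpDl ?cabs_ge0.
by move=> x Kx; rewrite (le_trans (H x (mem_set Kx)))//= lerDl.
Qed.

Section bounds_on_segments.
Context {R : realType}.
Implicit Types (a b : R) (f : R -> CC R).

Lemma pcont_bound a b f : pcont a b f ->
  exists2 M : R, 0 < M & forall s, a <= s <= b -> cabs (f s) <= M.
Proof.
move=> cf; have [s|M M0 H] := compact_cbound (@segment_compact R a b) (f := f).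
  by rewrite /= in_itv /=; exact: cf.
by exists M => // s sab; apply: H; rewrite /= in_itv.
Qed.

Lemma pcont_lower a b f : pcont a b f -> (forall s, a <= s <= b -> f s != 0) ->
  exists2 d : R, 0 < d & forall s, a <= s <= b -> d <= cabs (f s).
Proof.
move=> cf f0; have [s sab|M M0 H] := @pcont_bound a b (fun s => (f s)^-1).
  exact: cvgCV (f0 s sab) (cf s sab).
exists M^-1; first by rewrite invr_gt0.
move=> s sab; have := H s sab.
have fs : 0 < cabs (f s) by rewrite cabs_gt0 f0.
by rewrite cabsV => ?; rewrite -[leRHS]invrK lef_pV2 ?posrE ?invr_gt0.
Qed.

Lemma cint_pder a b (u v t M : R) (P dP : R -> R -> CC R) : u < t < v ->
  (forall x, u < x < v -> pcont a b (P x)) ->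
  (forall x s, u < x < v -> a <= s <= b -> pder (P^~ s) x (dP x s)) ->
  (forall x s, u < x < v -> a <= s <= b -> cabs (dP x s) <= M) ->
  pder (fun x => cint `[a, b] (P x)) t (cint `[a, b] (dP t)).
Proof.
move=> utv cP dPP bP.
have M_ge0 s : a <= s <= b -> 0 <= M by move=> /(bP _ _ utv); apply: le_trans; exact: cabs_ge0.
(* [M] is known to be nonnegative only when the segment is inhabited, so the dominating constant is
   [|M|]. *)
have Mi : (@lebesgue_measure R).-integrable `[a, b] (EFin \o (fun=> `|M|)).
  apply: continuous_compact_integrable; first exact: segment_compact.
  by apply: continuous_subspaceT => s; exact: cst_continuous.
have tI : `]u, v[%classic t by rewrite /= in_itv.
have key (p : CC R -> R) :
    (forall x, u < x < v ->
      (@lebesgue_measure R).-integrable `[a, b] (EFin \o (fun s => p (P x s)))) ->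
    (forall x s, u < x < v -> a <= s <= b -> is_derive x 1 (fun y => p (P y s)) (p (dP x s))) ->
    (forall z, `|p z| <= cabs z) ->
    is_derive t 1 (fun x => \int[lebesgue_measure]_(s in `[a, b]) p (P x s))
       (\int[lebesgue_measure]_(s in `[a, b]) p (dP t s)).
  move=> ip dp pb; pose f x s := p (P x s).
  have i1 x : `]u, v[%classic x ->
      (@lebesgue_measure R).-integrable `[a, b] (EFin \o f x).
    by rewrite /= in_itv /=; exact: ip.
  have i2 x y : `]u, v[%classic x -> `[a, b]%classic y -> derivable (f^~ y) x 1.
    by rewrite /= !in_itv /= => xuv yab; case: (dp _ _ xuv yab).
  have pE x y : `]u, v[%classic x -> `[a, b]%classic y -> partial1of2 f x y = p (dP x y).
    rewrite /= !in_itv /= => xuv yab; have D := dp _ _ xuv yab.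
    by rewrite partial1of2E; case: D.
  have i3 x y : `]u, v[%classic x -> `[a, b]%classic y -> `|partial1of2 f x y| <= `|M|.
    move=> xuv yab; rewrite pE// (le_trans (pb _))//.
    move: xuv yab; rewrite /= !in_itv /= => xuv yab.
    by rewrite (le_trans (bP _ _ xuv yab))// ler_norm.
  have H1 := @derivable_under_integral _ _ _ (@lebesgue_measure R) f `[a, b]
    (measurable_itv _) t u v tI i1 i2 (fun=> `|M|) (fun=> normr_ge0 _) Mi i3.
  have H2 := @differentiation_under_integral _ _ _ (@lebesgue_measure R) f `[a, b]
    (measurable_itv _) t u v tI i1 i2 (fun=> `|M|) (fun=> normr_ge0 _) Mi i3.
  apply: DeriveDef => //; rewrite -derive1E H2; apply: eq_Rintegral => s /set_mem sab.
  exact: pE.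
apply/pderP; split; apply: key.
- by move=> x /cP /pcont_integrable[].
- by move=> x s xuv sab; have /pderP[] := dPP x s xuv sab.
- exact: cabs_Re.
- by move=> x /cP /pcont_integrable[].
- by move=> x s xuv sab; have /pderP[] := dPP x s xuv sab.
- exact: cabs_Im.
Qed.

Lemma cint_cvg_param a b (u v t M : R) (P : R -> R -> CC R) : u < t < v ->
  (forall x, u < x < v -> pcont a b (P x)) ->
  (forall x s, u < x < v -> a <= s <= b -> P^~ s @ x --> P x s) ->
  (forall x s, u < x < v -> a <= s <= b -> cabs (P x s) <= M) ->
  (fun x => cint `[a, b] (P x)) @ t --> cint `[a, b] (P t).
Proof.
move=> utv cP ccP bP.
have Mi : (@lebesgue_measure R).-integrable `[a, b] (EFin \o (fun=> M)).
  apply: continuous_compact_integrable; first exact: segment_compact.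
  by apply: continuous_subspaceT => s; exact: cst_continuous.
have tI : t \in `]u, v[%classic by rewrite inE /= in_itv.
have key (p : CC R -> R) :
    (forall x, u < x < v ->
      (@lebesgue_measure R).-integrable `[a, b] (EFin \o (fun s => p (P x s)))) ->
    (forall x s, u < x < v -> a <= s <= b -> (fun y => p (P y s)) @ x --> (p (P x s))) ->
    (forall z, `|p z| <= cabs z) ->
    (fun x => \int[lebesgue_measure]_(s in `[a, b]) p (P x s)) @ t -->
       (\int[lebesgue_measure]_(s in `[a, b]) p (P t s)).
  move=> ip dp pb.
  apply: (@continuity_under_integral _ _ _ (@lebesgue_measure R) (fun x s => p (P x s)) `[a, b]
    (measurable_itv _) u v _ _ (fun=> M) Mi _ t tI).
  - by move=> x; rewrite /= in_itv /=; exact: ip.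
  - apply: aeW => s /=; rewrite in_itv /= => sab x /set_mem /=; rewrite in_itv /= => xuv.
    exact: dp.
  - move=> x; rewrite /= in_itv /= => xuv; apply: aeW => s /=; rewrite in_itv /= => sab.
    by rewrite (le_trans (pb _))// bP.
apply/(@cvgC_ReIm _ _ (nbhs t) (nbhs_filter t)); split; apply: key.
- by move=> x /cP /pcont_integrable[].
- by move=> x s xuv sab; exact: cvg_Re (ccP x s xuv sab).
- exact: cabs_Re.
- by move=> x /cP /pcont_integrable[].
- by move=> x s xuv sab; exact: cvg_Im (ccP x s xuv sab).
- exact: cabs_Im.
Qed.

End bounds_on_segments.

(** * Cauchy formula on star-shaped contours *)

Record piece (R : realType) := Piece {
  p_lo : R; p_hi : R; p_path : R -> CC R; p_vel : R -> CC R }.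

Definition is_piece {R : realType} (p : piece R) :=
  p_lo p <= p_hi p /\ forall s, p_lo p <= s <= p_hi p ->
    pder (p_path p) s (p_vel p s) /\ p_vel p @ s --> p_vel p s.

Section contour.
Context {R : realType} (n : nat) (P : 'I_n -> piece R).
Hypothesis okP : forall i, is_piece (P i).

Definition on_contour (u : CC R) :=
  exists i s, p_lo (P i) <= s <= p_hi (P i) /\ u = p_path (P i) s.

Definition oint (f : CC R -> CC R) : CC R :=
  \sum_(i < n) cint `[p_lo (P i), p_hi (P i)] (fun s => f (p_path (P i) s) * p_vel (P i) s).

(** The boundary of the contour vanishes as a formal sum of points. No order or adjacency of the
    pieces is prescribed, and this is exactly what the fundamental theorem of calculus asks for when
    it is summed over the pieces. *)
Definition closed_contour := forall F : CC R -> CC R,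
  \sum_(i < n) (F (p_path (P i) (p_hi (P i))) - F (p_path (P i) (p_lo (P i)))) = 0.

Definition cont_on (f : CC R -> CC R) := forall u, on_contour u -> f @ u --> f u.

Lemma path_cvg i s : p_lo (P i) <= s <= p_hi (P i) -> p_path (P i) @ s --> p_path (P i) s.
Proof. by move=> /(proj2 (okP i))[H _]; exact: pder_cont H. Qed.

Lemma vel_cvg i s : p_lo (P i) <= s <= p_hi (P i) -> p_vel (P i) @ s --> p_vel (P i) s.
Proof. by move=> /(proj2 (okP i))[]. Qed.

Lemma on_contour_path i s : p_lo (P i) <= s <= p_hi (P i) -> on_contour (p_path (P i) s).
Proof. by exists i, s. Qed.

Lemma cont_on_comp f i s : cont_on f -> p_lo (P i) <= s <= p_hi (P i) ->
  (fun s => f (p_path (P i) s)) @ s --> f (p_path (P i) s).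
Proof.
move=> cf sP; have := cf _ (on_contour_path sP).
exact: cvg_comp (path_cvg sP).
Qed.

Lemma pcont_oint f i : cont_on f ->
  pcont (p_lo (P i)) (p_hi (P i)) (fun s => f (p_path (P i) s) * p_vel (P i) s).
Proof. by move=> cf s sP; exact: cvgCM (cont_on_comp cf sP) (vel_cvg sP). Qed.

Lemma eq_oint f g : (forall u, on_contour u -> f u = g u) -> oint f = oint g.
Proof.
move=> fg; apply: eq_bigr => i _; apply: eq_cint => s /set_mem /=; rewrite in_itv /= => sP.
by rewrite fg//; exact: on_contour_path.
Qed.

Lemma ointD f g : cont_on f -> cont_on g -> oint (fun u => f u + g u) = oint f + oint g.
Proof.
move=> cf cg; rewrite -big_split /=; apply: eq_bigr => i _.
rewrite -cintD//; [|exact/pcont_integrable/pcont_oint..].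
by apply: eq_cint => s _; rewrite mulrDl.
Qed.

Lemma ointZ c f : cont_on f -> oint (fun u => c * f u) = c * oint f.
Proof.
move=> cf; rewrite mulr_sumr; apply: eq_bigr => i _.
rewrite -cintZ//; last exact/pcont_integrable/pcont_oint.
by apply: eq_cint => s _; rewrite mulrA.
Qed.

Lemma oint0 : oint (fun=> 0) = 0.
Proof.
transitivity (0 * oint (fun=> 0)); last exact: mul0r.
have c0 : cont_on (fun=> 0) by move=> u _; exact: cvgC_cst_at.
by rewrite -(ointZ 0 c0); apply: eq_oint => u _; rewrite mul0r.
Qed.

Lemma oint_sum (I : Type) (r : seq I) (F : I -> CC R -> CC R) :
  (forall i, cont_on (F i)) ->
  oint (fun u => \sum_(i <- r) F i u) = \sum_(i <- r) oint (F i).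
Proof.
move=> cF; elim: r => [|i r IH].
  by rewrite big_nil -[RHS]oint0; apply: eq_oint => u _; rewrite big_nil.
rewrite big_cons -IH -ointD//.
  by apply: eq_oint => u _; rewrite big_cons.
by move=> u uP; apply: cvgC_sum_at => j _; exact: cF.
Qed.

Lemma oint_FTC F f : cont_on f -> (forall u, on_contour u -> cdiff F u (f u)) ->
  closed_contour -> oint f = 0.
Proof.
move=> cf dF /(_ F) <-; apply: eq_bigr => i _.
apply: (@cint_FTC _ _ _ _ (fun s => F (p_path (P i) s))).
- by case: (okP i).
- exact: pcont_oint.
move=> s sP; apply: pder_comp; first exact: dF (on_contour_path sP).
by have [] := proj2 (okP i) s sP.
Qed.

(** The integrand has the primitive [u -> H (a + t (u - a)) / t], so its integral is a sum of end
    point differences. *)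
Lemma oint_FTC_star (H H' : CC R -> CC R) (a : CC R) (t : R) : 0 < t ->
  closed_contour ->
  (forall u, on_contour u -> cdiff H (a + t%:C * (u - a)) (H' (a + t%:C * (u - a)))) ->
  (forall u, on_contour u -> H' @ (a + t%:C * (u - a)) --> H' (a + t%:C * (u - a))) ->
  oint (fun u => H' (a + t%:C * (u - a))) = 0.
Proof.
move=> t0 cl dH cH.
have t0' : (t%:C : CC R) != 0 by rewrite (inj_eq (@complexI R) t 0) gt_eqF.
have cmap u : (fun v : CC R => a + t%:C * (v - a)) @ u --> a + t%:C * (u - a).
  apply: cvgCD_at; first exact: cvgC_cst_at.
  by apply: cvgCM_at; [exact: cvgC_cst_at|apply: cvgCB_at; [exact: cvgC_id_at|exact: cvgC_cst_at]].
apply: (@oint_FTC (fun u => t%:C^-1 * H (a + t%:C * (u - a))) _ _ _ cl).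
  move=> u uP; have := cH u uP.
  exact: (cvgC_comp (nbhs_filter u) (cmap u)).
move=> u uP; apply: cdiff_eq.
- apply: cdiffZ; apply: cdiff_comp; first exact: dH.
  apply: cdiffD; first exact: cdiff_cst.
  by apply: cdiffZ; apply: cdiffB; [exact: cdiff_id|exact: cdiff_cst].
- by field.
Qed.

End contour.

Lemma const_of_pder {R : realType} (f : R -> CC R) (a b : R) : a < b ->
  (forall t, a < t < b -> pder f t 0) -> (forall t, a <= t <= b -> f @ t --> f t) ->
  f a = f b.
Proof.
move=> ab df cf.
have key (p : CC R -> R) :
    (forall t, a < t < b -> is_derive t 1 (fun s => p (f s)) 0) ->
    (forall t, a <= t <= b -> (fun s => p (f s)) @ t --> p (f t)) -> p (f a) = p (f b).
  move=> dp cp.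
  have dp' t : t \in `]a, b[ -> is_derive t 1 (fun s => p (f s)) (cst 0 t).
    by rewrite in_itv /=; exact: dp.
  have cp' : {within `[a, b], continuous (fun s => p (f s))}.
    by apply: continuous_in_subspaceT => t /set_mem /=; rewrite in_itv /=; exact: cp.
  have [c _] := MVT ab dp' cp'.
  by rewrite mul0r => /eqP; rewrite subr_eq0 => /eqP.
apply: complexP; apply: key.
- by move=> t /df /pderP[].
- by move=> t /cf; exact: cvg_Re.
- by move=> t /df /pderP[].
- by move=> t /cf; exact: cvg_Im.
Qed.

(** Truncating the homotopy parameter makes the integrals of [cauchy_star] functions of all real
    [t], continuous from both sides at [0] and [1], while [H] is evaluated in the closed half plane
    only. *)
Definition clamp {R : realType} (t : R) := Num.max 0 (Num.min 1 t).

Lemma clamp_id {R : realType} (t : R) : 0 <= t <= 1 -> clamp t = t.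
Proof. by move=> /andP[t0 t1]; rewrite /clamp min_r// max_r. Qed.

Lemma clamp_itv {R : realType} (t : R) : 0 <= clamp t <= 1.
Proof. by rewrite /clamp le_max lexx /= ge_max ler01 ge_min lexx. Qed.

Lemma clamp_cvg {R : realType} (t : R) : (clamp : R -> R) @ t --> clamp t.
Proof.
apply: (@continuous_max R R (cst 0) (fun s => Num.min 1 s)); first exact: cvg_cst.
by apply: (@continuous_min R R (cst 1) id); [exact: cvg_cst|exact: cvg_id].
Qed.

Lemma fst_cvg {R : realType} (x s : R) : (fun p : R * R => p.1) @ (x, s) --> x.
Proof. by apply: (@cvg_fst R R (nbhs x) (nbhs s)). Qed.
Lemma snd_cvg {R : realType} (x s : R) : (fun p : R * R => p.2) @ (x, s) --> s.
Proof. by apply: (@cvg_snd R R (nbhs x) (nbhs s)). Qed.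

Section cauchy_star.
Context {R : realType} (n : nat) (P : 'I_n -> piece R).
Hypothesis okP : forall i, is_piece (P i).
Hypothesis clP : closed_contour P.
Variables (H H' : CC R -> CC R) (a : CC R).
Hypothesis a0 : 0 < complex.Re a.
Hypothesis P0 : forall u, on_contour P u -> 0 <= complex.Re u.
Hypothesis aP : forall u, on_contour P u -> u - a != 0.
Hypothesis cH : forall u : CC R, 0 <= complex.Re u -> H @ u --> H u.
Hypothesis dH : forall u : CC R, 0 < complex.Re u -> cdiff H u (H' u).
Hypothesis cH' : forall u : CC R, 0 < complex.Re u -> H' @ u --> H' u.

Let ray (t : R) (u : CC R) := a + t%:C * (u - a).

Let ReRay t u : complex.Re (ray t u) = (1 - t) * complex.Re a + t * complex.Re u.
Proof. by rewrite /ray !ReImE /=; ring. Qed.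

Let ray_ge0 (t : R) (u : CC R) : 0 <= t <= 1 -> on_contour P u -> 0 <= complex.Re (ray t u).
Proof.
move=> /andP[t0 t1] /P0 u0; rewrite ReRay addr_ge0// mulr_ge0 ?subr_ge0//.
exact: ltW.
Qed.

Let ray_gt0 (t : R) (u : CC R) : 0 < t < 1 -> on_contour P u -> 0 < complex.Re (ray t u).
Proof.
move=> /andP[t0 t1] /P0 u0; rewrite ReRay ltr_wpDr ?mulr_gt0 ?subr_gt0//.
by rewrite mulr_ge0// ltW.
Qed.

Let cvg_ray i (T : Type) (F : set_system T) (FF : Filter F) (f : T -> R) (g : T -> R) (t s : R) :
  p_lo (P i) <= s <= p_hi (P i) -> f @ F --> t -> g @ F --> s ->
  (fun x => ray (f x) (p_path (P i) (g x))) @ F --> ray t (p_path (P i) s).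
Proof.
move=> sP ft gs; apply: cvgCD; first exact: cvgC_cst.
apply: cvgCM; first exact: cvg_real.
apply: cvgCB; last exact: cvgC_cst.
exact: cvg_comp gs (path_cvg okP sP).
Qed.

Let cvg_vel i (T : Type) (F : set_system T) (FF : Filter F) (g : T -> R) (s : R) :
  p_lo (P i) <= s <= p_hi (P i) -> g @ F --> s ->
  (fun x => p_vel (P i) (g x)) @ F --> p_vel (P i) s.
Proof. by move=> sP gs; exact: cvg_comp gs (vel_cvg okP sP). Qed.

Let cvg_den i (T : Type) (F : set_system T) (FF : Filter F) (g : T -> R) (s : R) :
  p_lo (P i) <= s <= p_hi (P i) -> g @ F --> s ->
  (fun x => (p_path (P i) (g x) - a)^-1) @ F --> (p_path (P i) s - a)^-1.
Proof.
move=> sP gs; apply: cvgCV; first by apply: aP; exact: on_contour_path.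
apply: cvgCB; last exact: cvgC_cst.
exact: cvg_comp gs (path_cvg okP sP).
Qed.

Let Phi i (t s : R) := H (ray (clamp t) (p_path (P i) s)) / (p_path (P i) s - a) * p_vel (P i) s.

Let cvg_Phi i (T : Type) (F : set_system T) (FF : Filter F) (f : T -> R) (g : T -> R) (t s : R) :
  p_lo (P i) <= s <= p_hi (P i) -> f @ F --> t -> g @ F --> s ->
  (fun x => Phi i (f x) (g x)) @ F --> Phi i t s.
Proof.
move=> sP ft gs; apply: cvgCM; last exact: cvg_vel.
apply: cvgCM; last exact: cvg_den.
have cc : (fun x => clamp (f x)) @ F --> clamp t by apply: cvg_comp ft _; exact: clamp_cvg.
apply: (cvgC_comp FF (cvg_ray FF sP cc gs)); apply: cH.
by apply: ray_ge0; [exact: clamp_itv|exact: on_contour_path].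
Qed.

Let Phi_s i (t : R) : pcont (p_lo (P i)) (p_hi (P i)) (Phi i t).
Proof.
move=> s sP; apply: (@cvg_Phi i _ _ (nbhs_filter s) (fun=> t) id t s sP).
  exact: cvg_cst.
exact: cvg_id.
Qed.

Let Phi_t i (t s : R) : p_lo (P i) <= s <= p_hi (P i) -> Phi i ^~ s @ t --> Phi i t s.
Proof.
move=> sP; apply: (@cvg_Phi i _ _ (nbhs_filter t) id (fun=> s) t s sP).
  exact: cvg_id.
exact: cvg_cst.
Qed.

(** Differentiating [H (a + t (u - a)) / (u - a)] in [t] produces the factor [u - a], which cancels
    the denominator; what is left falls under [oint_FTC_star]. *)
Let dPhi i (t s : R) := H' (ray t (p_path (P i) s)) * p_vel (P i) s.

Let cvg_dPhi i (T : Type) (F : set_system T) (FF : Filter F) (f : T -> R) (g : T -> R) (t s : R) :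
  0 < t < 1 -> p_lo (P i) <= s <= p_hi (P i) -> f @ F --> t -> g @ F --> s ->
  (fun x => dPhi i (f x) (g x)) @ F --> dPhi i t s.
Proof.
move=> t01 sP ft gs; apply: cvgCM; last exact: cvg_vel.
apply: (cvgC_comp FF (cvg_ray FF sP ft gs)); apply: cH'.
by apply: ray_gt0 => //; exact: on_contour_path.
Qed.

Let rect_bound i (f : R -> R -> CC R) (t0 t1 : R) :
  (forall t s, t0 <= t <= t1 -> p_lo (P i) <= s <= p_hi (P i) ->
     (fun x : R * R => f x.1 x.2) @ (t, s) --> f t s) ->
  exists2 M : R, 0 < M & forall t s, t0 <= t <= t1 -> p_lo (P i) <= s <= p_hi (P i) ->
    cabs (f t s) <= M.
Proof.
move=> cf.
have cK : compact (`[t0, t1]%classic `*` `[p_lo (P i), p_hi (P i)]%classic).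
  by apply: compact_setX; exact: segment_compact.
have [[t s]|M M0 HM] := compact_cbound cK (f := fun x : R * R => f x.1 x.2).
  by move=> [/=]; rewrite !in_itv /=; exact: cf.
exists M => // t s tI sI; apply: (HM (t, s)).
by split => /=; rewrite in_itv.
Qed.

Let cint_Phi_cvg i (t : R) : -1 < t < 2 ->
  (fun x => cint `[p_lo (P i), p_hi (P i)] (Phi i x)) @ t -->
  cint `[p_lo (P i), p_hi (P i)] (Phi i t).
Proof.
move=> t12; have [x s xI sI|M M0 HM] := @rect_bound i (Phi i) (-1) 2.
  exact: (@cvg_Phi i _ _ (nbhs_filter (x, s)) fst snd x s sI (@fst_cvg R x s) (@snd_cvg R x s)).
apply: (@cint_cvg_param _ _ _ (-1) 2 t M (Phi i)) => //.
- by move=> x s _; exact: Phi_t.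
- by move=> x s /andP[x1 x2] sP; apply: HM => //; rewrite !ltW.
Qed.

Let cint_Phi_der i (t : R) : 0 < t < 1 ->
  pder (fun x => cint `[p_lo (P i), p_hi (P i)] (Phi i x)) t
       (cint `[p_lo (P i), p_hi (P i)] (dPhi i t)).
Proof.
(* The parameters stay in [[u, v]], a compact part of []0, 1[]: there the rays keep away from the
   imaginary axis, near which [H'] may be unbounded. *)
move=> /andP[t0 t1]; pose u := t / 2; pose v := (1 + t) / 2.
have u0 : 0 < u by rewrite /u; lra.
have v1 : v < 1 by rewrite /v; lra.
have [x s /andP[xu xv] sI|M M0 HM] := @rect_bound i (dPhi i) u v.
  apply: (@cvg_dPhi i _ _ (nbhs_filter (x, s)) fst snd x s _ sI (@fst_cvg R x s) (@snd_cvg R x s)).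
  by rewrite (lt_le_trans u0)//= (le_lt_trans xv).
apply: (@cint_pder _ _ _ u v t M (Phi i) (dPhi i)).
- by apply/andP; split; rewrite /u /v; lra.
- by move=> x _; exact: Phi_s.
- move=> x s /andP[xu xv] sP.
  have x0 : 0 < x by rewrite (lt_trans u0).
  have x1 : x < 1 by rewrite (lt_trans xv).
  apply: (@pder_near _ (fun y => H (ray y (p_path (P i) s)) / (p_path (P i) s - a) * p_vel (P i) s)).
    have xin : x \in `]0, 1[ by rewrite in_itv /= x0.
    apply: filterS (near_in_itvoo xin) => y; rewrite in_itv /= => /andP[y0 y1].
    by rewrite /Phi clamp_id// !ltW.
  set p := p_path (P i) s.
  have dray : pder (fun y => ray y p) x (p - a).
    apply: pder_eq; first apply: pderD; first exact: pder_cst.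
      apply: pderM; last exact: pder_cst.
      by apply: (pder_real (f := id)); exact: is_derive_id.
    by rewrite /=; ring.
  have rx : 0 < complex.Re (ray x p).
    by apply: ray_gt0; [rewrite x0|exact: on_contour_path].
  have D1 := pder_comp (dH rx) dray.
  have D2 := pderM (pderM D1 (pder_cst (p - a)^-1 x)) (pder_cst (p_vel (P i) s) x).
  apply: pder_eq D2 _.
  have := aP (on_contour_path sP); rewrite -/p => pa.
  by rewrite /dPhi -/p; field.
- by move=> x s /andP[xu xv] sP; apply: HM => //; rewrite !ltW.
Qed.

(* The integral of [H (a + t (u - a)) / (u - a)] does not depend on [t] in [[0, 1]]. *)
Lemma cauchy_star :
  oint P (fun u => H u / (u - a)) = H a * oint P (fun u => (u - a)^-1).
Proof.
pose phi t := \sum_(i < n) cint `[p_lo (P i), p_hi (P i)] (Phi i t).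
have phi1 : phi 1 = oint P (fun u => H u / (u - a)).
  apply: eq_bigr => i _; apply: eq_cint => s _.
  rewrite /Phi clamp_id ?ler01 ?lexx//.
  by congr (H _ / _ * _); rewrite /ray; ring.
have phi0 : phi 0 = H a * oint P (fun u => (u - a)^-1).
  rewrite -ointZ//; last first.
    move=> u uP; apply: cvgCV_at; first exact: aP.
    by apply: cvgCB_at; [exact: cvgC_id_at|exact: cvgC_cst_at].
  apply: eq_bigr => i _; apply: eq_cint => s _.
  rewrite /Phi clamp_id ?ler01 ?lexx//.
  by congr (H _ / _ * _); rewrite /ray; ring.
rewrite -phi1 -phi0; symmetry; apply: const_of_pder => //.
  move=> t t01; have -> : (0 : CC R) = \sum_(i < n) cint `[p_lo (P i), p_hi (P i)] (dPhi i t).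
    symmetry; apply: (@oint_FTC_star _ _ P okP H H' a t) => //.
    - by case/andP: t01.
    - by move=> u uP; apply: dH; exact: ray_gt0.
    - by move=> u uP; apply: cH'; exact: ray_gt0.
  by apply: pder_sum => i; exact: cint_Phi_der.
move=> t /andP[t0 t1]; apply: cvgC_sum => i _; apply: cint_Phi_cvg.
by apply/andP; split; lra.
Qed.

End cauchy_star.

(** * Differentiation of Cauchy kernels *)

Lemma cdiff_sum {R : realType} (I : Type) (r : seq I) (F : I -> CC R -> CC R) (d : I -> CC R) z :
  (forall i, cdiff (F i) z (d i)) ->
  cdiff (fun x => \sum_(i <- r) F i x) z (\sum_(i <- r) d i).
Proof.
move=> dF; elim: r => [|i r IH].
  have -> : (fun x => \sum_(i <- [::]) F i x) = (fun=> 0) by apply/funext => x; rewrite big_nil.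
  by rewrite big_nil; exact: cdiff_cst.
have -> : (fun x => \sum_(j <- i :: r) F j x) = (fun x => F i x + \sum_(j <- r) F j x).
  by apply/funext => x; rewrite big_cons.
by rewrite big_cons; exact: cdiffD (dF i) IH.
Qed.

Section kernel_derivative.
Context {R : realType}.

(** The equation [y - x = b * x * y] is the one satisfied by the reciprocals
    [x = 1 / (alpha - beta z)] and [y = 1 / (alpha - beta (z + h))] with [b = beta h]. In this form
    the induction on [N] involves no division, and the constant depends on [N] and [L] only. *)
Lemma pow_diff_bound (N : nat) (L : R) : 0 <= L -> exists2 C : R, 0 <= C &
  forall x y b : CC R, cabs x <= L -> cabs y <= L -> y - x = b * x * y ->
  cabs (y ^+ N - x ^+ N) <= C * cabs b.
Proof.
move=> L0; elim: N => [|N [C C0 IH]].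
  by exists 0 => // x y b _ _ _; rewrite !expr0 subrr cabs0 mul0r.
exists (L * C + L ^+ 2 * L ^+ N); first by rewrite addr_ge0 ?mulr_ge0 ?exprn_ge0.
move=> x y b xL yL xy.
have -> : y ^+ N.+1 - x ^+ N.+1 = x * (y ^+ N - x ^+ N) + (y - x) * y ^+ N.
  by rewrite !exprS; ring.
apply: (le_trans (cabsD _ _)); rewrite [leRHS]mulrDl; apply: lerD.
  rewrite cabsM -[leRHS]mulrA; apply: ler_pM => //; rewrite ?cabs_ge0//.
  exact: IH.
rewrite xy !cabsM cabsX.
have -> : cabs b * cabs x * cabs y * cabs y ^+ N = (cabs x * cabs y) * cabs y ^+ N * cabs b by ring.
apply: ler_wpM2r; first exact: cabs_ge0.
apply: ler_pM; rewrite ?mulr_ge0 ?exprn_ge0 ?cabs_ge0//.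
  by rewrite expr2; apply: ler_pM; rewrite ?cabs_ge0.
by rewrite lerXn2r ?nnegrE ?cabs_ge0.
Qed.

Lemma pow_diff2_bound (N : nat) (L : R) : 0 <= L -> exists2 C : R, 0 <= C &
  forall x y b : CC R, cabs x <= L -> cabs y <= L -> y - x = b * x * y ->
  cabs (y ^+ N - x ^+ N - N%:R * b * x ^+ N.+1) <= C * cabs b ^+ 2.
Proof.
move=> L0; elim: N => [|N [C C0 IH]].
  by exists 0 => // x y b _ _ _; rewrite !expr0 subrr !mul0r subrr cabs0.
have [D D0 HD] := pow_diff_bound N.+1 L0.
exists (L * C + L * D); first by rewrite addr_ge0 ?mulr_ge0.
move=> x y b xL yL xy.
have -> : y ^+ N.+1 - x ^+ N.+1 - N.+1%:R * b * x ^+ N.+2 =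
  x * (y ^+ N - x ^+ N - N%:R * b * x ^+ N.+1) + b * (x * (y ^+ N.+1 - x ^+ N.+1)).
  have yE : y ^+ N.+1 = x * y ^+ N + b * x * y ^+ N.+1.
    have yE' : y = x + b * x * y by rewrite -xy; ring.
    by rewrite [LHS]exprS {1}yE' exprS; ring.
  by rewrite {1}yE -natr1 !exprS; ring.
apply: (le_trans (cabsD _ _)); rewrite [leRHS]mulrDl; apply: lerD.
  rewrite cabsM -[leRHS]mulrA; apply: ler_pM => //; rewrite ?cabs_ge0//.
  exact: IH.
rewrite !cabsM.
have -> : L * D * cabs b ^+ 2 = cabs b * (L * (D * cabs b)) by ring.
apply: ler_wpM2l; rewrite ?cabs_ge0//.
apply: ler_pM; rewrite ?cabs_ge0//.
exact: HD.
Qed.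

(** The denominators stay away from [0] along the segment, so [pow_diff2_bound] gives a remainder of
    order [|h|^2] uniformly in [s], which can be integrated. *)
Lemma cint_kernel_cdiff (a b : R) (psi alpha beta : R -> CC R) (N : nat) (z : CC R) :
  a <= b -> pcont a b psi -> pcont a b alpha -> pcont a b beta ->
  (forall s, a <= s <= b -> alpha s - beta s * z != 0) ->
  cdiff (fun w => cint `[a, b] (fun s => psi s / (alpha s - beta s * w) ^+ N)) z
    (N%:R * cint `[a, b] (fun s => psi s * beta s / (alpha s - beta s * z) ^+ N.+1)).
Proof.
move=> ab cpsi calpha cbeta nz.
have cden w : pcont a b (fun s => alpha s - beta s * w).
  move=> s sab; apply: cvgCB; first exact: calpha.
  by apply: cvgCM; [exact: cbeta|exact: cvgC_cst].
have [d d0 Hd] := pcont_lower (cden z) nz.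
have [B B0 HB] := pcont_bound cbeta.
have [M M0 HM] := pcont_bound cpsi.
pose L := 2 / d.
have L0 : 0 <= L by rewrite divr_ge0// ltW.
have [C C0 HC] := pow_diff2_bound N L0.
move=> e e0.
pose K := 2 * (M * (C * B ^+ 2) * (b - a)).
have K0 : 0 <= K by rewrite !mulr_ge0// ?exprn_ge0// ?subr_ge0// ltW.
(* The first radius keeps the perturbed denominators above [d / 2], half of their lower bound; the
   second turns the integrated remainder [K |h|^2] into [e |h|]. *)
exists (Num.min (d / (2 * B)) (e / (K + 1))).
  by rewrite lt_min !divr_gt0// ?mulr_gt0// ltr_wpDl.
move=> h; rewrite lt_min => /andP[h1 h2].
have hB s : a <= s <= b -> cabs (beta s * h) <= d / 2.
  move=> sab; rewrite cabsM.
  apply: (@le_trans _ _ (B * (d / (2 * B)))); last first.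
    by rewrite le_eqVlt; apply/orP; left; apply/eqP; field; rewrite gt_eqF.
  by apply: ler_pM; rewrite ?cabs_ge0 ?HB// ltW.
have den s : a <= s <= b -> d / 2 <= cabs (alpha s - beta s * (z + h)).
  move=> sab; have := Hd s sab; have := hB s sab.
  have -> : alpha s - beta s * (z + h) = (alpha s - beta s * z) - beta s * h by ring.
  set X := alpha s - beta s * z; set Y := beta s * h.
  have : cabs X <= cabs (X - Y) + cabs Y by rewrite -{1}(subrK Y X) cabsD.
  by lra.
have den0 s : a <= s <= b -> alpha s - beta s * (z + h) != 0.
  by move=> /den; rewrite -cabs_gt0; apply: lt_le_trans; rewrite divr_gt0.
have cq w : (forall s, a <= s <= b -> alpha s - beta s * w != 0) ->
    pcont a b (fun s => psi s / (alpha s - beta s * w) ^+ N).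
  move=> w0 s sab; apply: cvgCM; first exact: cpsi.
  by apply: cvgCV; [rewrite expf_neq0// w0|apply: cvgCX; exact: cden].
have cq' : pcont a b (fun s => psi s * beta s / (alpha s - beta s * z) ^+ N.+1).
  move=> s sab; apply: cvgCM; first by apply: cvgCM; [exact: cpsi|exact: cbeta].
  by apply: cvgCV; [rewrite expf_neq0// nz|apply: cvgCX; exact: cden].
have mab : measurable (`[a, b]%classic : set (measurableTypeR R)) by exact: measurable_itv.
have i1 := pcont_integrable (cq _ den0); have i2 := pcont_integrable (cq _ nz).
have i3 := pcont_integrable cq'.
have i3' := cintegrableZ (N%:R * h) mab i3.
rewrite -(cintB mab i1 i2).
rewrite [_ * h]mulrAC -(cintZ (N%:R * h) mab i3) -(cintB mab _ i3'); last first.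
  have := cintegrableD mab i1 (cintegrableZ (-1) mab i2).
  by congr (cintegrable _ _); apply/funext => s; rewrite mulN1r.
have cdif : pcont a b (fun s => psi s / (alpha s - beta s * (z + h)) ^+ N -
    psi s / (alpha s - beta s * z) ^+ N - N%:R * h * (psi s * beta s / (alpha s - beta s * z) ^+ N.+1)).
  move=> s sab; apply: cvgCB; first by apply: cvgCB; exact: cq.
  by apply: cvgCM; [exact: cvgC_cst|exact: cq'].
have bd s : a <= s <= b -> cabs (psi s / (alpha s - beta s * (z + h)) ^+ N -
    psi s / (alpha s - beta s * z) ^+ N - N%:R * h * (psi s * beta s / (alpha s - beta s * z) ^+ N.+1))
    <= M * (C * B ^+ 2) * cabs h ^+ 2.
  move=> sab.
  pose x := (alpha s - beta s * z)^-1; pose y := (alpha s - beta s * (z + h))^-1.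
  have -> : psi s / (alpha s - beta s * (z + h)) ^+ N -
    psi s / (alpha s - beta s * z) ^+ N - N%:R * h * (psi s * beta s / (alpha s - beta s * z) ^+ N.+1)
    = psi s * (y ^+ N - x ^+ N - N%:R * (beta s * h) * x ^+ N.+1).
    by rewrite /x /y !exprVn; ring.
  rewrite cabsM -[leRHS]mulrA; apply: ler_pM; rewrite ?cabs_ge0 ?HM//.
  apply: (le_trans (HC x y (beta s * h) _ _ _)).
  - rewrite cabsV /L invf_ple ?posrE ?divr_gt0// ?cabs_gt0 ?nz//.
    by rewrite invf_div (le_trans _ (Hd s sab))// ler_pdivrMr// ler_peMr ?ltW// ltr1n.
  - rewrite cabsV /L invf_ple ?posrE ?divr_gt0// ?cabs_gt0 ?den0//.
    by rewrite invf_div den.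
  - by rewrite /x /y; have := nz s sab; have := den0 s sab => ? ?; field; apply/andP.
  rewrite -mulrA; apply: ler_wpM2l => //; rewrite cabsM exprMn ler_wpM2r ?exprn_ge0 ?cabs_ge0//.
  by rewrite lerXn2r ?nnegrE ?cabs_ge0 ?HB// ltW.
apply: (le_trans (cint_bound ab cdif bd)).
have -> : 2 * (M * (C * B ^+ 2) * cabs h ^+ 2 * (b - a)) = (K * cabs h) * cabs h.
  by rewrite /K; ring.
apply: ler_wpM2r; rewrite ?cabs_ge0//.
apply: (@le_trans _ _ ((K + 1) * cabs h)); first by rewrite ler_wpM2r ?cabs_ge0 ?lerDl.
by rewrite mulrC -ler_pdivlMr ?ltW// ltr_wpDl.
Qed.

Variables (n : nat) (P : 'I_n -> piece R).
Hypothesis okP : forall i, is_piece (P i).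

Lemma oint_kernel_cdiff (psi alpha beta : CC R -> CC R) (N : nat) (z : CC R) :
  cont_on P psi -> cont_on P alpha -> cont_on P beta ->
  (forall u, on_contour P u -> alpha u - beta u * z != 0) ->
  cdiff (fun w => oint P (fun u => psi u / (alpha u - beta u * w) ^+ N)) z
    (N%:R * oint P (fun u => psi u * beta u / (alpha u - beta u * z) ^+ N.+1)).
Proof.
move=> cpsi calpha cbeta nz; rewrite mulr_sumr; apply: cdiff_sum => i.
pose psi' s := psi (p_path (P i) s) * p_vel (P i) s.
have := @cint_kernel_cdiff (p_lo (P i)) (p_hi (P i)) psi' (fun s => alpha (p_path (P i) s))
  (fun s => beta (p_path (P i) s)) N z (proj1 (okP i)) _ _ _ _.
have E1 w k (g : CC R -> CC R) : (fun s => g (p_path (P i) s) / (alpha (p_path (P i) s) -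
      beta (p_path (P i) s) * w) ^+ k * p_vel (P i) s) =
   (fun s => g (p_path (P i) s) * p_vel (P i) s / (alpha (p_path (P i) s) -
      beta (p_path (P i) s) * w) ^+ k) by apply/funext => s; ring.
have E2 w k : (fun s => psi (p_path (P i) s) * beta (p_path (P i) s) / (alpha (p_path (P i) s) -
      beta (p_path (P i) s) * w) ^+ k * p_vel (P i) s) =
   (fun s => psi' s * beta (p_path (P i) s) / (alpha (p_path (P i) s) -
      beta (p_path (P i) s) * w) ^+ k) by apply/funext => s; rewrite /psi'; ring.
rewrite E2; under [X in _ -> cdiff X _ _]eq_fun => w do rewrite E1.
apply.
- exact: pcont_oint.
- by move=> s sP; exact: (cont_on_comp okP calpha sP).
- by move=> s sP; exact: (cont_on_comp okP cbeta sP).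
- by move=> s sP; apply: nz; exact: on_contour_path.
Qed.

(* the successive derivatives in [w] of the integral of [phi / (alpha - beta w)] *)
Definition kernel_seq (phi alpha beta : CC R -> CC R) (k : nat) (w : CC R) : CC R :=
  (k`!)%:R * oint P (fun u => phi u * beta u ^+ k / (alpha u - beta u * w) ^+ k.+1).

Lemma kernel_seq_cdiff (phi alpha beta : CC R -> CC R) (k : nat) (z : CC R) :
  cont_on P phi -> cont_on P alpha -> cont_on P beta ->
  (forall u, on_contour P u -> alpha u - beta u * z != 0) ->
  cdiff (kernel_seq phi alpha beta k) z (kernel_seq phi alpha beta k.+1 z).
Proof.
move=> cphi calpha cbeta nz; rewrite /kernel_seq.
have cpsi : cont_on P (fun u => phi u * beta u ^+ k).
  by move=> u uP; apply: cvgCM_at; [exact: cphi|apply: cvgCX_at; exact: cbeta].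
apply: cdiff_eq (cdiffZ (k`!)%:R (oint_kernel_cdiff k.+1 cpsi calpha cbeta nz)) _.
rewrite mulrA -natrM -[(k`! * _)%N]mulnC -factS; congr (_ * _).
by apply: eq_oint => u uP; rewrite [beta u ^+ k.+1]exprSr mulrA.
Qed.

End kernel_derivative.

(** * Matrix functions as contour integrals *)

Section polynomial_multiplicity.
Context {F : numFieldType}.
Implicit Types (p q r : {poly F}) (l : F) (s : seq F).

Lemma derivn_XsubC_exp k q l : ((('X - l%:P) ^+ k * q)^`(k)).[l] = (k`!)%:R * q.[l].
Proof.
elim: k q => [|k IH] q; first by rewrite expr0 mul1r derivn0 fact0 mul1r.
rewrite derivSn derivM.
have -> : (('X - l%:P) ^+ k.+1)^`() * q + ('X - l%:P) ^+ k.+1 * q^`() =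
    ('X - l%:P) ^+ k * (k.+1%:R *: q + ('X - l%:P) * q^`()).
  rewrite deriv_exp derivXsubC mul1r /= exprS scaler_nat.
  by rewrite mulrDr mulrnAl mulrnAr -mulrA mulrCA.
rewrite IH hornerD hornerZ hornerM hornerXsubC subrr mul0r addr0 mulrA -natrM.
by rewrite factS mulnC.
Qed.

(** If the multiplicity [k] were smaller than [n], write [q = (X - l)^k r]: the [k]-th derivative at
    [l] is [k! r(l)], so [r(l) = 0] in characteristic zero, and [k] was not maximal. *)
Lemma mup_ge_of_derivs q l n : q != 0 ->
  (forall j, (j < n)%N -> (q^`(j)).[l] = 0) -> (n <= mup l q)%N.
Proof.
move=> q0 H; rewrite leqNgt; apply/negP => lt.
have := mup_geq l (mup l q) q0; rewrite leqnn => /esym /dvdpP[r qE].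
have := H _ lt; set k := mup l q in qE lt *.
rewrite qE mulrC derivn_XsubC_exp => /eqP; rewrite mulf_eq0 pnatr_eq0 gtn_eqF ?fact_gt0 //= => /eqP r0.
have : ('X - l%:P) ^+ k.+1 %| q.
  rewrite qE exprS; apply: dvdp_mul => //.
  by rewrite dvdp_XsubCl; apply/rootP.
by rewrite -mup_geq// ltnn.
Qed.

Lemma mup_prod_XsubC s l : mup l (\prod_(c <- s) ('X - c%:P)) = count_mem l s.
Proof.
elim: s => [|c s IH]; first by rewrite big_nil mupNroot// root1.
have nz : \prod_(c <- s) ('X - c%:P) != 0 by rewrite prodf_seq_neq0; apply/allP => x _; rewrite polyXsubC_eq0.
rewrite big_cons mupM ?polyXsubC_eq0// IH /=; congr (_ + _)%N.
by have := mup_XsubCX 1 l c; rewrite expr1 eq_sym => ->; case: eqP.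
Qed.

Lemma dvdp_prod_XsubC s q : q != 0 -> (forall l, (count_mem l s <= mup l q)%N) ->
  \prod_(c <- s) ('X - c%:P) %| q.
Proof.
elim: s q => [|c s IH] q q0 H; first by rewrite big_nil dvd1p.
have := H c; rewrite /= eqxx add1n => Hc.
have : 'X - c%:P %| q by rewrite XsubC_dvd// (leq_trans _ Hc).
move=> /dvdpP[r qE]; have r0 : r != 0 by apply: contra_neq q0 => r0; rewrite qE r0 mul0r.
rewrite big_cons qE mulrC dvdp_mul2r ?polyXsubC_eq0//; apply: IH => // l.
have := H l; rewrite qE mupM ?polyXsubC_eq0//= addnC.
have -> : mup l ('X - c%:P) = (c == l).
  by have := mup_XsubCX 1 l c; rewrite expr1 eq_sym => ->; case: eqP.
by rewrite leq_add2r.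
Qed.

End polynomial_multiplicity.

(** * Newton interpolation with repeated nodes *)

Section newton.
Context {R : realType}.

Lemma char_poly_roots m (M : 'M[CC R]_m) :
  exists2 s : seq (CC R), char_poly M = \prod_(l <- s) ('X - l%:P) & size s = m.
Proof.
have [s sE] := @closed_field_poly_normal (R[i] : closedFieldType) (char_poly M).
have E : char_poly M = \prod_(l <- s) ('X - l%:P).
  by rewrite {1}sE (monicP (char_poly_monic M)) scale1r.
exists s => //; have := size_char_poly M.
by rewrite E size_prod_XsubC => -[].
Qed.

Definition nodes (s : seq (CC R)) k : {poly CC R} := \prod_(l <- take k s) ('X - l%:P).

Lemma nodesS s k : (k < size s)%N -> nodes s k.+1 = nodes s k * ('X - (nth 0 s k)%:P).
Proof. by move=> ks; rewrite /nodes (take_nth 0 ks) -cats1 big_cat big_seq1. Qed.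

Lemma nodes_neq0 s k w : (forall l, l \in s -> w != l) -> (nodes s k).[w] != 0.
Proof.
move=> ws; rewrite /nodes horner_prod prodf_seq_neq0; apply/allP => l ls.
by rewrite hornerXsubC subr_eq0 ws//; exact: mem_take ls.
Qed.

(** Telescoping: the [k]-th term is the difference between [nodes s k / (nodes s k).[w]] and the
    same expression at [k.+1]. Evaluated at a number this is the remainder formula of interpolation;
    evaluated at a matrix whose characteristic polynomial is [nodes s (size s)], Cayley-Hamilton
    turns it into a formula for the resolvent. *)
Lemma newton_resolvent s w N : (N <= size s)%N -> (forall l, l \in s -> w != l) ->
  \sum_(k < N) ((nodes s k.+1).[w])^-1 *: (nodes s k * (w%:P - 'X)) =
  1 - ((nodes s N).[w])^-1 *: nodes s N.
Proof.
move=> Ns ws; elim: N Ns => [|N IH] Ns.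
  by rewrite big_ord0 /nodes take0 big_nil hornerC invr1 scale1r subrr.
rewrite big_ord_recr /= IH; last exact: ltnW.
have nz := nodes_neq0 N ws; have nz1 := nodes_neq0 N.+1 ws.
have E : nodes s N * (w%:P - 'X) = (w - nth 0 s N) *: nodes s N - nodes s N.+1.
  by rewrite nodesS// -mul_polyC polyCB; ring.
have E2 : (nodes s N.+1).[w] = (nodes s N).[w] * (w - nth 0 s N).
  by rewrite nodesS// hornerM hornerXsubC.
have nz3 : w - nth 0 s N != 0 by move: nz1; rewrite E2 mulf_eq0 negb_or => /andP[].
rewrite E scalerBr scalerA [in X in X *: _ - _]E2.
have -> : ((nodes s N).[w] * (w - nth 0 s N))^-1 * (w - nth 0 s N) = (nodes s N).[w]^-1.
  by field; rewrite nz nz3.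
by rewrite addrA subrK.
Qed.

(** The derivatives are carried by sequences [D] and [g] instead of an iterated operator, which lets
    the induction on the order [m] replace both sequences at once. *)
Lemma smooth_XsubC_vanish (U : set (CC R)) (l : CC R) (m : nat) :
  U l -> open U -> forall (D g : nat -> CC R -> CC R),
  (forall k z, U z -> cdiff (D k) z (D k.+1 z)) ->
  (forall k z, U z -> cdiff (g k) z (g k.+1 z)) ->
  (forall z, U z -> D 0%N z = (z - l) ^+ m * g 0%N z) ->
  forall j, (j < m)%N -> D j l = 0.
Proof.
move=> Ul oU; elim: m => [|m IH]// D g dD dg D0 [_|j]; first by rewrite D0// subrr exprS mul0r mul0r.
rewrite ltnS => jm.
(* The successive derivatives of [(m + 1) g + (z - l) g'], the cofactor of [(z - l)^m] in the
   derivative of [(z - l)^(m + 1) g]. *)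
pose g' k z := m.+1%:R * g k z + ((z - l) * g k.+1 z + k%:R * g k z).
apply: (IH (fun k => D k.+1) g') => //.
- by move=> k z Uz; exact: dD.
- move=> k z Uz; apply: cdiff_eq.
    apply: cdiffD; first by apply: cdiffZ; exact: dg.
    apply: cdiffD; last by apply: cdiffZ; exact: dg.
    apply: cdiffM; last exact: dg.
    by apply: cdiffB; [exact: cdiff_id|exact: cdiff_cst].
  by rewrite /g' -[k.+1%:R]natr1; ring.
- move=> z Uz.
  have d1 := dD 0%N z Uz.
  have d2 : cdiff (D 0%N) z ((z - l) ^+ m.+1 * g 1%N z + g 0%N z * (m.+1%:R * (z - l) ^+ m)).
    have nU : \forall w \near z, (w - l) ^+ m.+1 * g 0%N w = D 0%N w.
      have : \forall w \near z, U w by exact: open_nbhs_nbhs.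
      by apply: filterS => w Uw; rewrite D0.
    apply: cdiff_near nU _; apply: cdiffM; last exact: dg.
    have := @cdiffX R (fun w => w - l) z (1 - 0) m.+1 (cdiffB (cdiff_id z) (cdiff_cst l z)).
    by move=> /cdiff_eq; apply; rewrite /= subr0 mulr1.
  move/cdiffP : d1 => d1; move/cdiffP : d2 => d2.
  have -> : D 1%N z = (z - l) ^+ m.+1 * g 1%N z + g 0%N z * (m.+1%:R * (z - l) ^+ m).
    by rewrite -(@derive_val _ _ _ _ _ _ _ d1) -(@derive_val _ _ _ _ _ _ _ d2).
  by rewrite /g' exprS; ring.
Qed.

Lemma smooth_prod_XsubC (U : set (CC R)) (s : seq (CC R)) (g : nat -> CC R -> CC R) :
  (forall k z, U z -> cdiff (g k) z (g k.+1 z)) ->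
  exists2 g' : nat -> CC R -> CC R, (forall k z, U z -> cdiff (g' k) z (g' k.+1 z)) &
   forall z, g' 0%N z = (\prod_(l <- s) ('X - l%:P)).[z] * g 0%N z.
Proof.
move=> dg; elim: s => [|c s [g1 dg1 g10]].
  by exists g => // z; rewrite big_nil hornerC mul1r.
exists (fun k z => (z - c) * g1 k z + k%:R * g1 k.-1 z).
  move=> k z Uz.
  have D1 := cdiffM (cdiffB (cdiff_id z) (cdiff_cst c z)) (dg1 k z Uz).
  have D2 := cdiffZ k%:R (dg1 k.-1 z Uz).
  apply: cdiff_eq (cdiffD D1 D2) _.
  by case: k {D1 D2} => [|k] /=; [ring|rewrite -[k.+2%:R]natr1; ring].
by move=> z; rewrite big_cons hornerM hornerXsubC g10 mul0r addr0 mulrA.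
Qed.

End newton.

(** * Primary matrix functions from a Cauchy representation *)

Section matrix_function.
Context {R : realType} (n : nat) (P : 'I_n -> piece R).
Hypothesis okP : forall i, is_piece (P i).
Variables (S : set (CC R)) (K kf : CC R -> CC R) (c0 : CC R).
Hypothesis oS : open S.
Hypothesis SP : forall z u, S z -> on_contour P u -> u ^+ 2 != z.
Hypothesis ckf : cont_on P kf.
Hypothesis hK : forall z, S z -> K z = c0 * oint P (fun u => kf u / (u ^+ 2 - z)).

Let sq : CC R -> CC R := fun u => u ^+ 2.
Let one : CC R -> CC R := fun=> 1.

Let csq : cont_on P sq.
Proof. by move=> u _; apply: cvgCX_at; exact: cvgC_id_at. Qed.

Let cone : cont_on P one.
Proof. by move=> u _; exact: cvgC_cst_at. Qed.

Let nzS z u : S z -> on_contour P u -> sq u - one u * z != 0.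
Proof. by move=> Sz uP; rewrite /one mul1r subr_eq0; exact: SP. Qed.

Let kernel0 phi z : kernel_seq P phi sq one 0 z = oint P (fun u => phi u / (u ^+ 2 - z)).
Proof.
rewrite /kernel_seq fact0 mul1r; apply: eq_oint => u _.
by rewrite /one /sq expr0 expr1 mul1r mulr1.
Qed.

Let Kseq k z := c0 * kernel_seq P kf sq one k z.

Let dKseq k z : S z -> cdiff (Kseq k) z (Kseq k.+1 z).
Proof. by move=> Sz; apply: cdiffZ; apply: kernel_seq_cdiff => // u; exact: nzS. Qed.

Let K_derive k z : S z -> cderiv_n k K z = Kseq k z.
Proof.
apply: derive1n_seq => // {}z Sz; first by rewrite hK// /Kseq kernel0.
Qed.

Lemma cont_on_nodes s k : (forall l, l \in s -> S l) ->
  cont_on P (fun u => ((nodes s k).[u ^+ 2])^-1).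
Proof.
move=> sS u uP; apply: cvgCV_at; last by apply: cvgC_horner_at; exact: csq uP.
by apply: nodes_neq0 => l /sS Sl; exact: SP.
Qed.

(* the divided differences of [K], read off its contour representation *)
Definition newton_coef s k := c0 * oint P (fun u => kf u * ((nodes s k.+1).[u ^+ 2])^-1).

Definition newton_interp s : {poly CC R} :=
  \sum_(k < size s) newton_coef s k *: nodes s k.

Let cont_term s k c : (forall l, l \in s -> S l) ->
  cont_on P (fun u => c * (kf u * ((nodes s k).[u ^+ 2])^-1)).
Proof.
move=> sS u uP; apply: cvgCM_at; first exact: cvgC_cst_at.
by apply: cvgCM_at; [exact: ckf|exact: cont_on_nodes].
Qed.

Let cont_term1 s k : (forall l, l \in s -> S l) ->
  cont_on P (fun u => kf u * ((nodes s k).[u ^+ 2])^-1).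
Proof. by move=> sS u uP; apply: cvgCM_at; [exact: ckf|exact: cont_on_nodes]. Qed.

Lemma newton_sum s (q : nat -> CC R) : (forall l, l \in s -> S l) ->
  \sum_(k < size s) newton_coef s k * q k =
  c0 * oint P (fun u => kf u * \sum_(k < size s) q k / (nodes s k.+1).[u ^+ 2]).
Proof.
move=> sS.
transitivity (c0 * \sum_(k < size s) oint P (fun u => q k * (kf u * ((nodes s k.+1).[u ^+ 2])^-1))).
  rewrite mulr_sumr; apply: eq_bigr => k _.
  by rewrite (ointZ okP (q k) (@cont_term1 s k.+1 sS)) /newton_coef; ring.
rewrite -(oint_sum okP _ (fun k : 'I_(size s) => @cont_term s k.+1 (q k) sS)).
congr (_ * _); apply: eq_oint => u _; rewrite mulr_sumr.
by apply: eq_bigr => k _; ring.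
Qed.

(** Inserting [newton_resolvent] at [X = z] into the contour formula for [K], the sum reproduces the
    interpolation polynomial and the rest carries the factor [(nodes s (size s)).[z]]. *)
Lemma newton_remainder s z : (forall l, l \in s -> S l) -> S z ->
  K z - (newton_interp s).[z] =
  (nodes s (size s)).[z] *
    (c0 * oint P (fun u => kf u / (nodes s (size s)).[u ^+ 2] / (u ^+ 2 - z))).
Proof.
move=> sS Sz.
have cz : cont_on P (fun u => (u ^+ 2 - z)^-1).
  move=> u uP; apply: cvgCV_at; first by rewrite subr_eq0 SP.
  by apply: cvgCB_at; [exact: csq uP|exact: cvgC_cst_at].
have E : (newton_interp s).[z] = \sum_(k < size s) newton_coef s k * (nodes s k).[z].
  by rewrite /newton_interp horner_sum; apply: eq_bigr => k _; rewrite hornerZ.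
have c1 : cont_on P (fun u => kf u / (u ^+ 2 - z)).
  by move=> u uP; apply: cvgCM_at; [exact: ckf|exact: cz].
have c2 : cont_on P (fun u => kf u * \sum_(k < size s) (nodes s k).[z] / (nodes s k.+1).[u ^+ 2]).
  move=> u uP; apply: cvgCM_at; first exact: ckf.
  apply: cvgC_sum_at => k _; apply: cvgCM_at; first exact: cvgC_cst_at.
  exact: cont_on_nodes.
have c3 : cont_on P (fun u => kf u / (nodes s (size s)).[u ^+ 2] / (u ^+ 2 - z)).
  move=> u uP; apply: cvgCM_at; last exact: cz.
  by apply: cvgCM_at; [exact: ckf|exact: cont_on_nodes].
have c4 : cont_on P (fun u => -1 * (kf u * \sum_(k < size s) (nodes s k).[z] / (nodes s k.+1).[u ^+ 2])).
  by move=> u uP; apply: cvgCM_at; [exact: cvgC_cst_at|exact: c2].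
rewrite (hK Sz) E (newton_sum (fun k => (nodes s k).[z]) sS) mulrCA -mulrBr -(ointZ okP _ c3).
congr (_ * _); rewrite -[X in _ - X]mul1r -mulNr -(ointZ okP _ c2) -(ointD okP c1 c4).
apply: eq_oint => u uP.
have us l : l \in s -> u ^+ 2 != l by move=> /sS Sl; exact: SP.
have uz : u ^+ 2 - z != 0 by rewrite subr_eq0 SP.
have nz := nodes_neq0 (size s) us.
have := congr1 (fun p => p.[z]) (newton_resolvent (leqnn _) us).
rewrite horner_sum hornerD hornerN hornerC hornerZ.
have -> : \sum_(i < size s) ((nodes s i.+1).[u ^+ 2]^-1 *: (nodes s i * ((u ^+ 2)%:P - 'X))).[z]
  = (\sum_(k < size s) (nodes s k).[z] / (nodes s k.+1).[u ^+ 2]) * (u ^+ 2 - z).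
  rewrite mulr_suml; apply: eq_bigr => k _.
  by rewrite hornerZ hornerM hornerD hornerN hornerX hornerC; ring.
set X := \sum_(k < size s) _ => H.
have -> : X = (1 - (nodes s (size s)).[u ^+ 2]^-1 * (nodes s (size s)).[z]) / (u ^+ 2 - z).
  by rewrite -H mulfK.
by field; rewrite nz uz.
Qed.

(** Near an eigenvalue [l] of multiplicity [m] the remainder is [(z - l)^m] times a smooth function,
    so its derivatives of order below [m] vanish at [l]. *)
Lemma newton_hermite m (M : 'M[CC R]_m.+1) s :
  char_poly M = \prod_(l <- s) ('X - l%:P) -> (forall l, l \in s -> S l) ->
  hermite_interp K M (newton_interp s).
Proof.
move=> chM sS l rl j; rewrite chM mup_prod_XsubC => jm.
have ls : l \in s by move: rl; rewrite chM root_prod_XsubC.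
have Sl := sS l ls.
rewrite K_derive//; apply/esym/eqP; rewrite -subr_eq0; apply/eqP.
pose phi u := kf u / (nodes s (size s)).[u ^+ 2].
have cphi : cont_on P phi by exact: cont_term1.
pose g0 k z := c0 * kernel_seq P phi sq one k z.
have dg0 k z : S z -> cdiff (g0 k) z (g0 k.+1 z).
  by move=> Sz; apply: cdiffZ; apply: kernel_seq_cdiff => // u; exact: nzS.
(* The nodes different from [l] are absorbed into the smooth cofactor. *)
have [g dg g0E] := smooth_prod_XsubC [seq c <- s | c != l] dg0.
pose D k z := Kseq k z - ((newton_interp s)^`(k)).[z].
apply: (@smooth_XsubC_vanish R S l (count_mem l s) Sl oS D g _ dg _ j jm).
- move=> k z Sz; rewrite /D derivnS; apply: cdiffB; first exact: dKseq.
  exact: cdiff_horner.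
- move=> z Sz; rewrite /D derivn0 /Kseq kernel0 -hK// newton_remainder// g0E [in RHS]mulrA.
  rewrite /g0 kernel0; congr (_ * _).
  rewrite /nodes take_size (bigID (pred1 l)) /= hornerM; congr (_ * _); last first.
    by rewrite big_filter.
  rewrite (eq_bigr (fun=> 'X - l%:P)); last by move=> c /eqP ->.
  by rewrite big_const_seq iter_mulr_1 horner_exp hornerXsubC.
Qed.

(** [matfun] takes its interpolant by choice. Two interpolants differ by a multiple of the
    characteristic polynomial, so Cayley-Hamilton makes the resulting matrix independent of that
    choice. *)
Lemma hermite_unique m (M : 'M[CC R]_m.+1) (p q : {poly CC R}) :
  hermite_interp K M p -> hermite_interp K M q -> horner_mx M p = horner_mx M q.
Proof.
move=> hp hq; apply/eqP; rewrite -subr_eq0 -rmorphB /=; apply/eqP.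
have [->|r0] := eqVneq (p - q) 0; first by rewrite rmorph0.
have [s chM _] := char_poly_roots M.
have : char_poly M %| p - q.
  rewrite chM; apply: dvdp_prod_XsubC => // l.
  have [ls|ls] := boolP (l \in s); last by rewrite (count_memPn ls).
  apply: mup_ge_of_derivs => // j jm.
  have rl : root (char_poly M) l by rewrite chM root_prod_XsubC.
  have jm' : (j < mup l (char_poly M))%N by rewrite chM mup_prod_XsubC.
  by rewrite derivnB hornerD hornerN hp// hq// subrr.
by move=> /dvdpP[r ->]; rewrite rmorphM /= Cayley_Hamilton mulr0.
Qed.

(** Only one row of the matrix function is wanted. The resolvent is therefore replaced by the row
    [V u] solving [V u (u^2 - M) = e], which the Runge-Kutta structure makes explicit. *)
Lemma matfun_contour m (M : 'M[CC R]_m.+1) (e : 'rV[CC R]_m.+1) (V : CC R -> 'rV[CC R]_m.+1) j :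
  (forall l, root (char_poly M) l -> S l) ->
  (forall u, on_contour P u -> V u *m ((u ^+ 2)%:M - M) = e) ->
  (e *m matfun K M) 0 j = c0 * oint P (fun u => kf u * V u 0 j).
Proof.
move=> rS HV; have [s chM sm] := char_poly_roots M.
have sS l : l \in s -> S l by move=> ls; apply: rS; rewrite chM root_prod_XsubC.
have hp := newton_hermite chM sS.
have -> : matfun K M = horner_mx M (newton_interp s).
  apply: (@hermite_unique _ M _ _ _ hp).
  exact: (@xgetPex _ 0 [set p | hermite_interp K M p] (ex_intro _ _ hp)).
rewrite /newton_interp rmorph_sum /= mulmx_sumr summxE.
transitivity (\sum_(k < size s) newton_coef s k * (e *m horner_mx M (nodes s k)) 0 j).
  by apply: eq_bigr => k _; rewrite linearZ /= -scalemxAr mxE.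
rewrite (newton_sum (fun k => (e *m horner_mx M (nodes s k)) 0 j) sS).
congr (_ * _); apply: eq_oint => u uP; congr (_ * _).
have us l : l \in s -> u ^+ 2 != l by move=> /sS Sl; exact: SP.
pose W := \sum_(k < size s) ((nodes s k.+1).[u ^+ 2])^-1 *: (e *m horner_mx M (nodes s k)).
suff <- : W = V u.
  by rewrite /W summxE; apply: eq_bigr => k _; rewrite [in RHS]mxE mulrC.
have nE : nodes s (size s) = char_poly M by rewrite /nodes take_size chM.
have WE : W *m ((u ^+ 2)%:M - M) = e.
  have := congr1 (fun p => e *m horner_mx M p) (newton_resolvent (leqnn _) us).
  rewrite rmorph_sum rmorphB rmorph1 /= linearZ /= nE.
  rewrite Cayley_Hamilton scaler0 subr0 mulmx1 mulmx_sumr => H.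
  rewrite -[RHS]H /W mulmx_suml; apply: eq_bigr => k _.
  have -> : horner_mx M ((nodes s k.+1).[u ^+ 2]^-1 *: (nodes s k * ((u ^+ 2)%:P - 'X))) =
      (nodes s k.+1).[u ^+ 2]^-1 *: (horner_mx M (nodes s k) *m ((u ^+ 2)%:M - M)).
    by rewrite horner_mxZ rmorphM /= rmorphB /= horner_mx_C horner_mx_X.
  by rewrite -scalemxAl -scalemxAr mulmxA.
have unitM : (u ^+ 2)%:M - M \in unitmx.
  have nz : (char_poly M).[u ^+ 2] != 0.
    by apply/negP => /eqP/rootP/rS Sz; have := SP Sz uP; rewrite eqxx.
  rewrite unitmxE unitfE; apply: contra_neq nz => d0.
  have -> : (char_poly M).[u ^+ 2] = \det ((u ^+ 2)%:M - M); last exact: d0.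
  rewrite /char_poly -horner_evalE -det_map_mx; congr (\det _).
  apply/matrixP => i k; rewrite !mxE /= horner_evalE hornerD hornerN hornerC.
  by rewrite hornerMn hornerX.
by rewrite -[W](mulmxK unitM) WE -(HV _ uP) mulmxK.
Qed.

End matrix_function.

(** * The resolvent of the Runge-Kutta symbol *)

Lemma unitmx_of_ker {F : fieldType} n (X : 'M[F]_n) :
  (forall y : 'rV_n, y *m X = 0 -> y = 0) -> X \in unitmx.
Proof.
move=> H; rewrite -row_free_unit -kermx_eq0; apply/rowV0P => v /sub_kermxP; exact: H.
Qed.

(** * A submultiplicative entrywise matrix norm *)

Section matrix_norm.
Context {R : realType}.

Definition mxnorm1 m n (M : 'M[CC R]_(m, n)) : R := \sum_i \sum_j cabs (M i j).

Lemma mxnorm1_ge0 m n (M : 'M[CC R]_(m, n)) : 0 <= mxnorm1 M.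
Proof. by apply: sumr_ge0 => i _; apply: sumr_ge0 => j _; exact: cabs_ge0. Qed.

Lemma mxnorm1_ge m n (M : 'M[CC R]_(m, n)) i j : cabs (M i j) <= mxnorm1 M.
Proof.
rewrite /mxnorm1 (bigD1 i)//= (bigD1 j)//= -addrA lerDl addr_ge0//.
  by apply: sumr_ge0 => k _; exact: cabs_ge0.
by apply: sumr_ge0 => k _; apply: sumr_ge0 => l _; exact: cabs_ge0.
Qed.

Lemma mxnorm1_eq0 m n (M : 'M[CC R]_(m, n)) : mxnorm1 M <= 0 -> M = 0.
Proof.
move=> M0; apply/matrixP => i j; rewrite mxE; apply/eqP; rewrite -cabs_eq0 eq_le cabs_ge0 andbT.
exact: le_trans (mxnorm1_ge M i j) M0.
Qed.

Lemma mxnorm1D m n (M N : 'M[CC R]_(m, n)) : mxnorm1 (M + N) <= mxnorm1 M + mxnorm1 N.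
Proof.
rewrite -big_split /=; apply: ler_sum => i _; rewrite -big_split /=; apply: ler_sum => j _.
by rewrite mxE cabsD.
Qed.

Lemma mxnorm1N m n (M : 'M[CC R]_(m, n)) : mxnorm1 (- M) = mxnorm1 M.
Proof. by apply: eq_bigr => i _; apply: eq_bigr => j _; rewrite mxE cabsN. Qed.

Lemma mxnorm1Z m n c (M : 'M[CC R]_(m, n)) : mxnorm1 (c *: M) = cabs c * mxnorm1 M.
Proof.
rewrite mulr_sumr; apply: eq_bigr => i _; rewrite mulr_sumr; apply: eq_bigr => j _.
by rewrite mxE cabsM.
Qed.

Lemma mxnorm1M m n p (M : 'M[CC R]_(m, n)) (N : 'M[CC R]_(n, p)) :
  mxnorm1 (M *m N) <= mxnorm1 M * mxnorm1 N.
Proof.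
rewrite /mxnorm1 mulr_suml; apply: ler_sum => i _.
apply: (@le_trans _ _ (\sum_j \sum_k cabs (M i k) * cabs (N k j))).
  apply: ler_sum => j _; rewrite mxE (le_trans (cabs_sum _ _ _))//.
  by apply: ler_sum => k _; rewrite cabsM.
rewrite exchange_big /= mulr_suml; apply: ler_sum => k _.
rewrite -mulr_sumr ler_wpM2l ?cabs_ge0//.
rewrite (bigD1 k)//= lerDl; apply: sumr_ge0 => l _; apply: sumr_ge0 => j _.
exact: cabs_ge0.
Qed.

End matrix_norm.

(** * Stability function and resolvent of the method *)

Section runge_kutta.
Context {R : realType} {s : nat} (A : 'M[R]_s.+1) (b : 'rV[R]_s.+1).
Hypothesis Horder : \sum_(j < s.+1) b 0 j = 1.
Hypothesis HAstab : forall z : CC R, complex.Re z <= 0 ->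
  (1%:M - z *: Cmx A) \in unitmx /\ `|rk_r A b z| <= 1.
Hypothesis HAinv : A \in unitmx.
Hypothesis Hstiff : b *m invmx A = \row_(j < s.+1) (j == ord_max)%:R.

Let cA := Cmx A.
Let cb := Cmx b.
Let ones : 'cV[CC R]_s.+1 := const_mx 1.
Let e : 'rV[CC R]_s.+1 := delta_mx 0 ord_max.
Let B w := invmx (1%:M - w *: cA).

Lemma CmxM m n p (M : 'M[R]_(m, n)) (N : 'M[R]_(n, p)) : Cmx (M *m N) = Cmx M *m Cmx N.
Proof. exact: (map_mxM (real_complex R)). Qed.

Lemma Cmx_unit n (M : 'M[R]_n) : (Cmx M \in unitmx) = (M \in unitmx).
Proof. exact: (map_unitmx (real_complex R)). Qed.

(** Stiff accuracy in the form used below: the last row of [A] is [b]. *)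
Let eA : e *m cA = cb.
Proof.
have -> : e = Cmx (b *m invmx A).
  apply/rowP => j; rewrite Hstiff !mxE eqxx /=.
  by case: eqP.
by rewrite -CmxM mulmxKV.
Qed.

Let e1 : e *m ones = 1%:M.
Proof.
apply/matrixP => i j; rewrite !ord1 !mxE (bigD1 ord_max)//= big1 ?addr0.
  by rewrite !mxE !eqxx mulr1.
by move=> k /negbTE kn; rewrite !mxE kn andbF mul0r.
Qed.

Let unitA : cA \in unitmx. Proof. by rewrite Cmx_unit. Qed.

Let comm_B w : (1%:M - w *: cA) \in unitmx -> B w *m cA = cA *m B w.
Proof.
move=> U.
have C : cA *m (1%:M - w *: cA) = (1%:M - w *: cA) *m cA.
  by rewrite mulmxBr mulmxBl mulmx1 mul1mx -scalemxAl -scalemxAr.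
by rewrite -[LHS](mulmxK U) -(mulmxA (B w)) C (mulmxA (B w)) mulVmx// mul1mx.
Qed.

Let q1E w : (rk_q A b w *m ones) 0 0 * w = rk_r A b w - 1.
Proof. by rewrite /rk_r -/ones; ring. Qed.

Let q1M w : w *: (rk_q A b w *m ones) = (rk_r A b w - 1)%:M.
Proof.
by apply/matrixP => i j; rewrite !ord1 mxE [RHS]mxE eqxx mulr1n -q1E mulrC.
Qed.

Let qeB w : (1%:M - w *: cA) \in unitmx -> rk_q A b w = e *m B w *m cA.
Proof. by move=> U; rewrite /rk_q -/cb -eA -!mulmxA comm_B. Qed.

(** Since [b = e A], the term [w q(w) 1] equals [e B(w) 1 - e 1], and [e 1 = 1] cancels the constant
    term of [r]. Hence [r] decays at infinity together with the resolvent. *)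
Lemma rk_rE w : (1%:M - w *: cA) \in unitmx -> rk_r A b w = (e *m B w *m ones) 0 0.
Proof.
move=> U; have := q1M w; rewrite (qeB U).
have -> : w *: (e *m B w *m cA *m ones) = e *m B w *m ones - e *m ones.
  have -> : e *m ones = e *m B w *m (1%:M - w *: cA) *m ones.
    by rewrite -(mulmxA e) mulVmx// mulmx1.
  by rewrite mulmxBr mulmx1 mulmxBl opprB addrC subrK -scalemxAr -scalemxAl.
rewrite e1 => /matrixP/(_ 0 0); rewrite !mxE eqxx mulr1n => /eqP.
by rewrite subr_eq subrK => /eqP.
Qed.

(** A row in the kernel is a multiple [- c e], because [b = e A] and [A] is invertible; the scalar
    equation left for [c] has the factor [1 + zeta / (1 - zeta) = 1 / (1 - zeta)]. *)
Lemma rk_Delta_unit zeta : zeta != 1 ->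
  cA + (zeta / (1 - zeta)) *: (ones *m cb) \in unitmx.
Proof.
move=> z1; have z1' : 1 - zeta != 0 by rewrite subr_eq0 eq_sym.
apply: unitmx_of_ker => y; rewrite mulmxDr -scalemxAr mulmxA.
rewrite [y *m ones]mx11_scalar mul_scalar_mx scalerA => H.
set c := _ * _ in H.
have yE : y = - (c *: e).
  rewrite -[y](mulmxK unitA); have -> : y *m cA = - (c *: cb) by apply/eqP; rewrite -addr_eq0 H.
  by rewrite -eA mulNmx scalemxAl mulmxK.
have : c = - (zeta / (1 - zeta)) * c.
  rewrite {1}/c {1}yE mulNmx -scalemxAl e1 !mxE eqxx mulr1n; ring.
move=> /eqP; rewrite -subr_eq0.
have -> : c - - (zeta / (1 - zeta)) * c = c / (1 - zeta) by field.
rewrite mulf_eq0 invr_eq0 (negbTE z1') orbF => /eqP c0.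
by rewrite yE c0 scale0r oppr0.
Qed.

(** [rk_Delta] inverts [D = A + eta 1 b], a rank one perturbation of [A], and
    [Delta - w = (1 - w D) D^-1]. Both [e D] and [q (1 - w D)] are multiples of [b], with factors
    [1 / (1 - zeta)] and [(1 - zeta r) / (1 - zeta)]. *)
Lemma rk_last_row (zeta w : CC R) : zeta != 1 -> (1%:M - w *: cA) \in unitmx ->
  zeta * rk_r A b w != 1 ->
  ((1 - zeta * rk_r A b w)^-1 *: rk_q A b w) *m (rk_Delta A b zeta - w%:M) = e.
Proof.
move=> z1 U zr; have z1' : 1 - zeta != 0 by rewrite subr_eq0 eq_sym.
have zr' : 1 - zeta * rk_r A b w != 0 by rewrite subr_eq0 eq_sym.
have UD := rk_Delta_unit z1.
set eta := zeta / (1 - zeta) in UD *.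
set D := cA + _ in UD *.
have -> : rk_Delta A b zeta - w%:M = (1%:M - w *: D) *m invmx D.
  rewrite mulmxBl mul1mx -scalemxAl mulmxV// scalemx1.
  by rewrite /rk_Delta -/cA -/cb -/ones -/eta -/D.
rewrite mulmxA.
have -> : (1 - zeta * rk_r A b w)^-1 *: rk_q A b w *m (1%:M - w *: D) = e *m D; last first.
  by rewrite mulmxK.
have qU : rk_q A b w *m (1%:M - w *: cA) = cb := mulmxKV U cb.
have eD : e *m D = cb + eta *: cb by rewrite /D mulmxDr eA -scalemxAr mulmxA e1 mul1mx.
have qD : rk_q A b w *m (1%:M - w *: D) = cb - (eta * (rk_r A b w - 1)) *: cb.
  rewrite /D scalerDr opprD addrA mulmxDr qU mulmxN scalerA -scalemxAr mulmxA.
  congr (_ - _); rewrite (mulrC w) -(scalerA eta w) (scalemxAl w) q1M mul_scalar_mx.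
  by rewrite scalerA.
rewrite eD -scalemxAl qD.
have -> : cb - (eta * (rk_r A b w - 1)) *: cb = (1 - eta * (rk_r A b w - 1)) *: cb.
  by rewrite scalerBl scale1r.
have -> : cb + eta *: cb = (1 + eta) *: cb by rewrite scalerDl scale1r.
rewrite scalerA; congr (_ *: _).
by rewrite /eta; field; rewrite z1' zr'.
Qed.

(** A row annihilated by [1 - w D] is a multiple of [q(w)], and the scalar equation that remains has
    the factor [1 - zeta r(w)]. This locates the spectrum of [Delta(zeta)]. *)
Lemma rk_Delta_sub_unit (zeta w : CC R) : zeta != 1 -> (1%:M - w *: cA) \in unitmx ->
  zeta * rk_r A b w != 1 -> rk_Delta A b zeta - w%:M \in unitmx.
Proof.
move=> z1 U zr; have z1' : 1 - zeta != 0 by rewrite subr_eq0 eq_sym.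
have zr' : 1 - zeta * rk_r A b w != 0 by rewrite subr_eq0 eq_sym.
have UD := rk_Delta_unit z1.
set eta := zeta / (1 - zeta) in UD.
set D := cA + _ in UD.
have -> : rk_Delta A b zeta - w%:M = (1%:M - w *: D) *m invmx D.
  rewrite mulmxBl mul1mx -scalemxAl mulmxV// scalemx1.
  by rewrite /rk_Delta -/cA -/cb -/ones -/eta -/D.
rewrite unitmx_mul unitmx_inv UD andbT; apply: unitmx_of_ker => y.
rewrite /D scalerDr opprD addrA mulmxBr scalerA -scalemxAr mulmxA => /eqP.
rewrite subr_eq0 => /eqP yU.
rewrite [y *m ones]mx11_scalar mul_scalar_mx scalerA in yU.
set c := _ * _ in yU.
have yE : y = c *: rk_q A b w by rewrite -[y](mulmxK U) yU scalemxAl.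
set y1 := (y *m ones) 0 0 in c yU yE.
have : y1 = eta * (rk_r A b w - 1) * y1.
  by rewrite {1}/y1 {1}yE -scalemxAl mxE /c -q1E; ring.
move=> /eqP; rewrite -subr_eq0.
have -> : y1 - eta * (rk_r A b w - 1) * y1 = (1 - zeta * rk_r A b w) / (1 - zeta) * y1.
  by rewrite /eta; field.
rewrite !mulf_eq0 invr_eq0 (negbTE zr') (negbTE z1') /= => /eqP y10.
by rewrite yE /c y10 mulr0 scale0r.
Qed.

Lemma rk_at_infinity : exists rho C : R, [/\ 0 < rho, 0 < C &
  forall w, rho <= cabs w -> [/\ (1%:M - w *: cA) \in unitmx, cabs (rk_r A b w) <= C / cabs w &
    forall j, cabs (rk_q A b w 0 j) <= C / cabs w]].
Proof.
pose a := mxnorm1 (invmx cA).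
have a0 : 0 <= a := mxnorm1_ge0 _.
(* From [w B = B A^-1 - A^-1] the norms satisfy [|w| |B| <= a |B| + a], so [|B| <= 2 a / |w|] once
   [|w| >= 2 a]; the added [1] ensures positivity. *)
exists (2 * a + 1), (2 * a * (mxnorm1 e * mxnorm1 ones + mxnorm1 cb) + 1).
have c0 : 0 <= 2 * a * (mxnorm1 e * mxnorm1 ones + mxnorm1 cb).
  by rewrite mulr_ge0 ?addr_ge0 ?mulr_ge0 ?mxnorm1_ge0.
have rho0 : 0 < 2 * a + 1 by rewrite ltr_wpDl// mulr_ge0.
split; [exact: rho0|by rewrite ltr_wpDl|move=> w wa].
have w0 : 0 < cabs w by rewrite (lt_le_trans _ wa)// ltr_wpDl// mulr_ge0.
have U : (1%:M - w *: cA) \in unitmx.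
  apply: unitmx_of_ker => y; rewrite mulmxBr mulmx1 => /eqP; rewrite subr_eq0 => /eqP yE.
  have yA : y *m invmx cA = w *: y.
    by rewrite {1}yE -scalemxAr -scalemxAl mulmxK.
  apply: mxnorm1_eq0; have := mxnorm1M y (invmx cA); rewrite yA mxnorm1Z -/a.
  have := mxnorm1_ge0 y; set t := mxnorm1 y; set W := cabs w in wa w0 *.
  by nra.
have BE : w *: B w = B w *m invmx cA - invmx cA.
  have : B w *m (1%:M - w *: cA) *m invmx cA = invmx cA by rewrite mulVmx// mul1mx.
  rewrite mulmxBr mulmx1 mulmxBl -scalemxAr -scalemxAl mulmxK// => H.
  by rewrite -[X in _ - X]H opprB addrC subrK.
have NB : mxnorm1 (B w) <= 2 * a / cabs w.
  rewrite ler_pdivlMr//; have : cabs w * mxnorm1 (B w) <= mxnorm1 (B w) * a + a.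
    by rewrite -mxnorm1Z BE (le_trans (mxnorm1D _ _))// mxnorm1N lerD2r mxnorm1M.
  by have := mxnorm1_ge0 (B w); set t := mxnorm1 (B w); set W := cabs w in wa w0 *; nra.
have t1 : 0 <= mxnorm1 e * mxnorm1 ones by rewrite mulr_ge0 ?mxnorm1_ge0.
have t2 := mxnorm1_ge0 cb.
split => //.
  rewrite (rk_rE U) (le_trans (mxnorm1_ge _ _ _))// (le_trans (mxnorm1M _ _))//.
  apply: (@le_trans _ _ (mxnorm1 e * (2 * a / cabs w) * mxnorm1 ones)).
    rewrite ler_wpM2r ?mxnorm1_ge0// (le_trans (mxnorm1M _ _))// ler_wpM2l ?mxnorm1_ge0//.
  have -> : mxnorm1 e * (2 * a / cabs w) * mxnorm1 ones = (2 * a * (mxnorm1 e * mxnorm1 ones)) / cabs w by ring.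
  rewrite ler_wpM2r ?invr_ge0 ?(ltW w0)//.
  have := mulr_ge0 a0 t2; lra.
move=> j; rewrite (le_trans (mxnorm1_ge _ _ _))// (le_trans (mxnorm1M _ _))//.
apply: (@le_trans _ _ (mxnorm1 cb * (2 * a / cabs w))).
  by rewrite ler_wpM2l ?mxnorm1_ge0.
rewrite mulrA ler_wpM2r ?invr_ge0 ?(ltW w0)//.
have := mulr_ge0 a0 t1; lra.
Qed.

(** Cramer's rule. It serves to show that [r] and [q] are continuous wherever [1 - w A] is
    invertible. *)
Lemma rk_rational : exists (d r : {poly CC R}) (Q : 'I_s.+1 -> {poly CC R}),
  forall w, d.[w] = \det (1%:M - w *: cA) /\
    ((1%:M - w *: cA) \in unitmx -> rk_r A b w = r.[w] / d.[w] /\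
      forall j, rk_q A b w 0 j = (Q j).[w] / d.[w]).
Proof.
pose X : 'M[{poly CC R}]_s.+1 := 1%:M - 'X *: map_mx polyC cA.
have evX w : map_mx (horner_eval w) X = 1%:M - w *: cA.
  apply/matrixP => i j; rewrite !mxE /= horner_evalE !hornerE.
  by case: (i == j); rewrite ?hornerC ?horner0.
pose Q j := \sum_k (cb 0 k)%:P * \adj X k j.
exists (\det X), (\det X + 'X * \sum_k Q k), Q => w.
have dE : (\det X).[w] = \det (1%:M - w *: cA).
  by rewrite -evX det_map_mx.
split=> // U.
have d0 : \det (1%:M - w *: cA) != 0 by move: U; rewrite unitmxE unitfE.
have qE j : rk_q A b w 0 j = (Q j).[w] / (\det X).[w].
  rewrite /rk_q mxE horner_sum mulr_suml; apply: eq_bigr => k _.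
  rewrite hornerM hornerC dE -mulrA; congr (_ * _).
  rewrite /invmx U mxE mulrC; congr (_ * _).
  by rewrite -evX -map_mx_adj mxE.
have q1 : (rk_q A b w *m ones) 0 0 = (\sum_k (Q k).[w]) / (\det X).[w].
  rewrite mxE mulr_suml; apply: eq_bigr => k _.
  by rewrite qE [ones _ _]mxE mulr1.
split; last exact: qE.
have hs : (\sum_k Q k).[w] = \sum_k (Q k).[w] by rewrite horner_sum.
rewrite /rk_r -/ones q1 hornerD hornerM hornerX hs; field.
by rewrite dE.
Qed.

End runge_kutta.

(** * Exponential, logarithm and square root *)

Lemma cvg_cont_comp {R : realType} (T : Type) (F : set_system T) (FF : Filter F) (g : R -> R)
  (f : T -> R) (a : R) : f @ F --> a -> {for a, continuous g} -> (fun x => g (f x)) @ F --> g a.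
Proof. by move=> fa cg; exact: cvg_comp fa cg. Qed.

Section exp_log_sqrt.
Context {R : realType}.
Implicit Types (z w u h : CC R).

Lemma Re_cexp z : complex.Re (cexp z) = expR (complex.Re z) * cos (complex.Im z).
Proof. by rewrite /cexp !ReImE /=; ring. Qed.

Lemma Im_cexp z : complex.Im (cexp z) = expR (complex.Re z) * sin (complex.Im z).
Proof. by rewrite /cexp !ReImE /=; ring. Qed.

Lemma cexp0 : cexp (0 : CC R) = 1.
Proof. by apply: complexP; rewrite ?Re_cexp ?Im_cexp /= expR0 ?cos0 ?sin0; ring. Qed.

Lemma cexpD z w : cexp (z + w) = cexp z * cexp w.
Proof.
apply: complexP.
  by rewrite Re_cexp ReM !(Re_cexp, Im_cexp) ReD ImD expRD cosD; ring.
by rewrite Im_cexp ImM !(Re_cexp, Im_cexp) ReD ImD expRD sinD; ring.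
Qed.

Lemma cabs_cexp z : cabs (cexp z) = expR (complex.Re z).
Proof.
apply/eqP; rewrite -(eqrXn2 (n := 2))// ?cabs_ge0 ?expR_ge0//; apply/eqP.
rewrite cabs_sqr Re_cexp Im_cexp !exprMn -mulrDr cos2Dsin2 mulr1//.
Qed.

Lemma cexp_neq0 z : cexp z != 0.
Proof. by rewrite -cabs_gt0 cabs_cexp expR_gt0. Qed.

Lemma cexpN z : cexp (- z) = (cexp z)^-1.
Proof.
apply: (mulfI (cexp_neq0 z)); rewrite -cexpD subrr cexp0 mulfV//.
exact: cexp_neq0.
Qed.

Lemma cdiff_cexp0 : cdiff (@cexp R) 0 1.
Proof.
move=> e0 e00.
(* With [r = |h|], the real and imaginary parts of the remainder will be at most [4 e r] and
   [6 e r]; the bound [e <= 1] controls [expR x]. *)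
have [e [e_gt0 e_le1 e_le]] : exists e : R, [/\ 0 < e, e <= 1 & e <= e0 / 10].
  exists (Num.min 1 (e0 / 10)).
  by rewrite lt_min ltr01 divr_gt0// !ge_min !lexx orbT.
have /is_deriveP/(_ e e_gt0)[d1 d10 H1] := @is_derive_expR R 0.
have /is_deriveP/(_ e e_gt0)[d2 d20 H2] := @is_derive_cos R 0.
have /is_deriveP/(_ e e_gt0)[d3 d30 H3] := @is_derive_sin R 0.
exists (Num.min (Num.min d1 d2) (Num.min d3 e)); first by rewrite !lt_min d10 d20 d30.
move=> h; rewrite !lt_min => /andP[/andP[h1 h2] /andP[h3 h4]].
have hR := cabs_Re h; have hI := cabs_Im h.
have := H1 _ (le_lt_trans hR h1); have := H2 _ (le_lt_trans hI h2).
have := H3 _ (le_lt_trans hI h3).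
rewrite !add0r sin0 cos0 expR0 oppr0 mul0r !mul1r !subr0.
have c := cabs_le (cexp h - cexp 0 - h).
move=> s1 c1 x1; apply: (le_trans c); move: s1 c1 x1; rewrite cexp0 !ReD !ImD !ReN !ImN Re_cexp Im_cexp /= oppr0 !addr0.
move: hR hI h4; set x := complex.Re h; set y := complex.Im h; set r := cabs h.
set E := expR x; set cc := cos y; set ss := sin y.
move=> xr yr re s1 c1 x1.
have r0 : 0 <= r := cabs_ge0 h.
have E1 : `|E - 1| <= 2 * r.
  have -> : E - 1 = (E - 1 - x) + x by ring.
  rewrite (le_trans (ler_normD _ _))//.
  have : e * `|x| <= 1 * `|x| by rewrite ler_wpM2r.
  lra.
have E3 : `|E| <= 3.
  have -> : E = (E - 1) + 1 by ring.
  rewrite (le_trans (ler_normD _ _))// normr1; lra.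
have A1 : `|E * cc - 1 - x| <= 4 * e * r.
  have -> : E * cc - 1 - x = (E - 1 - x) + E * (cc - 1) by ring.
  rewrite (le_trans (ler_normD _ _))// normrM.
  have : `|E| * `|cc - 1| <= 3 * (e * `|y|) by apply: ler_pM.
  have : e * `|x| <= e * r by rewrite ler_pM2l.
  have : e * `|y| <= e * r by rewrite ler_pM2l.
  lra.
have A2 : `|E * ss - y| <= 6 * e * r.
  have -> : E * ss - y = E * (ss - y) + (E - 1) * y by ring.
  rewrite (le_trans (ler_normD _ _))// !normrM.
  have : `|E| * `|ss - y| <= 3 * (e * `|y|) by apply: ler_pM.
  have : `|E - 1| * `|y| <= 2 * r * r by apply: ler_pM.
  have : r * r <= e * r by rewrite ler_wpM2r// ltW.
  have : 0 <= e * r by rewrite mulr_ge0// ltW.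
  have : e * `|y| <= e * r by rewrite ler_pM2l.
  lra.
have : 10 * e * r <= e0 * r by rewrite ler_wpM2r//; lra.
lra.
Qed.

Lemma cdiff_cexp z : cdiff (@cexp R) z (cexp z).
Proof.
have H : cdiff (fun w => cexp z * cexp (w - z)) z (cexp z * (1 * (1 - 0))).
  apply: cdiffZ; apply: cdiff_comp; first by rewrite subrr; exact: cdiff_cexp0.
  by apply: cdiffB; [exact: cdiff_id|exact: cdiff_cst].
move: H; rewrite subr0 !mulr1.
by under eq_fun do rewrite -cexpD addrC subrK.
Qed.

(** Continuity of [g] makes its increment [k] small enough for the expansion of [f], which then
    reads [h = d k + o(k)] and is solved for [k]. This differentiates the logarithm and the square
    root. *)
Lemma cdiff_inverse (f g : CC R -> CC R) z d : d != 0 ->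
  (\forall w \near z, f (g w) = w) -> g @ z --> g z -> cdiff f (g z) d -> cdiff g z d^-1.
Proof.
move=> d0 fg cg df e e0; have D0 : 0 < cabs d by rewrite cabs_gt0.
(* The first bound yields [|k| <= 2 |h| / |d|]; the second absorbs this factor and the division by
   [d]. *)
pose e' := Num.min (cabs d / 2) (e * cabs d ^+ 2 / 2).
have e'0 : 0 < e' by rewrite lt_min !divr_gt0// mulr_gt0// exprn_gt0.
have [d1 d10 H1] := df e' e'0.
have /(@cvgCP _ _ (nbhs z) (nbhs_filter z))/(_ _ d10)/nbhsCP[d2 d20 H2] := cg.
move/nbhsCP : fg => [d3 d30 H3].
exists (Num.min d2 d3); first by rewrite lt_min d20.
move=> h; rewrite lt_min => /andP[h2 h3].
have zh : z + h - z = h by rewrite addrAC subrr add0r.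
have kd : cabs (g (z + h) - g z) < d1 by rewrite cabsB; apply: H2; rewrite zh.
have := H1 _ kd; rewrite [g z + _]addrC subrK H3 ?zh// H3 ?subrr ?cabs0// zh.
set k := g (z + h) - g z => hk.
have k2 : cabs k <= 2 * cabs h / cabs d.
  rewrite ler_pdivlMr//.
  have : cabs (d * k) <= cabs (h - d * k) + cabs h.
    rewrite -(cabsN (h - d * k)) opprB (le_trans _ (cabsD _ _))// subrK//.
  have : e' * cabs k <= cabs d / 2 * cabs k by rewrite ler_wpM2r ?cabs_ge0// ge_min lexx.
  rewrite cabsM; lra.
have -> : k - d^-1 * h = - ((h - d * k) / d) by field.
rewrite cabsN cabsM cabsV ler_pdivrMr//; apply: (le_trans hk).
have e'e : e' <= e * cabs d ^+ 2 / 2 by rewrite ge_min lexx orbT.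
apply: (le_trans (ler_pM (ltW e'0) (cabs_ge0 k) e'e k2)).
rewrite le_eqVlt; apply/orP; left; apply/eqP; field.
by rewrite gt_eqF.
Qed.

(** The complement of [(-oo, 0]], encoded as positivity of the denominator in the half-angle formula
    [cArg]; [slitP] gives the geometric form. *)
Definition slit z := 0 < cabs z + complex.Re z.

Lemma slitP z : slit z = ~~ ((complex.Im z == 0) && (complex.Re z <= 0)).
Proof.
rewrite /slit; have [I0|I0] := eqVneq (complex.Im z) 0 => /=.
  rewrite /cabs I0 expr0n addr0 sqrtr_sqr -ltNge.
  have [z0|z0] := ltP 0 (complex.Re z); first by rewrite gtr0_norm// addr_gt0.
  by rewrite ler0_norm// addNr ltxx.
have : `|complex.Re z| < cabs z.
  rewrite -(ltr_pXn2r (n := 2))// ?nnegrE ?cabs_ge0// cabs_sqr -normrX ger0_norm ?sqr_ge0//.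
  by rewrite ltrDl lt_def sqr_ge0 sqrf_eq0 I0.
by rewrite ltr_norml => /andP[H _]; apply/idP; lra.
Qed.

Lemma slit_neq0 z : slit z -> z != 0.
Proof. by apply: contraTneq => ->; rewrite /slit cabs0 add0r ltxx. Qed.

Lemma slit_gt0 z : slit z -> 0 < cabs z.
Proof. by move=> /slit_neq0; rewrite cabs_gt0. Qed.

(** With [t = tan (arg / 2)] one finds [cos^2 (arg / 2) = (|z| + Re z) / (2 |z|)]; doubling the
    angle recovers [z]. *)
Lemma cexp_cLog z : slit z -> cexp (cLog z) = z.
Proof.
move=> sz; have r0 := slit_gt0 sz.
pose t := complex.Im z / (cabs z + complex.Re z).
have D0 : cabs z + complex.Re z != 0 by rewrite gt_eqF.
have t2 : t ^+ 2 = (cabs z - complex.Re z) / (cabs z + complex.Re z).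
  rewrite /t expr_div_n; have -> : complex.Im z ^+ 2 = cabs z ^+ 2 - complex.Re z ^+ 2.
    by rewrite cabs_sqr; ring.
  by field.
have ReL : complex.Re (cLog z) = ln (cabs z) by rewrite /cLog !ReImE /=; ring.
have ImL : complex.Im (cLog z) = 2 * atan t.
  transitivity (cArg z); last by [].
  by rewrite /cLog !ReImE /=; ring.
have c0 : cos (atan t) != 0 by rewrite gt_eqF// cos_gt0_pihalf// atan_gtNpi2 atan_ltpi2.
have st : sin (atan t) = t * cos (atan t).
  by have := atanK t; rewrite /tan => H; rewrite -[X in X * _]H divfK.
have c2 : cos (atan t) ^+ 2 = (cabs z + complex.Re z) / (2 * cabs z).
  have := cos2Dsin2 (atan t); rewrite st exprMn t2 => H.
  have : cos (atan t) ^+ 2 * (1 + (cabs z - complex.Re z) / (cabs z + complex.Re z)) = 1.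
    by rewrite -[RHS]H; ring.
  have -> : 1 + (cabs z - complex.Re z) / (cabs z + complex.Re z) =
     2 * cabs z / (cabs z + complex.Re z) by field.
  have r0' : cabs z != 0 by rewrite gt_eqF.
  move=> H2; transitivity (cos (atan t) ^+ 2 * (2 * cabs z / (cabs z + complex.Re z)) *
    ((cabs z + complex.Re z) / (2 * cabs z))); last by rewrite H2 mul1r.
  by field; rewrite D0 r0'.
have r0' : cabs z != 0 by rewrite gt_eqF.
apply: complexP; rewrite ?Re_cexp ?Im_cexp ReL ImL lnK ?posrE// mulr_natl mulr2n.
  rewrite cosD -!expr2 st exprMn t2 c2; field.
  by rewrite r0' D0.
rewrite sinD st.
have -> : t * cos (atan t) * cos (atan t) + cos (atan t) * (t * cos (atan t)) =
  2 * t * cos (atan t) ^+ 2 by ring.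
by rewrite c2 /t; field; rewrite r0' D0.
Qed.

Lemma cArg_bound z : `|cArg z| <= pi.
Proof.
rewrite /cArg; set t := _ / _; have := atan_gtNpi2 t; have := atan_ltpi2 t => h1 h2.
rewrite ler_norml; apply/andP; split; lra.
Qed.

Lemma cArg_lt z : `|cArg z| < pi.
Proof.
rewrite /cArg; set t := _ / _; have := atan_gtNpi2 t; have := atan_ltpi2 t => h1 h2.
rewrite ltr_norml; apply/andP; split; lra.
Qed.

Lemma slit_open z : slit z -> \forall w \near z, slit w.
Proof.
move=> sz; apply/nbhsCP; exists ((cabs z + complex.Re z) / 2); first by rewrite divr_gt0.
move=> w; rewrite /slit => wz.
have := cabs_dist w z; have := cabs_Re (w - z); rewrite ReD ReN.
rewrite !ler_norml => /andP[h1 _] /andP[h2 _]; lra.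
Qed.

Lemma cLog_cont z : slit z -> (@cLog R) @ z --> cLog z.
Proof.
move=> sz; have FF := nbhs_filter z.
have cz : (fun w : CC R => w) @ z --> z by exact: cvgC_id_at.
have cc := @cvg_cabs R _ _ FF _ _ cz; have cr := @cvg_Re R _ _ FF _ _ cz.
have ci := @cvg_Im R _ _ FF _ _ cz.
have cl : (fun w : CC R => ln (cabs w)) @ z --> ln (cabs z).
  by apply: (@cvg_cont_comp R _ _ FF (@ln R) _ _ cc); apply: continuous_ln; exact: slit_gt0.
have ca : (fun w : CC R => cArg w) @ z --> cArg z.
  apply: cvgM; first exact: cvg_cst.
  have H : (fun w : CC R => complex.Im w / (cabs w + complex.Re w)) @ z -->
      complex.Im z / (cabs z + complex.Re z).
    by apply: cvgM => //; apply: cvgV; [rewrite gt_eqF|exact: cvgD].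
  by apply: (@cvg_cont_comp R _ _ FF (@atan R) _ _ H); exact: continuous_atan.
exact: (cvgCD_at (@cvg_real R _ _ FF _ _ cl) (cvgCM_at (@cvgC_cst_at R 'i z) (@cvg_real R _ _ FF _ _ ca))).
Qed.

Lemma cdiff_cLog z : slit z -> cdiff (@cLog R) z z^-1.
Proof.
move=> sz; apply: (@cdiff_inverse (@cexp R) (@cLog R)).
- exact: slit_neq0.
- by apply: filterS (slit_open sz) => w; exact: cexp_cLog.
- exact: cLog_cont.
- by have := cdiff_cexp (cLog z); rewrite cexp_cLog.
Qed.

Lemma psqrt_sqr z : psqrt z ^+ 2 = z.
Proof.
have rp : 0 <= cabs z + complex.Re z.
  by have := cabs_Re z; rewrite ler_norml => /andP[]; lra.
have rm : 0 <= cabs z - complex.Re z.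
  by have := cabs_Re z; rewrite ler_norml => /andP[]; lra.
set p := Num.sqrt ((cabs z + complex.Re z) / 2).
set q := Num.sqrt ((cabs z - complex.Re z) / 2).
have p2 : p ^+ 2 = (cabs z + complex.Re z) / 2 by rewrite sqr_sqrtr// divr_ge0.
have q2 : q ^+ 2 = (cabs z - complex.Re z) / 2 by rewrite sqr_sqrtr// divr_ge0.
have pq : 2 * (p * q) = `|complex.Im z|.
  rewrite /p /q -sqrtrM ?divr_ge0//.
  have -> : (cabs z + complex.Re z) / 2 * ((cabs z - complex.Re z) / 2) = (complex.Im z / 2) ^+ 2.
    have -> : (cabs z + complex.Re z) / 2 * ((cabs z - complex.Re z) / 2) =
      (cabs z ^+ 2 - complex.Re z ^+ 2) / 4 by field.
    by rewrite cabs_sqr; field.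
  by rewrite sqrtr_sqr normrM [`|2^-1|]gtr0_norm ?invr_gt0//; field.
rewrite expr2; apply: complexP; rewrite ?ReM ?ImM /= -/p -/q.
  have -> : p * p - (if complex.Im z < 0 then -1 else 1) * q *
     ((if complex.Im z < 0 then -1 else 1) * q) = p ^+ 2 - q ^+ 2 by case: ifP => _; ring.
  by rewrite p2 q2; field.
case: ifPn => [neg|]; last rewrite -leNgt => pos.
  have -> : p * (-1 * q) + -1 * q * p = - (2 * (p * q)) by ring.
  by rewrite pq ltr0_norm// opprK.
have -> : p * (1 * q) + 1 * q * p = 2 * (p * q) by ring.
by rewrite pq ger0_norm.
Qed.

Lemma Re_psqrt_ge0 z : 0 <= complex.Re (psqrt z).
Proof. exact: sqrtr_ge0. Qed.

Lemma Re_psqrt_gt0 z : slit z -> 0 < complex.Re (psqrt z).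
Proof. by move=> sz; rewrite /= sqrtr_gt0 divr_gt0. Qed.

Lemma psqrt_eq z u : u ^+ 2 = z -> 0 < complex.Re u -> psqrt z = u.
Proof.
move=> <- u0; have /eqP := psqrt_sqr (u ^+ 2).
rewrite -subr_eq0 subr_sqr mulf_eq0 subr_eq0 addr_eq0 => /orP[/eqP //|/eqP E].
by have := Re_psqrt_ge0 (u ^+ 2); rewrite E ReN oppr_ge0 leNgt u0.
Qed.

End exp_log_sqrt.

(** * Entire power series *)

Lemma cvgnS {R : realType} (u : nat -> CC R) (l : CC R) :
  u @ \oo --> l -> (fun N => u N.+1) @ \oo --> l.
Proof. by move=> ul; rewrite (cvg_shiftS u). Qed.

Lemma cvgnM {R : realType} (u v : nat -> CC R) (l m : CC R) :
  u @ \oo --> l -> v @ \oo --> m -> (fun N => u N * v N) @ \oo --> l * m.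
Proof. exact: cvgCM. Qed.

Lemma cvgnD {R : realType} (u v : nat -> CC R) (l m : CC R) :
  u @ \oo --> l -> v @ \oo --> m -> (fun N => u N + v N) @ \oo --> l + m.
Proof. exact: cvgCD. Qed.

Lemma cvgnB {R : realType} (u v : nat -> CC R) (l m : CC R) :
  u @ \oo --> l -> v @ \oo --> m -> (fun N => u N - v N) @ \oo --> l - m.
Proof. exact: cvgCB. Qed.

Lemma cvgn_cst {R : realType} (l : CC R) : (fun _ : nat => l) @ \oo --> l.
Proof. exact: cvgC_cst. Qed.

Lemma cvgn_cabs {R : realType} (u : nat -> CC R) (l : CC R) :
  u @ \oo --> l -> (fun N => cabs (u N)) @ \oo --> cabs l.
Proof. exact: cvg_cabs. Qed.

Lemma cvgn_Re {R : realType} (u : nat -> CC R) (l : CC R) :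
  u @ \oo --> l -> (fun N => complex.Re (u N)) @ \oo --> complex.Re l.
Proof. exact: cvg_Re. Qed.

Lemma cvgn_Im {R : realType} (u : nat -> CC R) (l : CC R) :
  u @ \oo --> l -> (fun N => complex.Im (u N)) @ \oo --> complex.Im l.
Proof. exact: cvg_Im. Qed.

Section power_series.
Context {R : realType}.
Implicit Types (a b : nat -> R) (z h : CC R).

(** Coefficients dominated by those of an exponential. The class is stable under derivation, sums
    and multiplication by the variable, and convergence reduces to the series of [expR]. *)
Definition entire a := exists B M : R,
  [/\ 0 <= B, 0 <= M & forall k, `|a k| <= B * (M ^+ k / (k`!)%:R)].

Definition ps a z : CC R := cseries (fun k => (a k)%:C * z ^+ k).

Definition dps a k : R := k.+1%:R * a k.+1.

Lemma entire_dps a : entire a -> entire (dps a).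
Proof.
move=> [B [M [B0 M0 H]]]; exists (B * M), M; split=> //; first by rewrite mulr_ge0.
move=> k; rewrite /dps normrM normr_nat.
apply: (le_trans (ler_wpM2l _ (H k.+1))) => //.
rewrite le_eqVlt; apply/orP; left; apply/eqP.
have k0 : (k.+1%:R : R) != 0 by rewrite pnatr_eq0.
have f0 : ((k`!)%:R : R) != 0 by rewrite pnatr_eq0 -lt0n fact_gt0.
by rewrite factS natrM exprS; field; rewrite f0 addrC natr1 k0.
Qed.

Lemma exp_partial_le (x : R) n : 0 <= x -> \sum_(k < n) x ^+ k / (k`!)%:R <= expR x.
Proof.
move=> x0.
have nd : nondecreasing_seq (series (exp_coeff x)).
  apply/nondecreasing_seqP => k; rewrite /series /= big_nat_recr//= lerDl.
  by rewrite /exp_coeff /= divr_ge0 ?exprn_ge0.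
have := nondecreasing_cvgn_le nd (is_cvg_series_exp_coeff x) n.
by rewrite /series /= big_mkord.
Qed.

Lemma series_cvg_of_bound (u : nat -> CC R) (B x : R) : 0 <= B -> 0 <= x ->
  (forall k, cabs (u k) <= B * (x ^+ k / (k`!)%:R)) ->
  (fun N : nat => \sum_(k < N) u k) @ \oo --> cseries u.
Proof.
move=> B0 x0 H.
have key (p : CC R -> R) : (forall z, `|p z| <= cabs z) ->
    cvgn (series (fun k => p (u k))).
  move=> pb; apply: normed_cvg.
  have n0 k : 0 <= `|p (u k)| by [].
  have e0 k : 0 <= B * exp_coeff x k by rewrite mulr_ge0// exp_coeff_ge0.
  have le k : `|p (u k)| <= B * exp_coeff x k by apply: le_trans (pb _) (H k).
  apply: (series_le_cvg n0 e0 le).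
  by apply: is_cvg_seriesZ; exact: is_cvg_series_exp_coeff.
have c1 := key (@complex.Re R) (@cabs_Re R).
have c2 := key (@complex.Im R) (@cabs_Im R).
have E (p : CC R -> R) : (forall N, p (\sum_(k < N) u k) = \sum_(k < N) p (u k)) ->
   (fun N : nat => p (\sum_(k < N) u k)) = series (fun k => p (u k)).
  by move=> pN; apply/funext => N; rewrite pN /series /= big_mkord.
pose l : CC R := limn (series (fun k => complex.Re (u k))) +i*
  limn (series (fun k => complex.Im (u k))).
have sl : (fun N : nat => \sum_(k < N) u k) @ \oo --> l.
  apply/cvgC_ReIm; rewrite !E; first by split.
    by move=> N; elim/big_rec2 : _ => [//|i y z _ <-]; rewrite ImD.
  by move=> N; elim/big_rec2 : _ => [//|i y z _ <-]; rewrite ReD.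
suff -> : cseries u = l by [].
exact: (cvg_lim (@norm_hausdorff _ _) sl).
Qed.

Lemma ps_cvg a z : entire a -> (fun N : nat => \sum_(k < N) (a k)%:C * z ^+ k) @ \oo --> ps a z.
Proof.
move=> [B [M [B0 M0 H]]]; apply: (@series_cvg_of_bound _ B (M * cabs z)) => //.
  by rewrite mulr_ge0 ?cabs_ge0.
move=> k; rewrite cabsM cabsR cabsX.
apply: (le_trans (ler_wpM2r _ (H k))); first by rewrite exprn_ge0 ?cabs_ge0.
by rewrite le_eqVlt exprMn; apply/orP; left; apply/eqP; ring.
Qed.

Arguments ps_cvg {a} z _.

(** Deliberately crude: [1 <= rho] allows every power to be rounded up to [rho ^+ k], and a factor
    [k^2] is summable against the coefficients of an entire series. *)
Lemma pow_taylor2 (k : nat) (rho : R) z h : 1 <= rho -> cabs z <= rho -> cabs (z + h) <= rho ->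
  cabs ((z + h) ^+ k - z ^+ k - k%:R * z ^+ k.-1 * h) <= k%:R ^+ 2 * rho ^+ k * cabs h ^+ 2.
Proof.
move=> r1 zr zhr; have r0 : 0 <= rho by rewrite (le_trans ler01).
have key : forall j, cabs ((z + h) ^+ j.+1 - z ^+ j.+1 - j.+1%:R * z ^+ j * h) <=
    j.+1%:R ^+ 2 * rho ^+ j.+1 * cabs h ^+ 2.
  elim=> [|j IH].
    rewrite !expr1 expr0 mulr1 mul1r; have -> : z + h - z - h = 0 by ring.
    by rewrite cabs0 !mulr_ge0 ?exprn_ge0 ?cabs_ge0.
  have -> : (z + h) ^+ j.+2 - z ^+ j.+2 - j.+2%:R * z ^+ j.+1 * h =
    (z + h) * ((z + h) ^+ j.+1 - z ^+ j.+1 - j.+1%:R * z ^+ j * h) +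
      (j.+1%:R * z ^+ j) * h ^+ 2.
    by rewrite -[j.+2%:R]natr1 !exprS; ring.
  apply: (le_trans (cabsD _ _)); rewrite !cabsM !cabsX cabs_nat.
  apply: (@le_trans _ _ (rho * (j.+1%:R ^+ 2 * rho ^+ j.+1 * cabs h ^+ 2) +
     j.+1%:R * rho ^+ j.+2 * cabs h ^+ 2)).
    apply: lerD; first by apply: ler_pM => //; exact: cabs_ge0.
    rewrite -expr2; apply: ler_wpM2r; first by rewrite exprn_ge0 ?cabs_ge0.
    apply: ler_wpM2l => //; apply: (@le_trans _ _ (rho ^+ j)).
      by rewrite lerXn2r ?nnegrE ?cabs_ge0.
    by apply: ler_weXn2l => //; rewrite -addn2 leq_addr.
  have -> : rho * (j.+1%:R ^+ 2 * rho ^+ j.+1 * cabs h ^+ 2) + j.+1%:R * rho ^+ j.+2 * cabs h ^+ 2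
    = (j.+1%:R ^+ 2 + j.+1%:R) * rho ^+ j.+2 * cabs h ^+ 2 by rewrite !exprS; ring.
  rewrite ler_wpM2r ?exprn_ge0 ?cabs_ge0// ler_wpM2r ?exprn_ge0//.
  rewrite -[j.+2%:R]natr1; have : (0 : R) <= j.+1%:R by []; set t := j.+1%:R; nra.
case: k => [|k]; last exact: key.
by rewrite !expr0 !mul0r subrr subr0 cabs0 expr0n !mul0r.
Qed.

(** Since [k <= 2^k], the factor [k^2] is at most [4^k] and only enlarges the exponential type. *)
Lemma sum_entire_sq_bound a : entire a -> forall rho : R, 0 <= rho -> exists2 C : R, 0 <= C &
  forall N : nat, \sum_(k < N) `|a k| * (k%:R ^+ 2 * rho ^+ k) <= C.
Proof.
move=> [B [M [B0 M0 H]]] rho r0; exists (B * expR (4 * M * rho)); first by rewrite mulr_ge0 ?expR_ge0.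
move=> N; apply: (@le_trans _ _ (\sum_(k < N) B * ((4 * M * rho) ^+ k / (k`!)%:R))).
  apply: ler_sum => k _.
  have k2 : (k%:R : R) <= 2 ^+ k by rewrite -natrX ler_nat ltnW// ltn_expl.
  have k4 : (k%:R : R) ^+ 2 <= 4 ^+ k.
    have -> : (4 : R) ^+ k = (2 ^+ k) ^+ 2 by rewrite -!exprM mulnC exprM; congr (_ ^+ _); rewrite expr2 -natrM.
    by rewrite lerXn2r ?nnegrE.
  apply: (@le_trans _ _ (B * (M ^+ k / (k`!)%:R) * (4 ^+ k * rho ^+ k))).
    by apply: ler_pM => //; rewrite ?mulr_ge0 ?exprn_ge0// ler_wpM2r ?exprn_ge0.
  rewrite le_eqVlt; apply/orP; left; apply/eqP; rewrite !exprMn; field.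
  by rewrite pnatr_eq0 -lt0n fact_gt0.
by rewrite -mulr_sumr ler_wpM2l// exp_partial_le// !mulr_ge0.
Qed.

(** The quadratic remainder estimate holds for partial sums with a constant independent of their
    length, and passes to the limit. The partial sums of [dps a] are one term shorter because of the
    index shift. *)
Lemma cdiff_ps a z : entire a -> cdiff (ps a) z (ps (dps a) z).
Proof.
move=> ea; pose rho := cabs z + 1.
have r0 : 0 <= rho by rewrite addr_ge0 ?cabs_ge0.
have [C C0 HC] := sum_entire_sq_bound ea r0.
have main h : cabs h <= 1 -> cabs (ps a (z + h) - ps a z - ps (dps a) z * h) <= C * cabs h ^+ 2.
  move=> h1.
  have bd (N : nat) : cabs (\sum_(k < N.+1) (a k)%:C * (z + h) ^+ k - \sum_(k < N.+1) (a k)%:C * z ^+ k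
      - (\sum_(k < N) (dps a k)%:C * z ^+ k) * h) <= C * cabs h ^+ 2.
    have -> : (\sum_(k < N) (dps a k)%:C * z ^+ k) * h =
        \sum_(k < N.+1) (a k)%:C * (k%:R * z ^+ k.-1 * h).
      rewrite big_ord_recl /= !mul0r mulr0 add0r mulr_suml; apply: eq_bigr => k _.
      rewrite /dps rmorphM /= rmorph_nat /bump /= add1n; ring.
    rewrite -!sumrB.
    apply: (le_trans (cabs_sum _ _ _)).
    apply: le_trans (ler_wpM2r _ (HC N.+1)); last by rewrite exprn_ge0 ?cabs_ge0.
    rewrite mulr_suml; apply: ler_sum => k _.
    have -> : (a k)%:C * (z + h) ^+ k - (a k)%:C * z ^+ k - (a k)%:C * (k%:R * z ^+ k.-1 * h) =
      (a k)%:C * ((z + h) ^+ k - z ^+ k - k%:R * z ^+ k.-1 * h) by ring.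
    rewrite cabsM cabsR -[leRHS]mulrA; apply: ler_wpM2l => //; apply: pow_taylor2.
    - by rewrite lerDr cabs_ge0.
    - by rewrite lerDl.
    - by rewrite (le_trans (cabsD _ _))// lerD2l.
  have lim : (fun N : nat => cabs (\sum_(k < N.+1) (a k)%:C * (z + h) ^+ k -
      \sum_(k < N.+1) (a k)%:C * z ^+ k - (\sum_(k < N) (dps a k)%:C * z ^+ k) * h)) @ \oo -->
      cabs (ps a (z + h) - ps a z - ps (dps a) z * h).
    have l1 := cvgnM (ps_cvg z (entire_dps ea)) (@cvgn_cst R h).
    have l2 := cvgnB (cvgnB (cvgnS (ps_cvg (z + h) ea)) (cvgnS (ps_cvg z ea))) l1.
    exact: cvgn_cabs l2.
  apply: (ler_cvg_to lim (cvg_cst (C * cabs h ^+ 2))).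
  by apply: nearW => N; exact: bd.
move=> e e0; exists (Num.min 1 (e / (C + 1))).
  by rewrite lt_min ltr01 divr_gt0// ltr_wpDl.
move=> h; rewrite lt_min => /andP[h1 h2].
apply: (le_trans (main h (ltW h1))).
rewrite expr2 mulrA; apply: ler_wpM2r; first exact: cabs_ge0.
have h2' : cabs h * (C + 1) <= e by rewrite -ler_pdivlMr ?ltW// ltr_wpDl.
by have := cabs_ge0 h; nra.
Qed.

Lemma ps_ext a b z : (forall k, a k = b k) -> ps a z = ps b z.
Proof. by move=> ab; congr cseries; apply/funext => k; rewrite ab. Qed.

Lemma entireD a b : entire a -> entire b -> entire (fun k => a k + b k).
Proof.
move=> [B [M [B0 M0 H]]] [B' [M' [B0' M0' H']]].
exists (B + B'), (M + M'); split; rewrite ?addr_ge0// => k.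
apply: (le_trans (ler_normD _ _)); rewrite mulrDl; apply: lerD.
  apply: (le_trans (H k)); rewrite ler_wpM2l// ler_wpM2r ?invr_ge0//.
  by rewrite lerXn2r ?nnegrE ?addr_ge0// lerDl.
apply: (le_trans (H' k)); rewrite ler_wpM2l// ler_wpM2r ?invr_ge0//.
by rewrite lerXn2r ?nnegrE ?addr_ge0// lerDr.
Qed.

Lemma psD a b z : entire a -> entire b -> ps (fun k => a k + b k) z = ps a z + ps b z.
Proof.
move=> ea eb.
have H1 := ps_cvg z (entireD ea eb).
have H2 := cvgnD (ps_cvg z ea) (ps_cvg z eb).
apply: (cvg_unique (@norm_hausdorff _ (CC R)) H1).
suff -> : (fun N => \sum_(k < N) (a k + b k)%:C * z ^+ k) =
  (fun N => \sum_(k < N) (a k)%:C * z ^+ k + \sum_(k < N) (b k)%:C * z ^+ k) by exact: H2.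
apply/funext => N; rewrite -big_split /=; apply: eq_bigr => k _.
by rewrite rmorphD /= mulrDl.
Qed.

Definition shift a k : R := if k is k'.+1 then a k' else 0.

Lemma entire_shift a : entire a -> entire (shift a).
Proof.
move=> [B [M [B0 M0 H]]].
exists (B * 1), (2 * M + 1); split=> //; rewrite ?mulr1 ?addr_ge0 ?mulr_ge0// => -[|k] /=.
  by rewrite normr0 mulr_ge0// divr_ge0.
apply: (le_trans (H k)); rewrite ler_wpM2l//.
have f0 : (0 : R) < (k`!)%:R by rewrite ltr0n fact_gt0.
rewrite ler_pdivrMr// mulrAC ler_pdivlMr ?ltr0n ?fact_gt0// factS natrM mulrA ler_wpM2r//.
have k2 : (k.+1%:R : R) <= 2 ^+ k by rewrite -natrX ler_nat ltn_expl.
apply: (@le_trans _ _ ((2 * M) ^+ k)).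
  by rewrite exprMn mulrC ler_wpM2r ?exprn_ge0.
apply: (@le_trans _ _ ((2 * M + 1) ^+ k)).
  by rewrite lerXn2r ?nnegrE ?addr_ge0 ?mulr_ge0// lerDl.
by apply: ler_weXn2l => //; rewrite lerDr mulr_ge0.
Qed.

Lemma ps_shift a z : entire a -> ps (shift a) z = z * ps a z.
Proof.
move=> ea; have H1 := cvgnS (ps_cvg z (entire_shift ea)).
have H2 := cvgnM (@cvgn_cst R z) (ps_cvg z ea).
apply: (cvg_unique (@norm_hausdorff _ (CC R)) H1).
suff -> : (fun n : nat => \sum_(k < n.+1) (shift a k)%:C * z ^+ k) =
    (fun n : nat => z * \sum_(k < n) (a k)%:C * z ^+ k) by exact: H2.
apply/funext => N; rewrite big_ord_recl /= mul0r add0r mulr_sumr.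
by apply: eq_bigr => k _; rewrite /bump /= add1n exprS; ring.
Qed.

Lemma ps_real a (x : R) : entire a -> complex.Im (ps a x%:C) = 0.
Proof.
move=> ea; have := cvgn_Im (ps_cvg x%:C ea).
have -> : (fun N : nat => complex.Im (\sum_(k < N) (a k)%:C * (x%:C : CC R) ^+ k)) = (fun=> 0).
  apply/funext => N; elim/big_rec : _ => [//|k y _ Hy].
  by rewrite ImD Hy -rmorphXn -rmorphM /= addr0.
move=> H; rewrite -(cvg_lim (@Rhausdorff R) H).
by apply: cvg_lim => //; exact: cvg_cst.
Qed.

Definition rps a (x : R) : R := complex.Re (ps a x%:C).

Lemma psE a (x : R) : entire a -> ps a x%:C = (rps a x)%:C.
Proof. by move=> ea; apply: complexP; rewrite ?(ps_real x ea). Qed.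

Lemma rps_cvg a (x : R) : entire a -> (fun N : nat => \sum_(k < N) a k * x ^+ k) @ \oo --> rps a x.
Proof.
move=> ea; have := cvgn_Re (ps_cvg x%:C ea).
suff -> : (fun N : nat => complex.Re (\sum_(k < N) (a k)%:C * (x%:C : CC R) ^+ k)) =
  (fun N : nat => \sum_(k < N) a k * x ^+ k) by [].
apply/funext => N; elim/big_rec2 : _ => [//|k y z _ Hy].
by rewrite ReD Hy -rmorphXn -rmorphM.
Qed.

Arguments rps_cvg {a} x _.

Lemma rps_le a b (x : R) : entire a -> entire b -> (forall k, a k * x ^+ k <= b k * x ^+ k) ->
  rps a x <= rps b x.
Proof.
move=> ea eb ab; apply: (ler_cvg_to (rps_cvg x ea) (rps_cvg x eb)).
by apply: nearW => N; apply: ler_sum => k _; exact: ab.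
Qed.

End power_series.

Arguments ps_cvg {R a} z _.
Arguments rps_cvg {R a} x _.

(** * Bessel functions of order 0 *)

Section bessel.
Context {R : realType}.
Implicit Types (w z : CC R) (a : nat -> R).

(** Coefficients in the variable [w^2 / 4]: [cI] for [I_0], and [cL] for the part of [K_0] free of
    the logarithm. *)
Definition cI k : R := ((k`!)%:R ^+ 2)^-1.
Definition cL k : R := Hnum k / (k`!)%:R ^+ 2.

Lemma fact_neq0R k : ((k`!)%:R : R) != 0.
Proof. by rewrite pnatr_eq0 -lt0n fact_gt0. Qed.

Lemma cI_gt0 k : 0 < cI k.
Proof. by rewrite /cI invr_gt0 exprn_gt0// ltr0n fact_gt0. Qed.

Lemma Hnum_ge0 k : 0 <= (Hnum k : R).
Proof. by apply: sumr_ge0 => i _; rewrite invr_ge0. Qed.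

Lemma HnumS k : Hnum k.+1 = Hnum k + (k.+1%:R)^-1 :> R.
Proof. by rewrite /Hnum big_ord_recr. Qed.

Lemma Hnum_le k : (Hnum k : R) <= k%:R.
Proof.
elim: k => [|k IH]; first by rewrite /Hnum big_ord0.
by rewrite HnumS -[leRHS]natr1 lerD// invf_le1 ?ltr0n ?ler1n.
Qed.

Lemma fact_ge1R k : (1 : R) <= (k`!)%:R. Proof. by rewrite ler1n fact_gt0. Qed.

Lemma entire_cI : entire cI.
Proof.
exists 1, 1; split=> // k; rewrite expr1n mul1r gtr0_norm ?cI_gt0// /cI div1r.
have f1 := fact_ge1R k; have f0 : 0 < (k`!)%:R :> R by rewrite ltr0n fact_gt0.
rewrite lef_pV2 ?posrE ?exprn_gt0// expr2 ler_peMr// ltW.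
Qed.

Lemma entire_cL : entire cL.
Proof.
exists 1, 1; split=> // k; rewrite expr1n mul1r div1r /cL.
have f0 : 0 < (k`!)%:R :> R by rewrite ltr0n fact_gt0.
have p0 : 0 <= Hnum k / (k`!)%:R ^+ 2 :> R by rewrite divr_ge0 ?Hnum_ge0 ?exprn_ge0.
rewrite (ger0_norm p0).
rewrite ler_pdivrMr ?exprn_gt0// expr2 mulrA mulVf ?gt_eqF// mul1r.
by rewrite (le_trans (Hnum_le k))// ler_nat fact_geq.
Qed.

(** In the variable [z = w^2 / 4] the modified Bessel equation reads [z f'' + f' = f], and the
    operator on the left sends [z^k] to [k^2 z^(k - 1)]. The equations for [cI] and [cL] become
    recurrences; the extra term for [cL] compensates the derivatives of the logarithm. *)
Lemma ps_ode a z : entire a ->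
  z * ps (dps (dps a)) z + ps (dps a) z = ps (fun k => k.+1%:R ^+ 2 * a k.+1) z.
Proof.
move=> ea; have e1 := entire_dps ea; have e2 := entire_dps e1.
rewrite -(ps_shift z e2) -(psD z (entire_shift e2) e1); apply: ps_ext => -[|k] /=.
  by rewrite /dps expr1n; ring.
by rewrite /dps -[k.+2%:R]natr1; ring.
Qed.

Lemma cI_S k : k.+1%:R ^+ 2 * cI k.+1 = cI k.
Proof.
have f0 := fact_neq0R k; rewrite /cI factS natrM; field.
by rewrite f0 addrC natr1 pnatr_eq0.
Qed.

Lemma dps_cI k : dps cI k = cI k / k.+1%:R.
Proof.
have f0 := fact_neq0R k; rewrite /dps /cI factS natrM; field.
by rewrite f0 addrC natr1 pnatr_eq0.
Qed.

Lemma cL_S k : k.+1%:R ^+ 2 * cL k.+1 = cL k + dps cI k.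
Proof.
have f0 := fact_neq0R k; rewrite dps_cI /cL /cI HnumS factS natrM; field.
by rewrite f0 addrC natr1 pnatr_eq0.
Qed.

Lemma cI_ode z : z * ps (dps (dps cI)) z + ps (dps cI) z = ps cI z.
Proof. by rewrite ps_ode; [apply: ps_ext => k; exact: cI_S|exact: entire_cI]. Qed.

Lemma cL_ode z : z * ps (dps (dps cL)) z + ps (dps cL) z = ps cL z + ps (dps cI) z.
Proof.
rewrite ps_ode; last exact: entire_cL.
rewrite -psD; [|exact: entire_cL|exact/entire_dps/entire_cI].
by apply: ps_ext => k; exact: cL_S.
Qed.

Lemma besselI0E w : besselI0 w = ps cI (w ^+ 2 / 4).
Proof.
congr cseries; apply/funext => k.
by rewrite /cI mulrC fmorphV /= rmorphXn /= rmorph_nat.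
Qed.

Lemma besselK0E w :
  besselK0 w = - (cLog (w / 2) + (euler_gamma : R)%:C) * ps cI (w ^+ 2 / 4) + ps cL (w ^+ 2 / 4).
Proof.
rewrite /besselK0 besselI0E; congr (_ + _); congr cseries; apply/funext => k.
by rewrite /cL rmorphM /= fmorphV /= rmorphXn /= rmorph_nat; ring.
Qed.

(* the Euler operator [w d/dw] applied to [besselI0] and [besselK0] *)
Definition thetaI w : CC R := w ^+ 2 / 2 * ps (dps cI) (w ^+ 2 / 4).
Definition thetaK w : CC R := - ps cI (w ^+ 2 / 4)
  - (cLog (w / 2) + (euler_gamma : R)%:C) * thetaI w
  + w ^+ 2 / 2 * ps (dps cL) (w ^+ 2 / 4).

Lemma slit_half w : slit w -> slit (w / 2).
Proof.
have n2 : (2%:R^-1 : CC R) = (2^-1)%:C by rewrite fmorphV /= rmorph_nat.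
rewrite /slit n2 cabsM cabsR gtr0_norm ?invr_gt0// ReM /= mulr0 subr0 -mulrDl => H.
by rewrite mulr_gt0// invr_gt0.
Qed.

Lemma cdiff_quarter w : cdiff (fun v => v ^+ 2 / 4) w (w / 2).
Proof.
apply: cdiff_eq.
  apply: cdiffM; last exact: cdiff_cst.
  by apply: cdiffX; exact: cdiff_id.
by rewrite /= expr1; field.
Qed.

Lemma cdiff_ps_quarter a w : entire a ->
  cdiff (fun v => ps a (v ^+ 2 / 4)) w (ps (dps a) (w ^+ 2 / 4) * (w / 2)).
Proof.
move=> ea; apply: (@cdiff_comp _ (ps a) (fun v => v ^+ 2 / 4)); first exact: cdiff_ps.
exact: cdiff_quarter.
Qed.

Lemma cdiff_log_half w : slit w -> cdiff (fun v => cLog (v / 2) + (euler_gamma : R)%:C) w w^-1.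
Proof.
move=> sw; have w0 := slit_neq0 sw.
have D1 := cdiffM (cdiff_id w) (cdiff_cst (2^-1) w).
have D2 := @cdiff_comp _ (@cLog R) (fun v => v / 2) w _ _ (cdiff_cLog (slit_half sw)) D1.
apply: cdiff_eq (cdiffD D2 (cdiff_cst (euler_gamma : R)%:C w)) _.
by field.
Qed.

Lemma cdiff_theta a w : entire a ->
  cdiff (fun v => v ^+ 2 / 2 * ps (dps a) (v ^+ 2 / 4)) w
    (w * (w ^+ 2 / 4 * ps (dps (dps a)) (w ^+ 2 / 4) + ps (dps a) (w ^+ 2 / 4))).
Proof.
move=> ea; have D1 := cdiff_ps_quarter w (entire_dps ea).
have D2 := cdiffM (cdiffX 2 (cdiff_id w)) (cdiff_cst (2^-1) w).
apply: cdiff_eq (cdiffM D2 D1) _.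
by rewrite /= expr1; field.
Qed.

Lemma cdiff_besselK0 w : slit w -> cdiff (@besselK0 R) w (thetaK w / w).
Proof.
move=> sw; have w0 := slit_neq0 sw.
have D := cdiffD (cdiffM (cdiffN (cdiff_log_half sw)) (cdiff_ps_quarter w entire_cI))
  (cdiff_ps_quarter w entire_cL).
have -> : (@besselK0 R) = (fun v => - (cLog (v / 2) + (euler_gamma : R)%:C) * ps cI (v ^+ 2 / 4)
    + ps cL (v ^+ 2 / 4)) by apply/funext => v; exact: besselK0E.
apply: cdiff_eq D _.
by rewrite /thetaK /thetaI; field.
Qed.

(** The modified Bessel equation in the form [theta (theta K_0) = w^2 K_0], for the Euler operator
    [theta = w d/dw]. *)
Lemma cdiff_thetaK w : slit w -> cdiff thetaK w (w * besselK0 w).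
Proof.
move=> sw; have w0 := slit_neq0 sw.
have D1 := cdiff_theta w entire_cI; have D2 := cdiff_theta w entire_cL.
rewrite cI_ode in D1; rewrite cL_ode in D2.
have D := cdiffD (cdiffB (cdiffN (cdiff_ps_quarter w entire_cI))
  (cdiffM (cdiff_log_half sw) D1)) D2.
apply: cdiff_eq D _.
by rewrite besselK0E; field.
Qed.

Lemma ps_at0 a : entire a -> ps a 0 = (a 0%N)%:C.
Proof.
move=> ea; have H := cvgnS (ps_cvg 0 ea).
apply: (cvg_unique (@norm_hausdorff _ (CC R)) H).
suff -> : (fun N => \sum_(k < N.+1) (a k)%:C * (0 : CC R) ^+ k) = (fun=> (a 0%N)%:C).
  exact: cvgn_cst.
apply/funext => N; rewrite big_ord_recl expr0 mulr1 big1 ?addr0// => k _.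
by rewrite expr0n mulr0.
Qed.

(** The left-hand side is [I_0 theta K_0 - K_0 theta I_0] after the logarithms have cancelled. Only
    entire series remain, the differential equations make the expression constant, and it can be
    evaluated at [0]. *)
Lemma bessel_wronskian z (t : R) : z = t%:C -> 0 <= t ->
  - ps cI z ^+ 2 + ps cI z * (2 * z * ps (dps cL) z) - 2 * z * ps (dps cI) z * ps cL z = -1.
Proof.
move=> -> t0; pose W (t : R) : CC R := - ps cI t%:C ^+ 2 + ps cI t%:C * (2 * t%:C * ps (dps cL) t%:C)
  - 2 * t%:C * ps (dps cI) t%:C * ps cL t%:C.
have eI := entire_cI; have eL := entire_cL.
have dW s : pder W s 0.
  have id1 : pder (fun s : R => s%:C : CC R) s 1 by apply: (pder_real (@is_derive_id _ _ s 1)).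
  have dp a : entire a -> pder (fun s : R => ps a s%:C) s (ps (dps a) s%:C).
    by move=> ea; apply: pder_eq (pder_comp (cdiff_ps s%:C ea) id1) _; rewrite mulr1.
  have d2 : pder (fun s : R => 2 * s%:C : CC R) s (2 * 1) by exact: pderZ.
  have dI := dp _ eI; have dL := dp _ eL.
  have ddI := dp _ (entire_dps eI); have ddL := dp _ (entire_dps eL).
  have D := pderB (pderD (pderN (pderM dI dI)) (pderM dI (pderM d2 ddL)))
     (pderM (pderM d2 ddI) dL).
  have -> : W = (fun v : R => - (ps cI v%:C * ps cI v%:C) + ps cI v%:C * (2 * v%:C * ps (dps cL) v%:C) -
      2 * v%:C * ps (dps cI) v%:C * ps cL v%:C) by apply/funext => v; rewrite /W expr2.
  apply: pder_eq D _.
  have HI := cI_ode s%:C; have HL := cL_ode s%:C.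
  move: HI HL; set i := ps cI _; set i1 := ps (dps cI) _; set i2 := ps (dps (dps cI)) _.
  set l := ps cL _; set l1 := ps (dps cL) _; set l2 := ps (dps (dps cL)) _.
  set x : CC R := s%:C => HI HL.
  have -> : - (i * i1 + i * i1) + (i * (2 * x * l2 + l1 * (2 * 1)) + 2 * x * l1 * i1) -
      (2 * x * i1 * l1 + l * (2 * x * i2 + i1 * (2 * 1))) =
    2 * (i * (x * l2 + l1) - l * (x * i2 + i1) - i * i1) by ring.
  by rewrite HI HL; ring.
have W0 : W 0 = -1.
  rewrite /W (ps_at0 eI) mulr0 !mul0r mulr0 subr0 addr0.
  by rewrite /cI fact0 !expr1n invr1 expr1n.
rewrite -/(W t) -W0; move: t0; rewrite le_eqVlt => /predU1P[<-//|t0].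
apply/esym; apply: const_of_pder => // s _.
exact: pder_cont (dW s).
Qed.

End bessel.

(** * The function K_0 on the positive axis *)

Lemma le_of_derive {R : realType} (f f' : R -> R) (a b : R) : a <= b ->
  (forall x, a <= x <= b -> is_derive x 1 f (f' x)) -> (forall x, a <= x <= b -> 0 <= f' x) ->
  f a <= f b.
Proof.
move=> ab df f0.
have cf : {within `[a, b], continuous f}.
  apply: continuous_in_subspaceT => x /set_mem /=; rewrite in_itv /= => /df H.
  by apply: differentiable_continuous; apply/derivable1_diffP; case: H.
have df' x : x \in `]a, b[ -> is_derive x 1 f (f' x).
  by rewrite in_itv /= => /andP[/ltW ax /ltW xb]; apply: df; rewrite ax.
have [c cab] := MVT_segment ab df' cf.
by rewrite -subr_ge0 => ->; rewrite mulr_ge0 ?subr_ge0// f0.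
Qed.

Section bessel_real_axis.
Context {R : realType}.
Implicit Types (r x : R).

Local Notation gamma := (@euler_gamma R).

Lemma ln_le_sub1 x : 0 < x -> ln x <= x - 1.
Proof.
move=> x0; have -> : x = 1 + (x - 1) by ring.
rewrite [X in _ <= X - 1]addrC addrK; apply: le_ln1Dx; lra.
Qed.

Lemma ln_ge_sub1 x : 0 < x -> 1 - x^-1 <= ln x.
Proof.
move=> x0; have xV : 0 < x^-1 by rewrite invr_gt0.
have := ln_le_sub1 xV; rewrite lnV ?posrE//; lra.
Qed.

(** Lower and upper approximations of Euler's constant; the logarithm is taken at [k.+1] to stay
    away from [ln 0]. *)
Let b_seq k : R := Hnum k - ln k.+1%:R.
Let v_seq k : R := Hnum k.+1 - ln k.+1%:R.

Let b_nd : nondecreasing_seq b_seq.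
Proof.
apply/nondecreasing_seqP => k; rewrite /b_seq HnumS.
have k1 : 0 < (k.+1%:R : R) by rewrite ltr0n.
have k2 : 0 < (k.+2%:R : R) by rewrite ltr0n.
have := ln_le_sub1 (divr_gt0 k2 k1); rewrite ln_div ?posrE//.
have -> : k.+2%:R / k.+1%:R - 1 = k.+1%:R^-1 :> R.
  by rewrite -[k.+2%:R]natr1; field; rewrite addrC natr1 gt_eqF.
move: (ln _) (ln _) _^-1 => u1 u2 u3; lra.
Qed.

Let v_ni : nonincreasing_seq v_seq.
Proof.
apply/nonincreasing_seqP => k; rewrite /v_seq [Hnum k.+2]HnumS.
have k1 : 0 < (k.+1%:R : R) by rewrite ltr0n.
have k2 : 0 < (k.+2%:R : R) by rewrite ltr0n.
have := ln_ge_sub1 (divr_gt0 k2 k1); rewrite ln_div ?posrE// invf_div.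
have -> : 1 - k.+1%:R / k.+2%:R = k.+2%:R^-1 :> R.
  by rewrite -[X in X / _](addrK 1) natr1; field; rewrite gt_eqF.
move: (ln _) (ln _) _^-1 => u1 u2 u3; lra.
Qed.

Let b_le_v k j : b_seq k <= v_seq j.
Proof.
have bv i : b_seq i <= v_seq i by rewrite /b_seq /v_seq HnumS; have : 0 <= (i.+1%:R : R)^-1 by []; move: (ln _) _^-1 => u1 u2; lra.
have [kj|/ltnW jk] := leqP k j; first exact: le_trans (b_nd kj) (bv j).
exact: le_trans (bv k) (v_ni jk).
Qed.

Let gammaE : gamma = limn v_seq /\ cvgn v_seq.
Proof.
have cv : cvgn v_seq.
  apply: nonincreasing_is_cvgn => //; exists (b_seq 0%N) => _ [j _ <-]; exact: b_le_v.
split=> //; rewrite /euler_gamma; apply: cvg_lim => //.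
by rewrite -(cvg_shiftS (fun n : nat => Hnum n - ln n%:R)).
Qed.

Lemma gamma_le k : gamma <= Hnum k + k.+1%:R^-1 - ln k.+1%:R.
Proof.
have [-> cv] := gammaE; have := nonincreasing_cvgn_ge v_ni cv k.
by rewrite /v_seq HnumS.
Qed.

Lemma gamma_ge k : Hnum k - ln k.+1%:R <= gamma.
Proof.
have [-> cv] := gammaE; apply: limr_ge => //.
by apply: nearW => j; exact: b_le_v.
Qed.

Lemma entireZ (c : R) a : entire a -> entire (fun k => c * a k).
Proof.
move=> [B [M [B0 M0 H]]]; exists (`|c| * B), M; split; rewrite ?mulr_ge0// => k.
by rewrite normrM -mulrA ler_wpM2l.
Qed.

Lemma rpsD a b x : entire a -> entire b -> rps (fun k => a k + b k) x = rps a x + rps b x.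
Proof. by move=> ea eb; rewrite /rps psD// ReD. Qed.

Lemma rpsZ (c : R) a x : entire a -> rps (fun k => c * a k) x = c * rps a x.
Proof.
move=> ea; have H1 := rps_cvg x (entireZ c ea).
have H2 : (fun N : nat => c * \sum_(k < N) a k * x ^+ k) @ \oo --> c * rps a x.
  by apply: cvgM; [exact: cvg_cst|exact: rps_cvg].
apply: (cvg_unique (@Rhausdorff R) H1).
suff -> : (fun N : nat => \sum_(k < N) c * a k * x ^+ k) =
   (fun N : nat => c * \sum_(k < N) a k * x ^+ k) by exact: H2.
by apply/funext => N; rewrite mulr_sumr; apply: eq_bigr => k _; rewrite mulrA.
Qed.

Lemma rps_shift a x : entire a -> rps (shift a) x = x * rps a x.
Proof. by move=> ea; rewrite /rps ps_shift// ReM /= mul0r subr0. Qed.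

Lemma rps_ge_head a x : entire a -> (forall k, 0 <= a k) -> 0 <= x -> a 0%N <= rps a x.
Proof.
move=> ea a0 x0; have H := rps_cvg x ea.
apply: (ler_cvg_to (cvg_cst (a 0%N)) H); exists 1%N => // -[|N] //= _.
rewrite big_ord_recl /= expr0 mulr1 lerDl; apply: sumr_ge0 => k _.
by rewrite mulr_ge0// exprn_ge0.
Qed.

Lemma rps_ge0 (a : nat -> R) x : entire a -> (forall k, 0 <= a k) -> 0 <= x -> 0 <= rps a x.
Proof. by move=> ea a0 x0; exact: le_trans (a0 0%N) (rps_ge_head ea a0 x0). Qed.

Lemma shift_dps (a : nat -> R) k : shift (dps a) k = k%:R * a k.
Proof. by case: k => [|k]; rewrite /= ?mul0r. Qed.

Lemma rps_at0 a : entire a -> rps a (0 : R) = a 0%N.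
Proof. by move=> ea; rewrite /rps (ps_at0 ea). Qed.

Local Opaque rps ps.

(* [Ir], [Qr], [yr] and [Pr] are [I_0], [r I_0'], [K_0] and [r K_0'] on the positive axis. *)
Definition Ir r := rps cI (r ^+ 2 / 4).
Definition Qr r := r ^+ 2 / 2 * rps (dps cI) (r ^+ 2 / 4).
Definition yr r := - (ln (r / 2) + gamma) * Ir r + rps cL (r ^+ 2 / 4).
Definition Pr r := - Ir r - (ln (r / 2) + gamma) * Qr r + r ^+ 2 / 2 * rps (dps cL) (r ^+ 2 / 4).

Let eI := @entire_cI R.
Let eL := @entire_cL R.
Let eI' := entire_dps eI.
Let eL' := entire_dps eL.

Let quarter r : (r%:C : CC R) ^+ 2 / 4 = (r ^+ 2 / 4)%:C.
Proof. by rewrite rmorphM rmorphXn fmorphV /= rmorph_nat. Qed.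

Let half2 r : (r%:C : CC R) ^+ 2 / 2 = (r ^+ 2 / 2)%:C.
Proof. by rewrite rmorphM rmorphXn fmorphV /= rmorph_nat. Qed.

Let cLog_real r : 0 < r -> cLog (r%:C / 2 : CC R) = (ln (r / 2))%:C.
Proof.
move=> r0; have -> : (r%:C : CC R) / 2 = (r / 2)%:C by rewrite rmorphM fmorphV /= rmorph_nat.
rewrite /cLog /cArg /= mul0r atan0 mulr0 mulr0 addr0 cabsR gtr0_norm//.
by rewrite divr_gt0.
Qed.

Lemma besselK0_real r : 0 < r -> besselK0 (r%:C : CC R) = (yr r)%:C.
Proof.
move=> r0; rewrite besselK0E cLog_real// quarter !psE//.
by rewrite /yr /Ir !rmorphD rmorphM rmorphN !rmorphD.
Qed.

Lemma thetaK_real r : 0 < r -> thetaK (r%:C : CC R) = (Pr r)%:C.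
Proof.
move=> r0; rewrite /thetaK /thetaI cLog_real// quarter half2 !psE//.
by rewrite /Pr /Ir /Qr !(rmorphD, rmorphM, rmorphN, rmorphB).
Qed.

Let real_derive (F : CC R -> CC R) (f : R -> R) r (d : R) :
  (\forall s \near r, F s%:C = (f s)%:C) -> cdiff F r%:C d%:C -> is_derive r 1 f d.
Proof.
move=> Ff dF; have id1 : pder (fun s : R => s%:C : CC R) r 1 by apply: (pder_real (@is_derive_id _ _ r 1)).
have /pderP[H _] := pder_comp dF id1; rewrite mulr1 /= in H.
apply: near_eq_is_derive H; apply: (@filterS _ (nbhs r) (nbhs_filter r)) Ff => s ->.
by [].
Qed.

Lemma is_derive_Ir r : is_derive r 1 Ir (r / 2 * rps (dps cI) (r ^+ 2 / 4)).
Proof.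
apply: (@real_derive (fun w => ps cI (w ^+ 2 / 4))).
  by apply: (@filterE _ (nbhs r) (nbhs_filter r)) => s; rewrite quarter psE.
apply: cdiff_eq (cdiff_ps_quarter r%:C eI) _.
by rewrite quarter psE// mulrC !rmorphM fmorphV /= rmorph_nat.
Qed.

Lemma is_derive_Qr r : is_derive r 1 Qr (r * Ir r).
Proof.
apply: (@real_derive (fun w => w ^+ 2 / 2 * ps (dps cI) (w ^+ 2 / 4))).
  by apply: (@filterE _ (nbhs r) (nbhs_filter r)) => s; rewrite quarter half2 psE// -rmorphM.
apply: cdiff_eq (cdiff_theta r%:C eI) _.
by rewrite cI_ode quarter psE// -rmorphM.
Qed.

Lemma is_derive_yr r : 0 < r -> is_derive r 1 yr (Pr r / r).
Proof.
move=> r0; apply: (@real_derive (@besselK0 R)).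
  apply: (@filterS _ (nbhs r) (nbhs_filter r) _ _ _ (lt_nbhsr r0)) => s; exact: besselK0_real.
have sr : slit (r%:C : CC R) by rewrite /slit cabsR gtr0_norm //= addr_gt0.
apply: cdiff_eq (cdiff_besselK0 sr) _.
by rewrite thetaK_real// rmorphM fmorphV.
Qed.

Lemma wronskian_real r : Ir r * Pr r - Qr r * yr r = -1.
Proof.
apply: complexI; have := @bessel_wronskian R _ (r ^+ 2 / 4) erefl.
rewrite divr_ge0 ?sqr_ge0// => /(_ isT).
rewrite !psE// => H; rewrite [RHS]rmorphN -[RHS]H /Pr /yr /Ir /Qr.
rewrite !(rmorphD, rmorphM, rmorphN, rmorphB) !fmorphV /= ?rmorphXn /= ?rmorph_nat.
by field.
Qed.

Lemma Ir_ge1 r : 1 <= Ir r.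
Proof.
have <- : cI 0 = 1 :> R by rewrite /cI fact0 expr1n invr1.
by apply: rps_ge_head => // [k|]; [exact: ltW (cI_gt0 k)|rewrite divr_ge0 ?sqr_ge0].
Qed.

Lemma Qr_gt0 r : 0 < r -> 0 < Qr r.
Proof.
move=> r0; rewrite /Qr mulr_gt0 ?divr_gt0 ?exprn_gt0//.
apply: (@lt_le_trans _ _ (dps cI 0)).
  by rewrite /dps mulr_gt0// cI_gt0.
apply: rps_ge_head => // [k|]; last by rewrite divr_ge0 ?sqr_ge0.
by rewrite /dps mulr_ge0// ltW// cI_gt0.
Qed.

Let yrE r : yr r = rps (fun k => cL k + - (ln (r / 2) + gamma) * cI k) (r ^+ 2 / 4).
Proof. by rewrite rpsD ?rpsZ /yr /Ir//; [ring|exact: entireZ]. Qed.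

Let eY r : entire (fun k => cL k + - (ln (r / 2) + gamma) * cI k).
Proof. by apply: entireD => //; exact: entireZ. Qed.

(* Termwise in the power series: [ln t <= t - 1] at [t = k.+1 / (r / 2)] removes the
   logarithm and Euler's constant. *)
Lemma yr_upper r : 0 < r -> yr r <= (Qr r + 2 * Ir r) / r - Ir r.
Proof.
have aux (d u v g H : R) : u - v <= d - 1 -> H - u <= g -> H - g - v <= d - 1 by lra.
move=> r0; have x0 : 0 < r / 2 by rewrite divr_gt0.
pose c1 : R := (r / 2)^-1.
have e1 : entire (fun k => c1 * shift (dps cI) k) by apply/entireZ/entire_shift.
have e2 : entire (fun k => (c1 - 1) * cI k) by exact: entireZ.
have -> : (Qr r + 2 * Ir r) / r - Ir r =
    rps (fun k => c1 * shift (dps cI) k + (c1 - 1) * cI k) (r ^+ 2 / 4).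
  rewrite rpsD// !rpsZ ?rps_shift//; last exact: entire_shift.
  by rewrite /Qr /Ir /c1; field; rewrite gt_eqF.
rewrite yrE; apply: rps_le => [||k]; [exact: eY|exact: entireD|].
rewrite ler_wpM2r ?exprn_ge0 ?divr_ge0 ?sqr_ge0//.
rewrite shift_dps.
have k1 : 0 < (k.+1%:R : R) by rewrite ltr0n.
have H : Hnum k - gamma - ln (r / 2) <= k.+1%:R * c1 - 1.
  have := gamma_ge k; have := ln_le_sub1 (divr_gt0 k1 x0).
  have -> : ln (k.+1%:R / (r / 2)) = ln k.+1%:R - ln (r / 2) by apply: ln_div; rewrite posrE.
  exact: aux.
have -> : cL k + - (ln (r / 2) + gamma) * cI k = cI k * (Hnum k - gamma - ln (r / 2)).
  by rewrite /cL /cI; ring.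
apply: (le_trans (ler_wpM2l (ltW (cI_gt0 k)) H)).
by rewrite -natr1 le_eqVlt; apply/orP; left; apply/eqP; ring.
Qed.

(** The counterpart of [yr_upper], from [ln t >= 1 - 1 / t] at the same [t] and from [gamma_le]. *)
Lemma yr_lower r : 0 < r -> Ir r - Qr r / r - 2 * Qr r / r ^+ 2 <= yr r.
Proof.
have aux (d e u v g H : R) : 1 - d <= u - v -> g <= H + e - u -> 1 - (d + e) <= H - g - v by lra.
move=> r0; have x0 : 0 < r / 2 by rewrite divr_gt0.
have e1 : entire (fun k => - (r / 2 + 1) * dps cI k) by exact: entireZ.
have -> : Ir r - Qr r / r - 2 * Qr r / r ^+ 2 =
    rps (fun k => cI k + - (r / 2 + 1) * dps cI k) (r ^+ 2 / 4).
  by rewrite rpsD// rpsZ// /Qr /Ir; field; rewrite gt_eqF.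
rewrite yrE; apply: rps_le => [||k]; [exact: entireD|exact: eY|].
rewrite ler_wpM2r ?exprn_ge0 ?divr_ge0 ?sqr_ge0// dps_cI.
have k1 : 0 < (k.+1%:R : R) by rewrite ltr0n.
have H : 1 - (r / 2 + 1) / k.+1%:R <= Hnum k - gamma - ln (r / 2).
  have := gamma_le k; have := ln_ge_sub1 (divr_gt0 k1 x0).
  have -> : ln (k.+1%:R / (r / 2)) = ln k.+1%:R - ln (r / 2) by apply: ln_div; rewrite posrE.
  rewrite invf_div [(_ + 1) / _]mulrDl mul1r.
  exact: aux.
have -> : cL k + - (ln (r / 2) + gamma) * cI k = cI k * (Hnum k - gamma - ln (r / 2)).
  by rewrite /cL /cI; ring.
apply: le_trans (ler_wpM2l (ltW (cI_gt0 k)) H).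
by rewrite le_eqVlt; apply/orP; left; apply/eqP; ring.
Qed.

(** The derivative of [(s I)^2 - Q^2] is [2 s I^2], because [Q = s I'] and [Q' = s I]. *)
Lemma Qr_le r : 0 < r -> Qr r <= r * Ir r.
Proof.
move=> r0; have I0 : 0 <= Ir r by rewrite (le_trans _ (Ir_ge1 r)).
have Q0 := ltW (Qr_gt0 r0); have rI0 : 0 <= r * Ir r by rewrite mulr_ge0// ltW.
rewrite -(@ler_sqr R (Qr r) (r * Ir r)) ?nnegrE// -subr_ge0.
have dD (s : R) : is_derive s (1 : R) (fun s : R => (s * Ir s) ^+ 2 - Qr s ^+ 2) (2 * s * Ir s ^+ 2).
  have d1 := is_derive_Ir s; have d2 := is_derive_Qr s.
  have dM : is_derive s (1 : R) (fun s : R => s * Ir s) (s * (s / 2 * rps (dps cI) (s ^+ 2 / 4)) + Ir s * 1).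
    exact: is_deriveM (is_derive_id s 1) d1.
  apply: is_derive_eq (is_deriveB (is_deriveX 2 dM) (is_deriveX 2 d2)) _.
  by rewrite /GRing.scale /= /Qr !expr1; field.
have := @le_of_derive R _ _ 0 r (ltW r0) (fun s _ => dD s).
rewrite mul0r /Qr !expr0n /= !mul0r expr0n subrr; apply => s /andP[s0 _].
by rewrite mulr_ge0 ?sqr_ge0// mulr_ge0.
Qed.

Let Ir_gt0 r : 0 < Ir r. Proof. exact: lt_le_trans ltr01 (Ir_ge1 r). Qed.

(** What matters is that [K_0 / I_0] tends to [0]: this singles out the solution recessive at
    infinity, which the series at [0] does not show. *)
Let yr_abs r : 0 < r -> `|yr r / Ir r| <= 4 / r.
Proof.
move=> r0; have := yr_upper r0; have := yr_lower r0; have Q := Qr_le r0.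
have I0 := Ir_gt0 r; have Q0 := Qr_gt0 r0.
have -> : (Qr r + 2 * Ir r) / r - Ir r = Qr r / r + 2 / r * Ir r - Ir r by ring.
have -> : 2 * Qr r / r ^+ 2 = 2 / r * (Qr r / r) by field; rewrite gt_eqF.
have Qr' : Qr r / r <= Ir r by rewrite ler_pdivrMr// mulrC.
have r2 : 0 <= 2 / r by rewrite divr_ge0// ltW.
have : 2 / r * (Qr r / r) <= 2 / r * Ir r by rewrite ler_wpM2l.
have : 0 <= 2 / r * Ir r by rewrite mulr_ge0// ltW.
have -> : 4 / r = 2 / r + 2 / r by field; rewrite gt_eqF.
rewrite normrM [`|(Ir r)^-1|]gtr0_norm ?invr_gt0// ler_pdivrMr//.
rewrite ler_norml mulrDl => h1 h2 h3 h4; apply/andP; split; lra.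
Qed.

(** If [f r] were positive, monotonicity would keep [f] above [f r], whereas [4 / s] is at most
    [f r / 2] from [s = 8 / f r] on. *)
Let decreasing_to_0 (f f' : R -> R) r : 0 < r ->
  (forall s, r <= s -> is_derive s 1 f (f' s)) -> (forall s, r <= s -> 0 <= f' s) ->
  (forall s, r <= s -> f s <= 4 / s) -> f r <= 0.
Proof.
move=> r0 df f0 fle; rewrite leNgt; apply/negP => fr.
pose s := Num.max r (8 / f r).
have rs : r <= s by rewrite le_max lexx.
have s8 : 8 / f r <= s by rewrite le_max lexx orbT.
have s0 : 0 < s by rewrite (lt_le_trans r0).
have : f r <= f s.
  by apply: (@le_of_derive R f f' r s rs) => x /andP[rx _]; [exact: df|exact: f0].
apply/negP; rewrite -ltNge (le_lt_trans (fle s rs))// ltr_pdivrMr//.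
by move: s8; rewrite ler_pdivrMr// => h; lra.
Qed.

Let is_derive_quot r : 0 < r -> is_derive r 1 (fun s : R => yr s / Ir s) (- (r * Ir r ^+ 2)^-1).
Proof.
move=> r0; have I0 : Ir r != 0 by rewrite gt_eqF.
have r0' : r != 0 by rewrite gt_eqF.
have d1 := is_derive_Ir r; have d2 := is_derive_yr r0.
have W := wronskian_real r.
apply: is_derive_eq (is_deriveM d2 (is_deriveV I0 d1)) _.
rewrite /GRing.scale /=.
have -> : yr r * (- Ir r ^- 2 * (r / 2 * rps (dps cI) (r ^+ 2 / 4))) + (Ir r)^-1 * (Pr r / r) =
  (Ir r * Pr r - Qr r * yr r) / (r * Ir r ^+ 2) by rewrite /Qr; field; rewrite r0' I0.
by rewrite W mulN1r.
Qed.

Lemma yr_ge0 r : 0 < r -> 0 <= yr r.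
Proof.
move=> r0; have I0 := Ir_gt0 r.
suff : - (yr r / Ir r) <= 0 by rewrite oppr_le0 pmulr_lge0 ?invr_gt0.
apply: (@decreasing_to_0 (fun s => - (yr s / Ir s)) (fun s => (s * Ir s ^+ 2)^-1)) => // s rs.
- have s0 := lt_le_trans r0 rs.
  by apply: is_derive_eq (is_deriveN (is_derive_quot s0)) _; rewrite opprK.
- by rewrite invr_ge0 mulr_ge0 ?sqr_ge0// (le_trans (ltW r0)).
- have s0 := lt_le_trans r0 rs; have := yr_abs s0.
  by rewrite ler_norml => /andP[h _]; lra.
Qed.

(** By the Wronskian and [Q = s I'], the function [K_0 / I_0 - 1 / (Q I_0)] has the nonnegative
    derivative [s / Q^2], and it is at most [4 / s]. *)
Lemma yr_le r : 0 < r -> yr r <= (Qr r)^-1.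
Proof.
have aux (t u v : R) : t <= u -> 0 <= v -> t - v <= u by lra.
move=> r0; have I0 := Ir_gt0 r; have Q0 := Qr_gt0 r0.
suff : yr r / Ir r - (Qr r * Ir r)^-1 <= 0.
  rewrite subr_le0 ler_pdivrMr// invfM -mulrA mulVf ?mulr1//.
  by rewrite gt_eqF.
apply: (@decreasing_to_0 (fun s => yr s / Ir s - (Qr s * Ir s)^-1) (fun s => s / Qr s ^+ 2)) => // s rs;
  have s0 := lt_le_trans r0 rs; have Is := Ir_gt0 s; have Qs := Qr_gt0 s0.
- have nz : Qr s * Ir s != 0 by rewrite mulf_neq0 ?gt_eqF.
  have dM : is_derive s 1 (fun s : R => Qr s * Ir s) (Qr s * (s / 2 * rps (dps cI) (s ^+ 2 / 4)) + Ir s * (s * Ir s)).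
    exact: is_deriveM (is_derive_Qr s) (is_derive_Ir s).
  have dV := @is_deriveV _ (fun s : R => Qr s * Ir s) _ _ _ nz dM.
  apply: is_derive_eq (is_deriveB (is_derive_quot s0) dV) _.
  rewrite /GRing.scale /=.
  have E : rps (dps cI) (s ^+ 2 / 4) = 2 * Qr s / s ^+ 2 by rewrite /Qr; field; rewrite gt_eqF.
  by rewrite E; field; rewrite !gt_eqF.
- exact: divr_ge0 (ltW s0) (sqr_ge0 _).
- have := yr_abs s0; rewrite ler_norml => /andP[_ h].
  have : 0 <= (Qr s * Ir s)^-1 by rewrite invr_ge0 (mulr_ge0 (ltW Qs) (ltW Is)).
  exact: aux.
Qed.

(** The function [(I + Q + s I) e^(- s)] has the derivative [I' e^(- s) >= 0] and equals [1] at [0];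
    then [Q <= r I] is inserted. *)
Lemma expR_le_Ir r : 0 < r -> expR r <= (1 + 2 * r) * Ir r.
Proof.
have aux (E I Q : R) : Q <= r * I -> E <= I + Q + r * I -> E <= (1 + 2 * r) * I by lra.
move=> r0; have I0 := Ir_gt0 r.
have dD (s : R) : is_derive s (1 : R) (fun s : R => (Ir s + Qr s + s * Ir s) * expR (- s))
    (s / 2 * rps (dps cI) (s ^+ 2 / 4) * expR (- s)).
  have d1 := is_derive_Ir s; have d2 := is_derive_Qr s.
  have dE : is_derive s 1 (fun s : R => expR (- s)) (- expR (- s)).
    have := is_derive1_comp (is_derive_expR (- s)) (is_deriveN (is_derive_id s 1)).
    by rewrite mulrN1.
  have dM : is_derive s (1 : R) (fun s : R => s * Ir s) (s * (s / 2 * rps (dps cI) (s ^+ 2 / 4)) + Ir s * 1).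
    exact: is_deriveM (is_derive_id s 1) d1.
  have dS : is_derive s (1 : R) (fun s : R => Ir s + Qr s + s * Ir s) _ := is_deriveD (is_deriveD d1 d2) dM.
  apply: is_derive_eq (is_deriveM dS dE) _.
  by rewrite /GRing.scale /= /Qr; field.
have E0 : (Ir 0 + Qr 0 + 0 * Ir 0) * expR (- 0) = 1.
  rewrite /Ir /Qr expr0n /= !mul0r !addr0 oppr0 expR0 mulr1.
  by rewrite (rps_at0 eI) /cI fact0 expr1n invr1.
have H : 1 <= (Ir r + Qr r + r * Ir r) * expR (- r).
  rewrite -[leLHS]E0.
  apply: (le_of_derive (ltW r0) (fun s _ => dD s)) => s /andP[s0 _].
  apply: mulr_ge0; last exact: expR_ge0.
  apply: mulr_ge0; first exact: divr_ge0.
  apply: (rps_ge0 eI') => [k|]; last by rewrite divr_ge0 ?sqr_ge0.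
  by rewrite /dps mulr_ge0// ltW ?cI_gt0.
move: H; rewrite expRN -ler_pdivrMr ?invr_gt0 ?expR_gt0// invrK mul1r.
exact: aux (Qr_le r0).
Qed.

(** The lower bound [yr_lower] cannot exceed the upper bound [yr_upper]; this gives
    [r I (r - 1) <= Q (r + 1)], and [r + 1 <= 3 (r - 1)] for [2 <= r]. *)
Lemma Qr_lower r : 2 <= r -> r * Ir r <= 3 * Qr r.
Proof.
move=> r2; have r0 : 0 < r by rewrite (lt_le_trans _ r2).
have := le_trans (yr_lower r0) (yr_upper r0).
have I0 := Ir_gt0 r; have Q0 := Qr_gt0 r0.
rewrite -(ler_pM2l (exprn_gt0 2 r0)).
have -> : r ^+ 2 * (Ir r - Qr r / r - 2 * Qr r / r ^+ 2) = r ^+ 2 * Ir r - r * Qr r - 2 * Qr r.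
  by field; rewrite gt_eqF.
have -> : r ^+ 2 * ((Qr r + 2 * Ir r) / r - Ir r) = r * Qr r + 2 * r * Ir r - r ^+ 2 * Ir r.
  by field; rewrite gt_eqF.
set I := Ir r; set Q := Qr r; rewrite expr2 => H.
have H2 : r * I * (r - 1) <= Q * (r + 1) by nra.
have H3 : r * I * (r + 1) <= 3 * (r * I * (r - 1)).
  have : 0 <= r * I * (2 * r - 4) by rewrite mulr_ge0 ?mulr_ge0 ?(ltW I0) ?(ltW r0)//; lra.
  lra.
rewrite -(ler_pM2r (_ : 0 < r + 1)); last by rewrite addr_gt0.
lra.
Qed.

(** [K_0 <= 1 / Q], [Q >= r I / 3] and [I >= e^r / (1 + 2 r)] control [K_0]; the Wronskian with
    [0 <= Q K_0 <= 1] gives [|r K_0'| <= 1 / I]. The powers of [r] lost against the true asymptotics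
    are harmless. *)
Lemma real_axis_bound r : 2 <= r ->
  expR r * `|yr r| <= 8 * r /\ expR r * `|r * yr r + Pr r| <= 8 * (1 + 2 * r).
Proof.
move=> r2; have r0 : 0 < r by rewrite (lt_le_trans _ r2).
have y0 := yr_ge0 r0; have yQ := yr_le r0; have E := expR_le_Ir r0; have Ql := Qr_lower r2.
have I0 := Ir_gt0 r; have Q0 := Qr_gt0 r0; have e0 := expR_gt0 r.
have W := wronskian_real r.
have ey : r * (expR r * yr r) <= 3 * (1 + 2 * r).
  apply: (@le_trans _ _ (r * (expR r * (Qr r)^-1))).
    by rewrite ler_wpM2l ?(ltW r0)// ler_wpM2l ?(ltW e0).
  rewrite mulrA ler_pdivrMr//.
  apply: (@le_trans _ _ (r * ((1 + 2 * r) * Ir r))); first by rewrite ler_wpM2l ?(ltW r0).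
  have -> : r * ((1 + 2 * r) * Ir r) = (1 + 2 * r) * (r * Ir r) by ring.
  have -> : 3 * (1 + 2 * r) * Qr r = (1 + 2 * r) * (3 * Qr r) by ring.
  by rewrite ler_wpM2l// addr_ge0// mulr_ge0// ltW.
have QyI : 0 <= Qr r * yr r <= 1.
  rewrite mulr_ge0 ?(ltW Q0)//=.
  by rewrite -(divff (lt0r_neq0 Q0)) ler_wpM2l// ltW.
have PI : `|Pr r| <= (Ir r)^-1.
  rewrite -(ler_pM2l I0) divff ?gt_eqF// -[X in X * _](gtr0_norm I0) -normrM.
  have -> : Ir r * Pr r = Qr r * yr r - 1 by rewrite -[X in _ + X]W; ring.
  by case/andP: QyI => q0 q1; rewrite ler_norml; apply/andP; split; lra.
have eP : expR r * `|Pr r| <= 1 + 2 * r.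
  apply: (@le_trans _ _ (expR r * (Ir r)^-1)); first by rewrite ler_wpM2l ?(ltW e0).
  by rewrite ler_pdivrMr.
rewrite (ger0_norm y0); split.
  have : 0 <= expR r * yr r by rewrite mulr_ge0 ?(ltW e0).
  move: ey; set t := expR r * yr r => h1 h2.
  have : 2 * t <= r * t by rewrite ler_wpM2r.
  lra.
apply: (@le_trans _ _ (expR r * (r * yr r + `|Pr r|))).
  rewrite ler_wpM2l ?(ltW e0)// (le_trans (ler_normD _ _))// lerD2r ger0_norm// mulr_ge0// ltW//.
rewrite mulrDr mulrCA.
have : 0 <= r := ltW r0.
move: ey eP; move: (r * (expR r * yr r)) (expR r * _) => t u; lra.
Qed.

End bessel_real_axis.

(** * The function K_0 on the slit plane *)

Section bessel_arc.
Context {R : realType}.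
Implicit Types (w z : CC R) (r s t : R).

Lemma norm_pder (f : R -> CC R) t (d : CC R) : pder f t d ->
  is_derive t (1 : R) (fun t => cabs (f t) ^+ 2)
    (2 * (complex.Re (f t) * complex.Re d + complex.Im (f t) * complex.Im d)).
Proof.
move=> /pderP[dr di]; under eq_fun do rewrite cabs_sqr.
apply: is_derive_eq (is_deriveD (is_deriveX 2 dr) (is_deriveX 2 di)) _.
by rewrite /GRing.scale /= !expr1; ring.
Qed.

Lemma gronwall1 (E E' : R -> R) (t : R) : 0 <= t ->
  (forall s, 0 <= s <= t -> is_derive s (1 : R) E (E' s)) ->
  (forall s, 0 <= s <= t -> E' s <= E s) -> E t <= expR t * E 0.
Proof.
move=> t0 dE le.
have dG s : 0 <= s <= t -> is_derive s (1 : R) (fun s => - (E s * expR (- s)))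
    ((E s - E' s) * expR (- s)).
  move=> st; have dX : is_derive s (1 : R) (fun s : R => expR (- s)) (- expR (- s)).
    have := is_derive1_comp (is_derive_expR (- s)) (is_deriveN (is_derive_id s 1)).
    by rewrite mulrN1.
  have d1 : is_derive s (1 : R) (fun s => E s * expR (- s)) (E s * - expR (- s) + expR (- s) * E' s).
    exact: is_deriveM (dE s st) dX.
  by apply: is_derive_eq (is_deriveN d1) _; ring.
have H : - (E 0 * expR (- 0)) <= - (E t * expR (- t)).
  apply: (le_of_derive t0 dG) => s st.
  by rewrite mulr_ge0 ?expR_ge0// subr_ge0 le.
move: H; rewrite oppr0 expR0 mulr1 lerN2 expRN ler_pdivrMr ?expR_gt0//.
by rewrite mulrC.
Qed.

(* With [v = e^w K_0(w)] and [S = 2 (w v + e^w theta K_0) + v], where [w = r e^(- i s t)], the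
   pair [(S, v)] solves [S' = - i s (2 w S + (S - v) / 2)], [v' = - i s (S - v) / 2]; the
   growth of [|S|^2 + |v|^2] is bounded independently of [r] because [s Im w <= 0]. *)
Lemma arc_energy (s p q a b c d : R) : s * s = 1 -> s * q <= 0 ->
  2 * (a * (2 * s * (p * b + q * a) + s * (b - d) / 2) +
       b * (- (2 * s * (p * a - q * b)) - s * (a - c) / 2)) +
  2 * (c * (s * (b - d) / 2) + d * (- (s * (a - c) / 2))) <= (a ^+ 2 + b ^+ 2) + (c ^+ 2 + d ^+ 2).
Proof.
move=> ss sq; rewrite -subr_ge0.
have -> : (a ^+ 2 + b ^+ 2) + (c ^+ 2 + d ^+ 2) -
    (2 * (a * (2 * s * (p * b + q * a) + s * (b - d) / 2) +
       b * (- (2 * s * (p * a - q * b)) - s * (a - c) / 2)) +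
     2 * (c * (s * (b - d) / 2) + d * (- (s * (a - c) / 2)))) =
   (b - s * c) ^+ 2 + (a + s * d) ^+ 2 + (1 - s * s) * (c ^+ 2 + d ^+ 2)
    + 4 * ((- (s * q)) * (a ^+ 2 + b ^+ 2)) by field.
rewrite ss subrr mul0r addr0 addr_ge0 ?addr_ge0 ?sqr_ge0// mulr_ge0// mulr_ge0 ?oppr_ge0//.
by rewrite addr_ge0 ?sqr_ge0.
Qed.

Lemma arc_energyC (s : R) (w S v : CC R) : s * s = 1 -> s * complex.Im w <= 0 ->
  2 * (complex.Re S * complex.Re (- ('i * s%:C) * (2 * w * S + (S - v) / 2)) +
       complex.Im S * complex.Im (- ('i * s%:C) * (2 * w * S + (S - v) / 2))) +
  2 * (complex.Re v * complex.Re (- ('i * s%:C) * ((S - v) / 2)) +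
       complex.Im v * complex.Im (- ('i * s%:C) * ((S - v) / 2))) <= cabs S ^+ 2 + cabs v ^+ 2.
Proof.
have half z : z / 2 = z * (2^-1)%:C by rewrite fmorphV /= rmorph_nat.
have two : (2 : CC R) = (2 : R)%:C by rewrite rmorph_nat.
move=> ss sq; have := arc_energy (complex.Re w) (complex.Re S) (complex.Im S) (complex.Re v)
    (complex.Im v) ss sq.
rewrite !cabs_sqr !half two.
case: w S v {sq} => [p q] [a b] [c d]; rewrite !ReImE /=.
apply: le_trans; rewrite le_eqVlt; apply/orP; left; apply/eqP; by field.
Qed.

Let W (r s t : R) : CC R := cexp ((ln r)%:C + 'i * (- (s * t))%:C).

Let ReW r s t : 0 < r -> complex.Re (W r s t) = r * cos (s * t).
Proof. by move=> r0; rewrite /W Re_cexp ReD ImD !ReImE /= !mul0r !mul1r !subr0 !add0r !addr0 lnK ?posrE// cosN. Qed.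

Let ImW r s t : 0 < r -> complex.Im (W r s t) = - (r * sin (s * t)).
Proof. by move=> r0; rewrite /W Im_cexp ReD ImD !ReImE /= !mul0r !mul1r !subr0 !add0r !addr0 lnK ?posrE// sinN mulrN. Qed.

Let absW r s t : 0 < r -> cabs (W r s t) = r.
Proof. by move=> r0; rewrite /W cabs_cexp ReD !ReImE /= ?mul0r ?mul1r ?mulr0 ?oppr0 ?subr0 ?addr0 lnK ?posrE. Qed.

Let slitW r s t : 0 < r -> s = 1 \/ s = -1 -> 0 <= t < pi -> slit (W r s t).
Proof.
move=> r0 s1 /andP[t0 tpi]; rewrite /slit absW// ReW//.
have -> : cos (s * t) = cos t by case: s1 => ->; rewrite ?mul1r ?mulN1r ?cosN.
have -> : t = t / 2 + t / 2 by field.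
rewrite cosD -!expr2 sin2cos2.
have -> : r + r * (cos (t / 2) ^+ 2 - (1 - cos (t / 2) ^+ 2)) = 2 * r * cos (t / 2) ^+ 2 by ring.
have p := pi_gt0 R.
have c0 : 0 < cos (t / 2) by apply: cos_gt0_pihalf; apply/andP; split; lra.
by rewrite mulr_gt0 ?exprn_gt0// mulr_gt0.
Qed.

Let pderW r s t : pder (W r s) t (- ('i * s%:C) * W r s t).
Proof.
have d1 : pder (fun t : R => (- (s * t))%:C : CC R) t (- s)%:C.
  apply: pder_real; apply: is_derive_eq (is_deriveN (is_deriveZ s (is_derive_id t 1))) _.
  by rewrite /GRing.scale /= mulr1.
have d2 := pderD (pder_cst (ln r)%:C t) (pderZ 'i d1).
apply: pder_eq (pder_comp (cdiff_cexp _) d2) _.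
by rewrite /W rmorphN add0r; ring.
Qed.

(** The exponential decay is factored out before the bound travels along an arc; [uK] is [w d/dw]
    applied to [vK]. *)
Let vK z : CC R := cexp z * besselK0 z.
Let uK z : CC R := cexp z * (z * besselK0 z + thetaK z).

Let cdiff_vK z : slit z -> cdiff vK z (uK z / z).
Proof.
move=> sz; have z0 := slit_neq0 sz.
apply: cdiff_eq (cdiffM (cdiff_cexp z) (cdiff_besselK0 sz)) _.
by rewrite /uK; field.
Qed.

Let cdiff_uK z : slit z -> cdiff uK z (2 * uK z + vK z).
Proof.
move=> sz; have z0 := slit_neq0 sz.
have D := cdiffD (cdiffM (cdiff_id z) (cdiff_besselK0 sz)) (cdiff_thetaK sz).
apply: cdiff_eq (cdiffM (cdiff_cexp z) D) _.
by rewrite /uK /vK; field.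
Qed.

Let arc_bound r s t : 2 <= r -> s = 1 \/ s = -1 -> 0 <= t < pi ->
  cabs (vK (W r s t)) <= expR pi * (49 * r).
Proof.
(* At the start of the arc [|S| <= 16 (1 + 2 r) + 8 r <= 48 r], as [2 <= r], and [|v| <= 8 r]; the
   constant [49] exceeds the Euclidean norm of [(48, 8)]. *)
have aux (x a c : R) : 2 <= x -> c <= 8 * x -> a <= 8 * (1 + 2 * x) -> 2 * a + c <= 48 * x by lra.
have aux2 : (48 : R) ^+ 2 + 8 ^+ 2 <= 49 ^+ 2 by lra.
move=> r2 s1 /andP[t0 tpi].
have r0 : 0 < r by rewrite (lt_le_trans _ r2).
have ss : s * s = 1 by case: s1 => ->; rewrite ?mul1r ?mulN1r ?opprK.
pose S z := 2 * uK z + vK z.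
pose E t := cabs (S (W r s t)) ^+ 2 + cabs (vK (W r s t)) ^+ 2.
pose E' t := let w := W r s t in
  2 * (complex.Re (S w) * complex.Re (- ('i * s%:C) * (2 * w * S w + (S w - vK w) / 2)) +
       complex.Im (S w) * complex.Im (- ('i * s%:C) * (2 * w * S w + (S w - vK w) / 2))) +
  2 * (complex.Re (vK w) * complex.Re (- ('i * s%:C) * ((S w - vK w) / 2)) +
       complex.Im (vK w) * complex.Im (- ('i * s%:C) * ((S w - vK w) / 2))).
have sl u : 0 <= u <= t -> slit (W r s u).
  by move=> /andP[u0 ut]; apply: slitW => //; rewrite u0 (le_lt_trans ut).
have dE u : 0 <= u <= t -> is_derive u (1 : R) E (E' u).
  move=> /sl su; have w0 := slit_neq0 su.
  have dv : pder (fun u => vK (W r s u)) u (- ('i * s%:C) * ((S (W r s u) - vK (W r s u)) / 2)).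
    apply: pder_eq (pder_comp (cdiff_vK su) (pderW r s u)) _.
    by rewrite /S; field.
  have du := pder_comp (cdiff_uK su) (pderW r s u).
  have dS : pder (fun u => S (W r s u)) u
     (- ('i * s%:C) * (2 * W r s u * S (W r s u) + (S (W r s u) - vK (W r s u)) / 2)).
    by apply: pder_eq (pderD (pderZ 2 du) dv) _; rewrite /S; field.
  exact: is_deriveD (norm_pder dS) (norm_pder dv).
have two : (2 : CC R) = (2 : R)%:C by rewrite rmorph_nat.
have leE u : 0 <= u <= t -> E' u <= E u.
  move=> ut; rewrite /E' /E /= !cabs_sqr.
  have sq : s * complex.Im (W r s u) <= 0.
    case/andP: ut => u0 ut; have up : 0 <= u <= pi by rewrite u0 ltW// (le_lt_trans ut).
    have sp := sin_ge0_pi up; rewrite ImW// mulrN oppr_le0.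
    have -> : s * (r * sin (s * u)) = (s * s) * (r * sin u).
      by case: s1 => ->; rewrite ?mul1r// ?mulN1r sinN; ring.
    by rewrite ss mul1r mulr_ge0// ltW.
  by have := arc_energyC (S (W r s u)) (vK (W r s u)) ss sq; rewrite !cabs_sqr.
have ts : 0 <= t <= t by rewrite t0 lexx.
have G := gronwall1 t0 dE leE.
have W0 : W r s 0 = r%:C.
  by apply: complexP; rewrite ?ReW// ?ImW// mulr0 ?cos0 ?sin0 ?mulr1 ?mulr0 ?oppr0.
have E0 : E 0 <= (49 * r) ^+ 2.
  have [b1 b2] := real_axis_bound r2.
  have v0 : cabs (vK r%:C) <= 8 * r.
    by rewrite /vK besselK0_real// cabsM cabs_cexp cabsR.
  have u0 : cabs (uK r%:C) <= 8 * (1 + 2 * r).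
    by rewrite /uK besselK0_real// thetaK_real// -rmorphM -rmorphD cabsM cabs_cexp cabsR.
  have S0 : cabs (S r%:C) <= 48 * r.
    apply: (le_trans (cabsD _ _)); rewrite cabsM two cabsR gtr0_norm//.
    exact: aux.
  rewrite /E W0; apply: (@le_trans _ _ ((48 * r) ^+ 2 + (8 * r) ^+ 2)).
    by rewrite lerD// ler_sqr// nnegrE ?cabs_ge0// mulr_ge0// ltW.
  by rewrite !exprMn -mulrDl ler_wpM2r ?sqr_ge0.
have vE : cabs (vK (W r s t)) ^+ 2 <= E t by rewrite /E lerDr sqr_ge0.
rewrite -ler_sqr ?nnegrE ?cabs_ge0// ?mulr_ge0 ?expR_ge0 ?(ltW r0)//.
apply: (le_trans vE); apply: (le_trans G).
apply: (le_trans (ler_wpM2l (expR_ge0 t) E0)); rewrite [leRHS]exprMn.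
apply: ler_wpM2r; first exact: sqr_ge0.
by rewrite expr2 -expRD ler_expR (le_trans (ltW tpi))// lerDl pi_ge0.
Qed.

(** The arc starts at [|w|] on the positive axis and turns by [|arg w| < pi] towards the half plane
    containing [w]; the constant does not degenerate at the cut. *)
Lemma besselK0_bound w : slit w -> 2 <= cabs w ->
  cabs (besselK0 w) <= 49 * expR pi * cabs w * expR (- complex.Re w).
Proof.
move=> sw w2; have w0 := slit_gt0 sw.
have [s s1 H] : exists2 s : R, s = 1 \/ s = -1 & w = W (cabs w) s `|cArg w|.
  have [c0|c0] := leP 0 (cArg w).
    exists (-1); first by right.
    by rewrite /W mulN1r opprK ger0_norm// -[LHS](cexp_cLog sw).
  exists 1; first by left.
  by rewrite /W mul1r ltr0_norm// opprK -[LHS](cexp_cLog sw).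
have := @arc_bound (cabs w) s `|cArg w| w2 s1.
rewrite normr_ge0 cArg_lt -H => /(_ isT).
rewrite /vK cabsM cabs_cexp => h.
rewrite expRN ler_pdivlMr ?expR_gt0// mulrC (le_trans h)//.
by rewrite mulrA [expR pi * _]mulrC.
Qed.

End bessel_arc.

(** * The keyhole contour *)

Lemma Re_imul {R : realType} (w : CC R) : complex.Re ('i * w) = - complex.Im w.
Proof. by rewrite ReM /=; ring. Qed.

Lemma Im_imul {R : realType} (w : CC R) : complex.Im ('i * w) = complex.Re w.
Proof. by rewrite ImM /=; ring. Qed.

Lemma i_neq0 {R : realType} : ('i : CC R) != 0.
Proof. by rewrite -cabs_gt0 cabsi. Qed.

Section square_root.
Context {R : realType}.
Implicit Types (z w : CC R).

Lemma psqrt_dist z w : slit z -> cabs (psqrt w - psqrt z) <= cabs (w - z) / complex.Re (psqrt z).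
Proof.
move=> sz; have r0 := Re_psqrt_gt0 sz; rewrite ler_pdivlMr//.
have -> : w - z = (psqrt w - psqrt z) * (psqrt w + psqrt z).
  by rewrite -subr_sqr !psqrt_sqr.
rewrite cabsM; apply: ler_wpM2l; first exact: cabs_ge0.
apply: (le_trans _ (cabs_Re _)); rewrite ReD ger0_norm ?lerDr ?Re_psqrt_ge0//.
by rewrite addr_ge0 ?Re_psqrt_ge0.
Qed.

Lemma psqrt_cont z : slit z -> (@psqrt R) @ z --> psqrt z.
Proof.
move=> sz; have r0 := Re_psqrt_gt0 sz.
apply/(@cvgCP _ _ (nbhs z) (nbhs_filter z)) => e e0; apply/nbhsCP.
exists (e * complex.Re (psqrt z)); first by rewrite mulr_gt0.
move=> w wz; rewrite cabsB (le_lt_trans (psqrt_dist w sz))//.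
by rewrite ltr_pdivrMr.
Qed.

Lemma cdiff_psqrt z : slit z -> cdiff (@psqrt R) z (2 * psqrt z)^-1.
Proof.
move=> sz; have r0 := Re_psqrt_gt0 sz.
have p0 : psqrt z != 0 by apply: contraTneq r0 => ->; rewrite ltxx.
apply: (@cdiff_inverse R (fun u => u ^+ 2)).
- by rewrite mulf_neq0// pnatr_eq0.
- apply: (@filterE _ (nbhs z) (nbhs_filter z)) => w; exact: psqrt_sqr.
- exact: psqrt_cont.
- by apply: cdiff_eq (cdiffX 2 (cdiff_id (psqrt z))) _; rewrite expr1 mulr1.
Qed.

End square_root.

(** * The contour in the square root plane *)

Section keyhole_contour.
Context {R : realType} (xi Y : R).
Hypothesis xi0 : 0 < xi.
Hypothesis Y0 : 0 < Y.
Implicit Types (u z : CC R) (y s : R).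

(* the square root of [- xi + i y] in the upper half plane *)
Definition bpath y : CC R := 'i * psqrt (xi%:C - 'i * y%:C).

Let base y : CC R := xi%:C - 'i * y%:C.

Let Re_base y : complex.Re (base y) = xi.
Proof. by rewrite /base !ReImE /=; ring. Qed.

Let slit_base y : slit (base y).
Proof. by rewrite /slit Re_base ltr_wpDl ?cabs_ge0. Qed.

Lemma i_sqr : ('i : CC R) ^+ 2 = -1.
Proof. by rewrite expr2; apply: complexP; rewrite !ReImE /=; ring. Qed.

Lemma bpath_sqr y : bpath y ^+ 2 = (- xi)%:C + 'i * y%:C.
Proof. by rewrite /bpath exprMn i_sqr psqrt_sqr rmorphN; ring. Qed.

Lemma Im_bpath_gt0 y : 0 < complex.Im (bpath y).
Proof. by rewrite /bpath Im_imul; exact: Re_psqrt_gt0 (slit_base y). Qed.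

Lemma bpath_neq0 y : bpath y != 0.
Proof. by have := Im_bpath_gt0 y; apply: contraTneq => ->; rewrite ltxx. Qed.

Lemma bpath_Re y : complex.Re (bpath y) ^+ 2 = complex.Im (bpath y) ^+ 2 - xi.
Proof. by have /(congr1 (@complex.Re R)) := bpath_sqr y; rewrite expr2 !ReImE /= => H; lra. Qed.

Lemma bpath_Im y : 2 * complex.Re (bpath y) * complex.Im (bpath y) = y.
Proof. by have /(congr1 (@complex.Im R)) := bpath_sqr y; rewrite expr2 !ReImE /= => H; lra. Qed.

Lemma Re_bpath_ge0 y : 0 <= y -> 0 <= complex.Re (bpath y).
Proof. by rewrite -{1}(bpath_Im y) pmulr_lge0 ?Im_bpath_gt0// pmulr_rge0. Qed.

Lemma Re_bpath_le0 y : y <= 0 -> complex.Re (bpath y) <= 0.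
Proof. by rewrite -{1}(bpath_Im y) pmulr_lle0 ?Im_bpath_gt0// pmulr_rle0. Qed.

Lemma Re_bpath_gt0 y : 0 < y -> 0 < complex.Re (bpath y).
Proof. by rewrite -{1}(bpath_Im y) pmulr_lgt0 ?Im_bpath_gt0// pmulr_rgt0. Qed.

Lemma bpath_opp y : complex.Re (bpath (- y)) = - complex.Re (bpath y) /\
  complex.Im (bpath (- y)) = complex.Im (bpath y).
Proof.
have h1 := bpath_Re y; have h2 := bpath_Im y; have h3 := Im_bpath_gt0 y.
move: (complex.Re (bpath y)) (complex.Im (bpath y)) h1 h2 h3 => a b h1 h2 h3.
have v2 : (- a +i* b : CC R) ^+ 2 = bpath (- y) ^+ 2.
  rewrite bpath_sqr expr2; apply: complexP; rewrite !ReImE /=; last by lra.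
  by move: h1; rewrite !expr2 => h1; lra.
have /eqP := v2; rewrite -subr_eq0 subr_sqr mulf_eq0 subr_eq0 addr_eq0 => /orP[/eqP <- //|/eqP E].
have := Im_bpath_gt0 (- y); have : complex.Im (- a +i* b : CC R) = b by [].
by rewrite E ImN => H1 H2; lra.
Qed.

Lemma bpath0 : bpath 0 = 'i * (Num.sqrt xi)%:C.
Proof.
have R0 : complex.Re (bpath 0) = 0.
  by apply/eqP; rewrite eq_le Re_bpath_ge0// Re_bpath_le0.
have I0 : complex.Im (bpath 0) = Num.sqrt xi.
  have := bpath_Re 0; rewrite R0 expr0n /= => /eqP; rewrite eq_sym subr_eq0 => /eqP H.
  by rewrite -[in RHS]H sqrtr_sqr gtr0_norm ?Im_bpath_gt0.
by rewrite [LHS]complexRI R0 I0 add0r.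
Qed.

Lemma pder_bpath y : pder bpath y ('i / (2 * bpath y)).
Proof.
have d1 : pder base y (0 - 'i * 1).
  apply: pderB; first exact: pder_cst.
  by apply: pderZ; apply: (pder_real (f := id)); exact: is_derive_id.
apply: pder_eq (pderZ 'i (pder_comp (cdiff_psqrt (slit_base y)) d1)) _.
have := bpath_neq0 y; rewrite /bpath -/(base y); set v := psqrt _ => v0.
have v1 : v != 0 by apply: contraNneq v0 => ->; rewrite mulr0.
have i0 := @i_neq0 R.
have -> : 'i * ((2 * v)^-1 * (0 - 'i * 1)) = - ('i ^+ 2) / (2 * v) :> CC R by field.
by rewrite i_sqr; field; rewrite v1 i0.
Qed.

Definition corner_Re := complex.Re (bpath Y).
Definition corner_Im := complex.Im (bpath Y).

(** In the plane of [u] the rays become arcs of the hyperbola [Im^2 - Re^2 = xi], the two sides of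
    the slit form the segment from [- i sqrt xi] to [i sqrt xi], and the closing arc is the vertical
    side [Re u = corner_Re]. The segment is cut at [0] and the side on the real axis, so that each
    piece lies in one half plane [Im u <= 0] or [0 <= Im u], where a single branch of the logarithm
    suffices. The orientation is clockwise; the velocity [i / (2 u)] expresses [2 u du = i dy]. *)
Definition keyhole (i : 'I_6) : piece R :=
  let p0 := Piece (- Y) 0 (fun s => - bpath s) (fun s => - ('i / (2 * bpath s))) in
  nth p0 [:: p0;
    Piece (- Num.sqrt xi) 0 (fun s => 'i * s%:C) (fun=> 'i);
    Piece 0 (Num.sqrt xi) (fun s => 'i * s%:C) (fun=> 'i);
    Piece 0 Y bpath (fun s => 'i / (2 * bpath s));
    Piece (- corner_Im) 0 (fun s => corner_Re%:C - 'i * s%:C) (fun=> - 'i);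
    Piece 0 corner_Im (fun s => corner_Re%:C - 'i * s%:C) (fun=> - 'i)] i.

Let pder_line (c d : CC R) s : pder (fun s => c + d * s%:C) s d.
Proof.
apply: pder_eq (pderD (pder_cst c s) (pderZ d (pder_real (f := id) (is_derive_id s (1 : R))))) _.
by rewrite add0r mulr1.
Qed.

Let pder_iline s : pder (fun s => 'i * s%:C : CC R) s 'i.
Proof.
have H := pder_line 0 'i s.
by move: H; under eq_fun do rewrite add0r.
Qed.

Let pder_side s : pder (fun s => corner_Re%:C - 'i * s%:C : CC R) s (- 'i).
Proof.
have H := pder_line corner_Re%:C (- 'i) s.
by move: H; under eq_fun do rewrite mulNr.
Qed.

Lemma bvel_cvg s : (fun s => 'i / (2 * bpath s)) @ s --> 'i / (2 * bpath s).
Proof.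
apply: cvgCM; first exact: cvgC_cst.
apply: cvgCV; first by rewrite mulf_neq0 ?pnatr_eq0 ?bpath_neq0.
apply: cvgCM; first exact: cvgC_cst.
exact: pder_cont (pder_bpath s).
Qed.

Lemma keyhole_piece i : is_piece (keyhole i).
Proof.
case: i => m; case: m => [|[|[|[|[|[|//]]]]]] mi; rewrite /is_piece /keyhole /=; split.
- by rewrite oppr_le0 ltW.
- move=> s _; split; first exact: pderN (pder_bpath s).
  apply: cvgCN; exact: bvel_cvg.
- by rewrite oppr_le0 sqrtr_ge0.
- move=> s _; split; [exact: pder_iline|exact: cvgC_cst].
- exact: sqrtr_ge0.
- move=> s _; split; [exact: pder_iline|exact: cvgC_cst].
- exact: ltW.
- move=> s _; split; [exact: pder_bpath|exact: bvel_cvg].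
- by rewrite oppr_le0 ltW// Im_bpath_gt0.
- move=> s _; split; [exact: pder_side|exact: cvgC_cst].
- by rewrite ltW// Im_bpath_gt0.
- move=> s _; split; [exact: pder_side|exact: cvgC_cst].
Qed.

Let corner : corner_Re%:C - 'i * (- corner_Im)%:C = bpath Y.
Proof. by rewrite [RHS]complexRI rmorphN mulrN opprK. Qed.

Let corner' : corner_Re%:C - 'i * corner_Im%:C = - bpath (- Y).
Proof.
have [h1 h2] := bpath_opp Y.
by rewrite [bpath (- Y)]complexRI h1 h2 rmorphN; ring.
Qed.

Lemma sum6 (V : zmodType) (F : 'I_6 -> V) :
  \sum_(i < 6) F i = F (inord 0) + (F (inord 1) + (F (inord 2) + (F (inord 3) + (F (inord 4) + F (inord 5))))).
Proof.
rewrite !big_ord_recl big_ord0 addr0.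
congr (F _ + (F _ + (F _ + (F _ + (F _ + F _))))); apply: val_inj; by rewrite /= inordK.
Qed.

Let kE k : (k < 6)%N -> keyhole (inord k) =
  let p0 := Piece (- Y) 0 (fun s => - bpath s) (fun s => - ('i / (2 * bpath s))) in
  nth p0 [:: p0;
    Piece (- Num.sqrt xi) 0 (fun s => 'i * s%:C) (fun=> 'i);
    Piece 0 (Num.sqrt xi) (fun s => 'i * s%:C) (fun=> 'i);
    Piece 0 Y bpath (fun s => 'i / (2 * bpath s));
    Piece (- corner_Im) 0 (fun s => corner_Re%:C - 'i * s%:C) (fun=> - 'i);
    Piece 0 corner_Im (fun s => corner_Re%:C - 'i * s%:C) (fun=> - 'i)] k.
Proof. by move=> k6; rewrite /keyhole inordK. Qed.

Lemma keyhole_closed : closed_contour keyhole.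
Proof.
move=> F; rewrite sum6 !kE//= corner corner' bpath0 rmorph0 mulr0 subr0 rmorphN mulrN.
by ring.
Qed.

Lemma on_keyhole (Q : CC R -> Prop) :
  (forall s, - Y <= s <= 0 -> Q (- bpath s)) -> (forall s, 0 <= s <= Y -> Q (bpath s)) ->
  (forall s, - Num.sqrt xi <= s <= Num.sqrt xi -> Q ('i * s%:C)) ->
  (forall s, - corner_Im <= s <= corner_Im -> Q (corner_Re%:C - 'i * s%:C)) ->
  forall u, on_contour keyhole u -> Q u.
Proof.
move=> Q1 Q2 Q3 Q4 u [[m mi] [s]]; have sx := sqrtr_ge0 xi; have b0 := Im_bpath_gt0 Y.
case: m mi => [|[|[|[|[|[|//]]]]]] mi; rewrite /keyhole /= => -[/andP[s1 s2] ->].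
- by apply: Q1; rewrite s1.
- by apply: Q3; rewrite s1 (le_trans s2).
- by apply: Q3; rewrite s2 (le_trans _ s1)// oppr_le0.
- by apply: Q2; rewrite s1.
- by apply: Q4; rewrite s1 (le_trans s2)// ltW.
- by apply: Q4; rewrite s2 andbT (le_trans _ s1)// oppr_le0 ltW.
Qed.

(** [Re u <= |Im u|] means [Re (u^2) <= 0], the half plane of A-stability; this covers the hyperbola
    and the segment, while the closing side is known by its real part. *)
Lemma keyhole_location u : on_contour keyhole u ->
  0 <= complex.Re u /\ (complex.Re u <= `|complex.Im u| \/ complex.Re u = corner_Re).
Proof.
have ReIm y : `|complex.Re (bpath y)| <= `|complex.Im (bpath y)|.
  by rewrite -ler_sqr ?nnegrE// !real_normK ?num_real// bpath_Re gerBl ltW.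
move: u; apply: on_keyhole.
- move=> s /andP[_ s0]; rewrite ReN ImN oppr_ge0 Re_bpath_le0// normrN; split=> //; left.
  by apply: le_trans (ReIm s); rewrite -normrN ler_norm.
- move=> s /andP[s0 _]; rewrite Re_bpath_ge0//; split=> //; left.
  by apply: le_trans (ReIm s); rewrite ler_norm.
- by move=> s _; rewrite Re_imul Im_imul /= oppr0; split=> //; left.
- move=> s _; rewrite ReD ReN Re_imul /= oppr0 oppr0 addr0.
  by split; [exact: Re_bpath_ge0 (ltW Y0)|right].
Qed.

Let cLog_i t : 0 < t -> cLog ('i * t%:C : CC R) - cLog (- ('i * t%:C)) = 'i * pi%:C.
Proof.
move=> t0; have a1 : cArg ('i * t%:C : CC R) = pi / 2.
  rewrite /cArg Re_imul Im_imul /= cabsM cabsi mul1r cabsR gtr0_norm// oppr0 addr0.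
  by rewrite divff ?gt_eqF// atan1; field.
have a2 : cArg (- ('i * t%:C) : CC R) = - (pi / 2).
  rewrite /cArg ReN ImN Re_imul Im_imul /= cabsN cabsM cabsi mul1r cabsR gtr0_norm// oppr0 oppr0 addr0.
  by rewrite mulNr divff ?gt_eqF// atanN atan1; field.
rewrite /cLog a1 a2 cabsN rmorphN.
have -> : (pi : R)%:C = (pi / 2)%:C + (pi / 2)%:C :> CC R.
  by rewrite -rmorphD; congr (_%:C); field.
by ring.
Qed.

Let sub_neq0 (a u : CC R) : on_contour keyhole u -> `|complex.Im a| < complex.Re a -> complex.Re a < corner_Re ->
  u - a != 0.
Proof.
move=> /keyhole_location[u0 H] a1 a2; rewrite subr_eq0; apply/eqP => ua.
by move: H; rewrite ua leNgt a1 => -[//|E]; move: a2; rewrite E ltxx.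
Qed.

(** Turning by [- i] moves the cut of the logarithm to the half line descending from [a], away from
    the points with [0 <= Im u]; [lower_log] is the mirror image. *)
Let upper_log (a : R) u : 0 <= complex.Im u -> u - a%:C != 0 ->
  cdiff (fun u => cLog (- ('i * (u - a%:C)))) u (u - a%:C)^-1.
Proof.
move=> u0 ua; have sl : slit (- ('i * (u - a%:C))).
  have r0 : 0 <= complex.Re (- ('i * (u - a%:C))).
    by rewrite ReN Re_imul ImD ImN /= subr0 opprK.
  by rewrite /slit ltr_wpDr// cabs_gt0 oppr_eq0 mulf_neq0// i_neq0.
have D := cdiffN (cdiffZ 'i (cdiffB (cdiff_id u) (cdiff_cst a%:C u))).
have D2 := @cdiff_comp R (@cLog R) (fun u => - ('i * (u - a%:C))) u _ _ (cdiff_cLog sl) D.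
apply: cdiff_eq D2 _.
by have := @i_neq0 R => i0; field; rewrite ua i0.
Qed.

Let lower_log (a : R) u : complex.Im u <= 0 -> u - a%:C != 0 ->
  cdiff (fun u => cLog ('i * (u - a%:C))) u (u - a%:C)^-1.
Proof.
move=> u0 ua; have sl : slit ('i * (u - a%:C)).
  have r0 : 0 <= complex.Re ('i * (u - a%:C)).
    by rewrite Re_imul ImD ImN /= subr0 oppr_ge0.
  by rewrite /slit ltr_wpDr// cabs_gt0 mulf_neq0// i_neq0.
have D := cdiffZ 'i (cdiffB (cdiff_id u) (cdiff_cst a%:C u)).
have D2 := @cdiff_comp R (@cLog R) (fun u => 'i * (u - a%:C)) u _ _ (cdiff_cLog sl) D.
apply: cdiff_eq D2 _.
by have := @i_neq0 R => i0; field; rewrite ua i0.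
Qed.

(** The primitives telescope over the upper and over the lower pieces. Where the contour meets the
    real axis, at [0] and at [corner_Re], the two branches disagree, and each place contributes
    [- i pi]. *)
Let winding_real (a : R) : 0 < a < corner_Re ->
  oint keyhole (fun u => (u - a%:C)^-1) = - (2 * 'i * pi%:C).
Proof.
move=> /andP[a0 aX].
have ua u : on_contour keyhole u -> u - a%:C != 0.
  by move=> uP; apply: sub_neq0 => //=; rewrite normr0.
have cf : cont_on keyhole (fun u => (u - a%:C)^-1).
  move=> u uP; apply: cvgCV_at; first exact: ua.
  by apply: cvgCB_at; [exact: cvgC_id_at|exact: cvgC_cst_at].
pose Fu u := cLog (- ('i * (u - a%:C))); pose Fl u := cLog ('i * (u - a%:C)).
have part (i : 'I_6) (F : CC R -> CC R) :
  (forall s, p_lo (keyhole i) <= s <= p_hi (keyhole i) ->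
     cdiff F (p_path (keyhole i) s) (p_path (keyhole i) s - a%:C)^-1) ->
  cint `[p_lo (keyhole i), p_hi (keyhole i)] (fun s => (p_path (keyhole i) s - a%:C)^-1 * p_vel (keyhole i) s)
   = F (p_path (keyhole i) (p_hi (keyhole i))) - F (p_path (keyhole i) (p_lo (keyhole i))).
  move=> dF; apply: (@cint_FTC _ _ _ _ (fun s => F (p_path (keyhole i) s))).
  - by case: (keyhole_piece i).
  - exact: (@pcont_oint R 6 keyhole keyhole_piece (fun u => (u - a%:C)^-1) i cf).
  move=> s sP; apply: pder_comp; first exact: dF.
  by have [] := proj2 (keyhole_piece i) s sP.
have up i : (forall s, p_lo (keyhole i) <= s <= p_hi (keyhole i) -> 0 <= complex.Im (p_path (keyhole i) s)) ->
  cint `[p_lo (keyhole i), p_hi (keyhole i)] (fun s => (p_path (keyhole i) s - a%:C)^-1 * p_vel (keyhole i) s)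
   = Fu (p_path (keyhole i) (p_hi (keyhole i))) - Fu (p_path (keyhole i) (p_lo (keyhole i))).
  move=> im; apply: part => s sP; apply: upper_log; first exact: im.
  by apply: ua; exact: on_contour_path.
have low i : (forall s, p_lo (keyhole i) <= s <= p_hi (keyhole i) -> complex.Im (p_path (keyhole i) s) <= 0) ->
  cint `[p_lo (keyhole i), p_hi (keyhole i)] (fun s => (p_path (keyhole i) s - a%:C)^-1 * p_vel (keyhole i) s)
   = Fl (p_path (keyhole i) (p_hi (keyhole i))) - Fl (p_path (keyhole i) (p_lo (keyhole i))).
  move=> im; apply: part => s sP; apply: lower_log; first exact: im.
  by apply: ua; exact: on_contour_path.
have side s : complex.Im (corner_Re%:C - 'i * s%:C : CC R) = - s.
  by rewrite ImD ImN Im_imul /= add0r.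
rewrite /oint sum6 low; last first.
  move=> s _; have -> : p_path (keyhole (inord 0)) s = - bpath s by rewrite kE.
  by rewrite ImN oppr_le0 ltW ?Im_bpath_gt0.
rewrite low; last by move=> s; rewrite kE// [p_path _]/= [p_lo _]/= [p_hi _]/= => /andP[_ s0]; rewrite Im_imul.
rewrite up; last by move=> s; rewrite kE// [p_path _]/= [p_lo _]/= [p_hi _]/= => /andP[s0 _]; rewrite Im_imul.
rewrite up; last first.
  move=> s _; have -> : p_path (keyhole (inord 3)) s = bpath s by rewrite kE.
  by rewrite ltW ?Im_bpath_gt0.
rewrite up; last by move=> s; rewrite kE// [p_path _]/= [p_lo _]/= [p_hi _]/= => /andP[_ s0]; rewrite side oppr_ge0.
rewrite low; last by move=> s; rewrite kE// [p_path _]/= [p_lo _]/= [p_hi _]/= => /andP[s0 _]; rewrite side oppr_le0.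
rewrite !kE//= corner corner' bpath0 rmorph0 mulr0 subr0 rmorphN mulrN.
have e1 := cLog_i a0; have := cLog_i (_ : 0 < corner_Re - a); rewrite subr_gt0 => /(_ aX) e2.
have l0 : Fl 0 = cLog (- ('i * a%:C)) by rewrite /Fl sub0r mulrN.
have u0 : Fu 0 = cLog ('i * a%:C) by rewrite /Fu sub0r mulrN opprK.
have sb : (corner_Re - a)%:C = corner_Re%:C - a%:C :> CC R by exact: rmorphB.
have lX : Fl corner_Re%:C = cLog ('i * (corner_Re - a)%:C) by rewrite sb.
have uX : Fu corner_Re%:C = cLog (- ('i * (corner_Re - a)%:C)) by rewrite sb.
transitivity (- (Fu 0 - Fl 0) - (Fl corner_Re%:C - Fu corner_Re%:C) ); first by ring.
by rewrite l0 u0 lX uX e1 e2; ring.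
Qed.

(** The point is moved vertically between [a] and its real part, off the contour. The derivative of
    the integral along the way is a multiple of the integral of [(u - m)^-2], which has a
    primitive. *)
Lemma keyhole_winding (a : CC R) : `|complex.Im a| < complex.Re a -> complex.Re a < corner_Re ->
  oint keyhole (fun u => (u - a)^-1) = - (2 * 'i * pi%:C).
Proof.
move=> a1 a2; have a0 : 0 < complex.Re a by rewrite (le_lt_trans _ a1).
pose c : CC R := (complex.Re a)%:C; pose m (t : R) : CC R := c + t%:C * ('i * (complex.Im a)%:C).
have mRe t : complex.Re (m t) = complex.Re a by rewrite /m !ReImE /=; ring.
have mIm t : complex.Im (m t) = t * complex.Im a by rewrite /m !ReImE /=; ring.
have mP t u : -1 < t < 2 -> `|t| <= 1 -> on_contour keyhole u -> u - m t != 0.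
  move=> _ t1 uP; apply: sub_neq0 => //; rewrite ?mRe// mIm normrM (le_lt_trans _ a1)//.
  by rewrite ler_piMl.
have one : cont_on keyhole (fun=> 1) by move=> u _; exact: cvgC_cst_at.
have cid : cont_on keyhole (fun u => u) by move=> u _; exact: cvgC_id_at.
have dm t : pder m t (0 + 'i * (complex.Im a)%:C).
  have h := pderM (pder_real (f := id) (is_derive_id t (1 : R))) (pder_cst ('i * (complex.Im a)%:C) t).
  apply: pder_eq (pderD (pder_cst c t) h) _.
  by rewrite mulr0 add0r mulr1.
have dW t : 0 <= t <= 1 -> pder (fun t => oint keyhole (fun u => (u - m t)^-1)) t 0.
  move=> /andP[t0 t1].
  have nz u : on_contour keyhole u -> u - 1 * m t != 0.
    by move=> uP; rewrite mul1r; apply: (mP t) => //; [apply/andP; split; lra|rewrite ger0_norm].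
  have D := pder_comp (oint_kernel_cdiff keyhole_piece 1 one cid one nz) (dm t).
  have eF : (fun t => oint keyhole (fun u => (u - m t)^-1)) = 
     (fun w => oint keyhole (fun u => 1 / (u - 1 * m w) ^+ 1)).
    by apply/funext => w; congr (oint _ _); apply/funext => u; rewrite expr1 !mul1r.
  rewrite eF; apply: pder_eq D _.
  rewrite (_ : oint _ _ = 0) ?mulr0 ?mul0r//.
  apply: (oint_FTC keyhole_piece (F := fun u => - (u - 1 * m t)^-1)).
  - move=> u uP; apply: cvgCM_at; first exact: cvgC_cst_at.
    apply: cvgCV_at; first by rewrite expf_neq0// nz.
    by apply: cvgCX_at; apply: cvgCB_at; [exact: cvgC_id_at|exact: cvgC_cst_at].
  - move=> u uP; have h := cdiffB (cdiff_id u) (cdiff_cst (1 * m t) u).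
    have h2 := @cdiffV R (fun u => u - 1 * m t) u _ (nz u uP) h.
    apply: cdiff_eq (cdiffN h2) _.
    by rewrite !mul1r subr0 mulr1 opprK.
  - exact: keyhole_closed.
have m0 : m 0 = c by rewrite /m rmorph0 mul0r addr0.
have m1 : m 1 = a by rewrite /m rmorph1 mul1r -complexRI.
transitivity (oint keyhole (fun u => (u - m 1)^-1)); first by rewrite m1.
transitivity (oint keyhole (fun u => (u - m 0)^-1)); last first.
  by rewrite m0; apply: winding_real; rewrite a0.
symmetry; apply: (const_of_pder (f := fun t => oint keyhole (fun u => (u - m t)^-1))) => //.
- by move=> t /andP[t0 t1]; apply: dW; rewrite !ltW.
- by move=> t tt; exact: pder_cont (dW t tt).
Qed.

End keyhole_contour.

(** * The transfer function *)

Lemma cvgC_eq {R : realType} {T : Type} (F : set_system T) (f : T -> CC R) (a b : CC R) :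
  f @ F --> a -> a = b -> f @ F --> b.
Proof. by move=> fa <-. Qed.
Arguments cvgC_eq {R T F f a b} _ _.

Section transfer_function.
Context {R : realType}.
Implicit Types (D : nat) (nx : R) (u z : CC R).

Definition rot : CC R := cexp (- ('i * (pi / 4 : R)%:C)).

Lemma Re_real_mul (n : R) z : complex.Re (n%:C * z) = n * complex.Re z.
Proof. by rewrite ReM /= mul0r subr0. Qed.

Lemma Im_real_mul (n : R) z : complex.Im (n%:C * z) = n * complex.Im z.
Proof. by rewrite ImM /= mul0r addr0. Qed.

Lemma rotV : rot^-1 = eipi4.
Proof. by rewrite /rot cexpN invrK. Qed.

Lemma rot_neq0 : rot != 0. Proof. exact: cexp_neq0. Qed.

Let k4 : R := cos (pi / 4).

Let k4_gt0 : 0 < k4.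
Proof. by have p := pi_gt0 R; apply: cos_gt0_pihalf; apply/andP; split; lra. Qed.

Lemma Re_rot : complex.Re rot = k4.
Proof. by rewrite /rot Re_cexp ReN ImN Re_imul Im_imul /= !oppr0 expR0 mul1r cosN. Qed.

Lemma Im_rot : complex.Im rot = - k4.
Proof.
rewrite /rot Im_cexp ReN ImN Re_imul Im_imul /= !oppr0 expR0 mul1r sinN /k4 -cosBpihalf -[in LHS]cosN.
by congr (- cos _); field.
Qed.

Lemma i_rot : 'i * rot = eipi4.
Proof.
have E : cexp ('i * (pi / 2 : R)%:C) = 'i.
  by apply: complexP; rewrite ?Re_cexp ?Im_cexp Re_imul Im_imul /= oppr0 expR0 mul1r ?cos_pihalf ?sin_pihalf.
transitivity (cexp ('i * (pi / 2 : R)%:C) * rot); first by rewrite E.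
rewrite /rot /eipi4 -cexpD; congr cexp.
rewrite -mulrBr -rmorphB; congr ('i * _%:C); by field.
Qed.

Lemma cabs_rot : cabs rot = 1.
Proof. by rewrite /rot cabs_cexp ReN Re_imul /= oppr0 oppr0 expR0. Qed.

(* [2 u K(u^2, x)], extended by continuity to the closed half plane [Re u >= 0] *)
Definition kfun D nx u : CC R :=
  let c := nx%:C * rot in
  match D with
  | 1 => eipi4 * cexp (- (c * u))
  | 2 => 2 * u * ((2 * (pi : R))%:C ^-1 * besselK0 (c * u))
  | _ => 2 * u * ((4 * (pi : R) * nx)%:C ^-1 * cexp (- (c * u)))
  end.

(** For [D = 2] the derivative of [u K_0(c u)] is [K_0 + theta K_0] at [c u]. *)
Definition kfun' D nx u : CC R :=
  let c := nx%:C * rot in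
  match D with
  | 1 => eipi4 * (cexp (- (c * u)) * - c)
  | 2 => 2 * ((2 * (pi : R))%:C ^-1 * (besselK0 (c * u) + thetaK (c * u)))
  | _ => 2 * ((4 * (pi : R) * nx)%:C ^-1 * ((1 - c * u) * cexp (- (c * u))))
  end.

Definition good_dim D nx := (1 <= D <= 3)%N /\ 0 <= nx /\ ((2 <= D)%N -> 0 < nx).

(** The argument of [u] lies in [[- pi / 2, pi / 2]]; the rotation shifts this to
    [[- 3 pi / 4, pi / 4]], off the cut. *)
Lemma slit_rot nx u : 0 < nx -> 0 <= complex.Re u -> u != 0 -> slit (nx%:C * rot * u).
Proof.
move=> n0 u0 un; rewrite slitP; apply/negP => /andP[/eqP I0 R0].
have s2 : 0 < nx * k4 by rewrite mulr_gt0.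
have eR : complex.Re (nx%:C * rot * u) = nx * k4 * (complex.Re u + complex.Im u).
  by rewrite -mulrA Re_real_mul ReM Re_rot Im_rot; ring.
have eI : complex.Im (nx%:C * rot * u) = nx * k4 * (complex.Im u - complex.Re u).
  by rewrite -mulrA Im_real_mul ImM Re_rot Im_rot; ring.
move: I0 R0; rewrite eR eI pmulr_rle0// => /eqP; rewrite mulf_eq0 gt_eqF//= subr_eq0 => /eqP E E2.
have Ru : complex.Re u = 0 by apply: le_anti; apply/andP; split=> //; lra.
by move/negP: un; apply; apply/eqP; rewrite [u]complexRI E Ru rmorph0 mulr0 addr0.
Qed.

Let cmul_cvg (c u : CC R) : (fun v => c * v) @ u --> c * u.
Proof. exact: (cvgCM_at (@cvgC_cst_at R c u) (@cvgC_id_at R u)). Qed.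

Let cexp_cont (c u : CC R) : (fun v => cexp (- (c * v))) @ u --> cexp (- (c * u)).
Proof. by apply: (cvgC_comp (nbhs_filter u) (cvgCN_at (@cmul_cvg c u))); exact: cdiff_cont (cdiff_cexp _). Qed.

(** For [t < 1] the elementary bound on the logarithm is applied at [sqrt t] instead of [t], which
    yields a majorant vanishing at [0]. *)
Lemma ln_abs_le (t : R) : 0 < t -> t * `|ln t| <= 2 * Num.sqrt t + t ^+ 2.
Proof.
move=> t0; have s0 : 0 < Num.sqrt t by rewrite sqrtr_gt0.
have ts : t = Num.sqrt t ^+ 2 by rewrite sqr_sqrtr// ltW.
have [t1|t1] := leP 1 t.
  rewrite ger0_norm ?ln_ge0//.
  have h : t * ln t <= t * (t - 1) by rewrite ler_wpM2l ?(ltW t0)// ln_le_sub1.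
  apply: (le_trans h); have : 0 <= t := ltW t0; rewrite expr2; lra.
have l0 : ln t <= 0 by rewrite ln_le0// ltW.
rewrite ler0_norm//; have lE : ln t = 2 * ln (Num.sqrt t).
  by rewrite [in LHS]ts expr2 lnM ?posrE//; ring.
have h := ln_ge_sub1 s0.
have h2 : - ln t <= 2 * (Num.sqrt t)^-1 by rewrite lE; lra.
apply: (@le_trans _ _ (t * (2 * (Num.sqrt t)^-1))); first by rewrite ler_wpM2l// ltW.
rewrite [X in X * (_ * _)]ts; have -> : Num.sqrt t ^+ 2 * (2 * (Num.sqrt t)^-1) = 2 * Num.sqrt t.
  by field; rewrite gt_eqF.
by rewrite lerDl sqr_ge0.
Qed.

(** The limit is over a full neighbourhood of [0], across the cut. There [cLog] is a discontinuous
    total function, but its imaginary part stays bounded by [pi], so [u log u] still tends to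
    [0]. *)
Let K0_at0 nx : 0 < nx ->
  (fun u => u * besselK0 (nx%:C * rot * u)) @ (0 : CC R) --> (0 : CC R).
Proof.
move=> n0; pose c : CC R := nx%:C * rot; have FF := nbhs_filter (0 : CC R).
have ci : (fun u : CC R => ps (@cI R) ((c * u) ^+ 2 / 4)) @ (0 : CC R) --> ps (@cI R) ((c * 0) ^+ 2 / 4).
  have h := cdiff_cont (cdiff_ps_quarter (c * 0) (@entire_cI R)).
  exact: (cvgC_comp FF (@cmul_cvg c 0) h).
have cl : (fun u : CC R => ps (@cL R) ((c * u) ^+ 2 / 4)) @ (0 : CC R) --> ps (@cL R) ((c * 0) ^+ 2 / 4).
  have h := cdiff_cont (cdiff_ps_quarter (c * 0) (@entire_cL R)).
  exact: (cvgC_comp FF (@cmul_cvg c 0) h).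
have clog : (fun u : CC R => u * cLog (c * u / 2)) @ (0 : CC R) --> (0 : CC R).
  pose m (u : CC R) : R := (2 / nx) * (2 * Num.sqrt (nx / 2 * cabs u) + (nx / 2 * cabs u) ^+ 2) + cabs u * pi.
  have cid : (fun v : CC R => v) @ (0 : CC R) --> (0 : CC R) by exact: cvgC_id_at.
  have ca := @cvg_cabs R _ _ FF _ _ cid; rewrite cabs0 in ca.
  have ck : (fun u : CC R => nx / 2 * cabs u) @ (0 : CC R) --> nx / 2 * 0.
    by apply: cvgM; [exact: cvg_cst|exact: ca].
  have cs : (fun u : CC R => Num.sqrt (nx / 2 * cabs u)) @ (0 : CC R) --> Num.sqrt (nx / 2 * 0).
    by apply: (@cvg_cont_comp R _ _ FF (@Num.sqrt R) _ _ ck); exact: sqrt_continuous.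
  have cm : m @ (0 : CC R) --> (2 / nx) * (2 * Num.sqrt (nx / 2 * 0) + (nx / 2 * 0) ^+ 2) + 0 * pi.
    apply: cvgD; last by apply: cvgM; [exact: ca|exact: cvg_cst].
    apply: cvgM; first exact: cvg_cst.
    apply: cvgD; first by apply: cvgM; [exact: cvg_cst|exact: cs].
    by apply: cvgM; exact: ck.
  rewrite mulr0 sqrtr0 expr0n mulr0 addr0 mulr0 mul0r addr0 in cm.
  apply/(@cvgCP _ _ _ FF) => e e0.
  have /cvgrPdist_lt/(_ e e0) := cm; apply: filterS => u.
  rewrite !sub0r normrN cabsN => /(le_lt_trans (ler_norm _)); apply: le_lt_trans.
  have [->|un] := eqVneq u 0.
    rewrite mul0r cabs0 /m cabs0 mulr0 sqrtr0 expr0n mulr0 addr0 mulr0 mul0r addr0//.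
  have u0 : 0 < cabs u by rewrite cabs_gt0.
  have cE : cabs (c * u / 2) = nx / 2 * cabs u.
    have -> : (2 : CC R) = (2 : R)%:C by rewrite rmorph_nat.
    rewrite -fmorphV /= cabsM cabsM /c cabsM cabs_rot !cabsR !gtr0_norm ?invr_gt0//.
    by ring.
  have t0 : 0 < nx / 2 * cabs u by rewrite mulr_gt0// divr_gt0.
  have L := ln_abs_le t0.
  have A : cabs (cLog (c * u / 2)) <= `|ln (nx / 2 * cabs u)| + pi.
    rewrite /cLog cE (le_trans (cabsD _ _))// cabsR cabsM cabsi mul1r cabsR lerD2l.
    exact: cArg_bound.
  rewrite cabsM (le_trans (ler_wpM2l (ltW u0) A))// mulrDr /m lerD2r.
  have -> : cabs u * `|ln (nx / 2 * cabs u)| = 2 / nx * (nx / 2 * cabs u * `|ln (nx / 2 * cabs u)|).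
    by field; rewrite gt_eqF.
  by rewrite ler_wpM2l// divr_ge0// ltW.
have -> : (fun u : CC R => u * besselK0 (c * u)) =
   (fun u => - (u * cLog (c * u / 2) + u * (euler_gamma : R)%:C) * ps (@cI R) ((c * u) ^+ 2 / 4) +
      u * ps (@cL R) ((c * u) ^+ 2 / 4)).
  by apply/funext => u; rewrite besselK0E; ring.
have cid := @cvgC_id_at R 0.
have H := cvgCD_at (cvgCM_at (cvgCN_at (cvgCD_at clog (cvgCM_at cid (@cvgC_cst_at R (euler_gamma : R)%:C 0)))) ci)
   (cvgCM_at cid cl).
have e0 p l : - (0 + 0 * (euler_gamma : R)%:C) * p + 0 * l = 0 :> CC R by ring.
exact: (cvgC_eq H (e0 _ _)).
Qed.

Let dim_cases D nx : good_dim D nx -> D = 1%N \/ (0 < nx /\ D = 2%N) \/ (0 < nx /\ D = 3%N).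
Proof.
move=> [D3 [n0 n1]]; case: D D3 n1 => [|[|[|[|]]]]//= _ h; first by left.
  by right; left; split=> //; exact: h.
by right; right; split=> //; exact: h.
Qed.

Lemma kfun_cont D nx u : good_dim D nx -> 0 <= complex.Re u -> kfun D nx @ u --> kfun D nx u.
Proof.
move=> gd u0; pose c : CC R := nx%:C * rot.
have c2 : (fun v => 2 * v) @ u --> 2 * u by exact: cmul_cvg.
case: (dim_cases gd) => [->|[[n0 ->]|[n0 ->]]].
- exact: (cvgCM_at (@cvgC_cst_at R _ u) (@cexp_cont c u)).
- have h : (fun u => u * besselK0 (c * u)) @ u --> u * besselK0 (c * u).
    have [->|un] := eqVneq u 0; first by rewrite mul0r; exact: K0_at0.
    apply: cvgCM_at; first exact: cvgC_id_at.
    apply: (cvgC_comp (nbhs_filter u) (@cmul_cvg c u)).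
    by apply: cdiff_cont (cdiff_besselK0 _); exact: slit_rot.
  have E v : kfun 2 nx v = (2 * (2 * (pi : R))%:C ^-1) * (v * besselK0 (c * v)).
    by rewrite /= -/c; ring.
  have -> : kfun 2 nx = (fun v => (2 * (2 * (pi : R))%:C ^-1) * (v * besselK0 (c * v))).
    by apply/funext.
  exact: (cvgCM_at (@cvgC_cst_at R _ u) h).
- exact: (cvgCM_at c2 (cvgCM_at (@cvgC_cst_at R _ u) (@cexp_cont c u))).
Qed.

Let Re_neq0 u : 0 < complex.Re u -> u != 0.
Proof. by apply: contraTneq => ->; rewrite ltxx. Qed.

Let cdiff_mul (c u : CC R) : cdiff (fun v => c * v) u c.
Proof. by apply: cdiff_eq (cdiffZ c (cdiff_id u)) _; rewrite mulr1. Qed.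

Lemma kfun_cdiff D nx u : good_dim D nx -> 0 < complex.Re u -> cdiff (kfun D nx) u (kfun' D nx u).
Proof.
move=> gd u0; pose c : CC R := nx%:C * rot; have un := Re_neq0 u0.
have dE : cdiff (fun v => cexp (- (c * v))) u (cexp (- (c * u)) * - c).
  exact: (@cdiff_comp R (@cexp R) (fun v => - (c * v)) u _ _ (cdiff_cexp _) (cdiffN (cdiff_mul c u))).
case: (dim_cases gd) => [->|[[n0 ->]|[n0 ->]]] /=.
- exact: cdiffZ dE.
- have sl := slit_rot n0 (ltW u0) un.
  have w0 := slit_neq0 sl.
  have dK := @cdiff_comp R (@besselK0 R) (fun v => c * v) u _ _ (cdiff_besselK0 sl) (cdiff_mul c u).
  apply: cdiff_eq (cdiffM (cdiff_mul 2 u) (cdiffZ (2 * (pi : R))%:C ^-1 dK)) _.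
  rewrite -/c; have wE : c * u != 0 by [].
  have cn : c != 0 by apply: contraNneq wE => ->; rewrite mul0r.
  have -> : 2 * u * ((2 * (pi : R))%:C^-1 * (thetaK (c * u) / (c * u) * c)) =
     2 * ((2 * (pi : R))%:C^-1 * thetaK (c * u)).
    by move: (_%:C^-1) (thetaK _) => k t; field; rewrite un cn.
  by ring.
- apply: cdiff_eq (cdiffM (cdiff_mul 2 u) (cdiffZ (4 * (pi : R) * nx)%:C ^-1 dE)) _.
  by rewrite -/c; ring.
Qed.

Lemma kfun'_cont D nx u : good_dim D nx -> 0 < complex.Re u -> kfun' D nx @ u --> kfun' D nx u.
Proof.
move=> gd u0; pose c : CC R := nx%:C * rot; have un := Re_neq0 u0.
have cst k := @cvgC_cst_at R k u.
case: (dim_cases gd) => [->|[[n0 ->]|[n0 ->]]] /=.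
- exact: (cvgCM_at (cst _) (cvgCM_at (@cexp_cont c u) (cst _))).
- have sl := slit_rot n0 (ltW u0) un.
  apply: (cvgCM_at (cst _)); apply: (cvgCM_at (cst _)); apply: cvgCD_at.
    apply: (cvgC_comp (nbhs_filter u) (@cmul_cvg c u)); exact: cdiff_cont (cdiff_besselK0 sl).
  apply: (cvgC_comp (nbhs_filter u) (@cmul_cvg c u)); exact: cdiff_cont (cdiff_thetaK sl).
- exact: (cvgCM_at (cst _) (cvgCM_at (cst _) (cvgCM_at (cvgCB_at (cst _) (@cmul_cvg c u)) (@cexp_cont c u)))).
Qed.

Let cabs_kform (k : R) u z : 0 < k -> cabs (2 * u * (k%:C ^-1 * z)) = 2 * cabs u * (k^-1 * cabs z).
Proof.
move=> k0; have two : (2 : CC R) = (2 : R)%:C by rewrite rmorph_nat.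
by rewrite {1}two !cabsM cabsV !cabsR !gtr0_norm.
Qed.

(** The condition on [u] says [Re (u^2) >= - xi]. It gives [Re u + Im u >= - sqrt xi], so the
    exponential is at most [e^(nx sqrt xi)]. The powers of [u] come from the factor [2 u] and, for
    [D = 2], from [besselK0_bound]. *)
Lemma kfun_bound D nx xi : good_dim D nx -> 0 < xi -> exists C rho : R, [/\ 0 < C, 0 < rho &
  forall u, 0 <= complex.Re u -> complex.Im u ^+ 2 <= complex.Re u ^+ 2 + xi -> rho <= cabs u ->
    cabs (kfun D nx u) <= C * cabs u ^+ 2].
Proof.
move=> gd xi0; pose c : CC R := nx%:C * rot; pose E := expR (nx * Num.sqrt xi).
have n0 : 0 <= nx by case: gd => _ [].
have E0 : 0 < E by exact: expR_gt0.
have p0 := pi_gt0 R.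
have sx := sqrtr_ge0 xi.
have ReB u : 0 <= complex.Re u -> complex.Im u ^+ 2 <= complex.Re u ^+ 2 + xi ->
    expR (- complex.Re (c * u)) <= E.
  move=> u0 I2; rewrite ler_expR /c -mulrA Re_real_mul ReM Re_rot Im_rot.
  have I1 : `|complex.Im u| <= complex.Re u + Num.sqrt xi.
    rewrite -ler_sqr ?nnegrE ?addr_ge0// real_normK ?num_real// (le_trans I2)//.
    rewrite sqrrD sqr_sqrtr ?(ltW xi0)// -addrA lerD2l lerDr.
    by rewrite mulrn_wge0// mulr_ge0.
  have := I1; rewrite ler_norml => /andP[I3 _].
  have -> : - (nx * (k4 * complex.Re u - - k4 * complex.Im u)) =
     nx * (k4 * - (complex.Re u + complex.Im u)) by ring.
  apply: ler_wpM2l => //; apply: (@le_trans _ _ (k4 * Num.sqrt xi)).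
    by apply: ler_wpM2l; [exact: ltW|lra].
  by rewrite -[leRHS]mul1r; apply: ler_wpM2r => //; exact: cos_le1.
have eE u : 0 <= complex.Re u -> complex.Im u ^+ 2 <= complex.Re u ^+ 2 + xi ->
    cabs (cexp (- (c * u))) <= E.
  by move=> u0 I2; rewrite cabs_cexp ReN; exact: ReB.
have sq1 u : 1 <= cabs u -> 1 <= cabs u ^+ 2 by move=> h; rewrite expr_ge1 ?cabs_ge0.
case: (dim_cases gd) => [->|[[n1 ->]|[n1 ->]]].
- exists E, 1; split => // u u0 I2 u1 /=.
  rewrite cabsM {1}/eipi4 cabs_cexp Re_imul /= oppr0 expR0 mul1r (le_trans (eE u u0 I2))//.
  by rewrite ler_peMr ?sq1// ltW.
- exists (2 * ((2 * pi)^-1 * (49 * expR pi * nx * E)) : R), (2 / nx : R); split.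
  + by rewrite mulr_gt0// mulr_gt0 ?invr_gt0 ?mulr_gt0 ?expR_gt0.
  + by rewrite divr_gt0.
  move=> u u0 I2 ur /=.
  have cE : cabs (c * u) = nx * cabs u by rewrite /c 2!cabsM cabs_rot cabsR gtr0_norm// mulr1.
  have un : u != 0 by rewrite -cabs_gt0 (lt_le_trans _ ur)// divr_gt0.
  have c2 : 2 <= cabs (c * u) by rewrite cE mulrC -ler_pdivrMr.
  have B := besselK0_bound (slit_rot n1 u0 un) c2.
  rewrite cabs_kform; last by rewrite !mulr_gt0.
  have B2 : cabs (besselK0 (c * u)) <= 49 * expR pi * (nx * cabs u) * E.
    apply: (le_trans B); rewrite cE; apply: ler_wpM2l; last exact: ReB.
    by rewrite !mulr_ge0 ?expR_ge0 ?cabs_ge0.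
  have -> : 2 * ((2 * pi)^-1 * (49 * expR pi * nx * E)) * cabs u ^+ 2 =
     2 * cabs u * ((2 * pi)^-1 * (49 * expR pi * (nx * cabs u) * E)) by ring.
  apply: ler_wpM2l; first by rewrite mulr_ge0 ?cabs_ge0.
  by apply: ler_wpM2l => //; rewrite invr_ge0 mulr_ge0// ltW.
- exists (2 * ((4 * pi * nx)^-1 * E) : R), 1; split => //.
    by rewrite mulr_gt0// mulr_gt0 ?invr_gt0 ?mulr_gt0.
  move=> u u0 I2 u1 /=.
  rewrite cabs_kform; last by rewrite !mulr_gt0.
  have k0 : 0 <= (4 * pi * nx)^-1 by rewrite invr_ge0 !mulr_ge0// ltW.
  apply: (@le_trans _ _ (2 * cabs u * ((4 * pi * nx)^-1 * E))).
    apply: ler_wpM2l; first by rewrite mulr_ge0 ?cabs_ge0.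
    by apply: ler_wpM2l => //; exact: eE.
  have -> : 2 * ((4 * pi * nx)^-1 * E) * cabs u ^+ 2 = 2 * cabs u * ((4 * pi * nx)^-1 * E) * cabs u by ring.
  by rewrite ler_peMr// !mulr_ge0 ?cabs_ge0// ltW.
Qed.

Lemma kfun_psqrt D (x : 'rV[R]_D) z : (1 <= D <= 3)%N -> psqrt z != 0 ->
  kfun D (enorm x) (psqrt z) = 2 * psqrt z * Ktrans z x.
Proof.
move=> D3 p0.
have cE (n : R) : n%:C * rot * psqrt z = n%:C * sqrt_zi z by rewrite /sqrt_zi -/rot [RHS]mulrA.
case: D x D3 => [|[|[|[|D]]]] x D3.
- discriminate D3.
- rewrite /kfun /Ktrans cE /sqrt_zi -/rot -rotV; have r0 := rot_neq0.
  by move: (cexp (- _)) => e; field; rewrite p0 r0.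
- by rewrite /kfun /Ktrans cE.
- by rewrite /kfun /Ktrans cE.
- discriminate D3.
Qed.

End transfer_function.

(** * Jumps of the logarithm and of [K_0] across the cut *)

Section boundary_values.
Context {R : realType}.
Implicit Types (z w : CC R).

(** Both [- arg (- z)] and [pi - arg z] lie in []0, pi[] and have the cosine [- Re z / |z|], and the
    cosine is injective there. *)
Lemma cLog_opp z : 0 < complex.Im z -> cLog z - cLog (- z) = 'i * (pi : R)%:C.
Proof.
move=> z0; have s1 : slit z by rewrite slitP gt_eqF.
have s2 : slit (- z) by rewrite slitP ImN oppr_eq0 gt_eqF.
have r0 := slit_gt0 s1.
have posA t : 0 < t -> 0 < 2 * atan t < pi.
  move=> t0; have := atan_ltpi2 t; have := lt_atan t0; rewrite atan0 => h1 h2.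
  by apply/andP; split; lra.
have A0 : 0 < cArg z < pi by apply: posA; rewrite divr_gt0.
have B0 : 0 < - cArg (- z) < pi.
  have -> : - cArg (- z) = 2 * atan (complex.Im z / (cabs (- z) + complex.Re (- z))).
    by rewrite /cArg ImN mulNr atanN mulrN opprK.
  by apply: posA; rewrite divr_gt0.
have ReA w : slit w -> cabs w * cos (cArg w) = complex.Re w.
  move=> sw; rewrite -[in RHS](cexp_cLog sw) Re_cexp /cLog ReD ImD Re_imul Im_imul /=.
  by rewrite oppr0 addr0 add0r lnK ?posrE ?slit_gt0.
have H : cos (- cArg (- z)) = cos (pi - cArg z).
  have e1 := ReA _ s1; have e2 := ReA _ s2; rewrite cabsN ReN -e1 in e2.
  rewrite cosN cosB cospi sinpi mulN1r mul0r addr0; apply: (mulfI (lt0r_neq0 r0)).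
  by rewrite mulrN.
have E : - cArg (- z) = pi - cArg z.
  move/andP: A0 => [a1 a2]; move/andP: B0 => [b1 b2].
  by apply: (@cos_inj R _ _ _ _ H); rewrite in_itv /=; apply/andP; split; lra.
have -> : cLog z - cLog (- z) = 'i * (cArg z - cArg (- z))%:C.
  by rewrite /cLog cabsN rmorphB; ring.
by congr ('i * _%:C); rewrite E; ring.
Qed.

(** Both power series are even in [w], so only the logarithms differ. *)
Lemma besselK0_opp w : 0 < complex.Im w ->
  besselK0 (- w) - besselK0 w = 'i * (pi : R)%:C * besselI0 w.
Proof.
move=> w0; have two : (2 : CC R) = (2 : R)%:C by rewrite rmorph_nat.
have h0 : 0 < complex.Im (w / 2).
  by rewrite two -fmorphV /= mulrC Im_real_mul mulr_gt0 ?invr_gt0.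
rewrite !besselK0E besselI0E sqrrN (mulNr w) -(cLog_opp h0); ring.
Qed.

Lemma besselJ0_I0 v w : w ^+ 2 = - v ^+ 2 -> besselJ0 v = besselI0 w :> CC R.
Proof.
move=> vw; congr cseries; apply/funext => k; congr (_ / _).
by rewrite -exprMn vw; congr (_ ^+ k); ring.
Qed.

Lemma enorm_gt0 D (x : 'rV[R]_D) : x != 0 -> 0 < enorm x.
Proof.
move=> x0; rewrite sqrtr_gt0 lt_def sumr_ge0 ?andbT => [|i _]; last exact: sqr_ge0.
apply: contraNneq x0 => /eqP; rewrite psumr_eq0 => [|i _]; last exact: sqr_ge0.
move=> /allP H; apply/eqP/rowP => i; rewrite mxE.
by have := H i (mem_index_enum i); rewrite /= sqrf_eq0 => /eqP.
Qed.

End boundary_values.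

(** * Boundary values and Cauchy representation of the transfer function *)

Section transfer_boundary.
Context {R : realType} (D : nat) (x : 'rV[R]_D).
Hypothesis HD : (1 <= D <= 3)%N.
Hypothesis Hx : (2 <= D)%N -> x != 0.
Implicit Types (l y xi : R) (u z : CC R).

Let nx := enorm x.
Let kf := kfun D nx.

Lemma good_dim_enorm : good_dim D nx.
Proof. by split=> //; split=> [|/Hx]; [exact: sqrtr_ge0|exact: enorm_gt0]. Qed.

(** The function [K] in terms of the square root [u] of [z]. The upper and lower sides of the cut
    are the two halves of the imaginary axis, so the boundary values [Kup] and [Kdown] are plain
    values of it. *)
Definition Kside u : CC R := kfun D (enorm x) u / (2 * u).

Lemma Kside_cont u : 0 <= complex.Re u -> u != 0 -> Kside @ u --> Kside u.
Proof.
move=> u0 un; apply: cvgCM_at; first exact: (@kfun_cont R D nx u good_dim_enorm u0).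
apply: cvgCV_at; first by rewrite mulf_neq0// pnatr_eq0.
by apply: cvgCM_at; [exact: cvgC_cst_at|exact: cvgC_id_at].
Qed.

Lemma Ktrans_Kside z : psqrt z != 0 -> Ktrans z x = Kside (psqrt z).
Proof. by move=> p0; rewrite /Kside kfun_psqrt//; field. Qed.

(** On the cut [psqrt] takes the value continued from above, so the point [- xi] belongs to the
    upper ray: [Ktrans_upper] includes [y = 0], [Ktrans_lower] asks for [y < 0]. *)
Let psqrt_neg xi : 0 < xi -> psqrt (- xi)%:C = bpath xi 0.
Proof.
move=> xi0; rewrite bpath0// /psqrt cabsR normrN gtr0_norm//= ltxx mul1r subrr mul0r sqrtr0 opprK.
have -> : (xi + xi) / 2 = xi by field.
by apply: complexP; rewrite ?Re_imul ?Im_imul /= ?oppr0.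
Qed.

Lemma Ktrans_upper xi y : 0 < xi -> 0 <= y -> Ktrans ((- xi)%:C + 'i * y%:C) x = Kside (bpath xi y).
Proof.
move=> xi0; rewrite le_eqVlt => /predU1P[<-|y0].
  by rewrite rmorph0 mulr0 addr0 Ktrans_Kside psqrt_neg// bpath_neq0.
have E := psqrt_eq (bpath_sqr xi y) (Re_bpath_gt0 xi0 y0).
by rewrite Ktrans_Kside E// bpath_neq0.
Qed.

Lemma Ktrans_lower xi y : 0 < xi -> y < 0 -> Ktrans ((- xi)%:C + 'i * y%:C) x = Kside (- bpath xi y).
Proof.
move=> xi0 y0; have [h _] := bpath_opp xi0 (- y); rewrite opprK in h.
have E : psqrt ((- xi)%:C + 'i * y%:C) = - bpath xi y.
  by apply: psqrt_eq; [rewrite sqrrN bpath_sqr|rewrite ReN h opprK Re_bpath_gt0// oppr_gt0].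
by rewrite Ktrans_Kside E// oppr_eq0 bpath_neq0.
Qed.

Definition Kup l := Kside ('i * (Num.sqrt l)%:C).
Definition Kdown l := Kside (- ('i * (Num.sqrt l)%:C)).

Let isl_neq0 l : 0 < l -> ('i * (Num.sqrt l)%:C : CC R) != 0.
Proof. by move=> l0; rewrite -cabs_gt0 cabsM cabsi mul1r cabsR normr_gt0 gt_eqF// sqrtr_gt0. Qed.

Let Re_isl l : complex.Re ('i * (Num.sqrt l)%:C : CC R) = 0.
Proof. by rewrite Re_imul /= oppr0. Qed.

(** The path [bpath] is reused with [l] in place of [xi]: it follows the square root of
    [- l + i eps] and is continuous at [eps = 0], where it reaches [i sqrt l]. *)
Lemma Kup_cvg l : 0 < l ->
  (fun eps : R => Ktrans ((- l)%:C + 'i * eps%:C) x) @ 0^'+ --> Kup l.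
Proof.
move=> l0; have H : (fun eps : R => Kside (bpath l eps)) @ (0 : R) --> Kup l.
  apply: (cvgC_comp (nbhs_filter (0 : R)) (pder_cont (pder_bpath l0 0))).
  rewrite /Kup bpath0//; apply: Kside_cont; last exact: isl_neq0.
  by rewrite Re_isl.
have H2 := cvg_at_right_filter H.
apply: cvg_trans H2; apply: near_eq_cvg.
by near=> e; rewrite Ktrans_upper//; near: e; exact: nbhs_right_ge.
Unshelve. all: by end_near. Qed.

Lemma Kdown_cvg l : 0 < l ->
  (fun eps : R => Ktrans ((- l)%:C - 'i * eps%:C) x) @ 0^'+ --> Kdown l.
Proof.
move=> l0; have H : (fun eps : R => Kside (- bpath l (- eps))) @ (0 : R) --> Kdown l.
  have c1 : (fun eps : R => bpath l (- eps)) @ (0 : R) --> bpath l (- 0).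
    apply: (@cvg_comp _ _ _ (fun e : R => - e) (bpath l) _ (nbhs (- 0 : R))).
      by apply: cvgN; exact: cvg_id.
    exact: pder_cont (pder_bpath l0 _).
  apply: (cvgC_comp (nbhs_filter (0 : R)) (cvgCN c1)).
  rewrite /Kdown oppr0 (bpath0 l0); apply: Kside_cont; last by rewrite oppr_eq0 isl_neq0.
  by rewrite ReN Re_isl oppr0.
have H2 := cvg_at_right_filter H.
apply: cvg_trans H2; apply: near_eq_cvg.
near=> e; have e0 : 0 < e by near: e; exact: nbhs_right_gt.
have <- : (- l)%:C + 'i * (- e)%:C = (- l)%:C - 'i * e%:C :> CC R by rewrite [(- e)%:C]rmorphN mulrN.
by rewrite Ktrans_lower// oppr_lt0.
Unshelve. all: by end_near. Qed.

Lemma Gjump_eq l : 0 < l -> Kdown l - Kup l = Gjump l x.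
Proof.
move=> l0; have N0 : (2 <= D)%N -> 0 < enorm x by move=> /Hx; exact: enorm_gt0.
rewrite /Kdown /Kup /Kside /Gjump; move: (enorm x) N0 => N N0.
pose s : CC R := (Num.sqrt l)%:C.
have s0 : s != 0 by apply: contraNneq (isl_neq0 l0) => E; rewrite -/s E mulr0.
have i0 := @i_neq0 R; have ii := @i_sqr R.
have iV : ('i : CC R)^-1 = - 'i.
  by apply: (mulfI i0); rewrite divff// mulrN -expr2 ii opprK.
pose w : CC R := N%:C * eipi4 * s.
have cw : N%:C * rot * ('i * s) = w by rewrite /w -i_rot; ring.
have cw' : N%:C * rot * - ('i * s) = - w by rewrite mulrN cw.
have E k1 k2 : k1 / (2 * - ('i * s)) - k2 / (2 * ('i * s)) = - ('i ^+ 2) * ('i * (k1 + k2)) / (2 * s).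
  by rewrite ii opprK mul1r mulrN invrN !invfM iV; ring.
have J n : kfun n N (- ('i * s)) + kfun n N ('i * s) =
  match n with
  | 1 => eipi4 * (cexp w + cexp (- w))
  | 2 => 2 * ('i * s) * ((2 * (pi : R))%:C ^-1 * (besselK0 w - besselK0 (- w)))
  | _ => 2 * ('i * s) * ((4 * (pi : R) * N)%:C ^-1 * (cexp (- w) - cexp w))
  end.
  case: n => [|[|[|n]]]; rewrite /kfun cw' cw ?opprK.
  - by move: (cexp (- w)) (cexp w) (_^-1) => p q r; ring.
  - by move: (cexp (- w)) (cexp w) => p q; ring.
  - by move: (besselK0 (- w)) (besselK0 w) (_^-1) => p q r; ring.
  - by move: (cexp (- w)) (cexp w) (_^-1) => p q r; ring.
rewrite -/s E J ii opprK mul1r {E J}; have two (t : R) : (2 * t)%:C = 2 * t%:C :> CC R by rewrite rmorphM rmorph_nat.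
have [D1|[D2|D3]] : D = 1%N \/ D = 2%N \/ D = 3%N.
  by case: D HD => [|[|[|[|]]]]//= _; [left|right;left|right;right].
- rewrite D1 /ccosh -/w; field.
  by rewrite s0.
- have w0 : 0 < complex.Im w.
    rewrite /w -mulrA Im_real_mul mulr_gt0 ?N0 ?D2//.
    rewrite mulrC Im_real_mul mulr_gt0 ?sqrtr_gt0// /eipi4 Im_cexp Re_imul Im_imul /= oppr0 expR0 mul1r.
    by have p := pi_gt0 R; apply: sin_gt0_pi; apply/andP; split; lra.
  have pn : ((pi : R)%:C : CC R) != 0.
    by rewrite -cabs_gt0 cabsR gtr0_norm ?pi_gt0.
  rewrite D2 (@besselJ0_I0 R _ w); last first.
    rewrite /w -i_rot /rot -/s !exprMn ii; ring.
  rewrite -[besselK0 w - _]opprB besselK0_opp// two.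
  (* [field] treats the imaginary unit as an atom, so the relation [i^2 = -1] enters by hand, as a
     factor equal to [1]. *)
  transitivity (- ('i ^+ 2) * ('i / 2 * besselI0 w)); last by rewrite ii; ring.
  by move: ((pi : R)%:C) pn => p pn; field; rewrite s0 pn.
- have nn : (((pi : R) * N)%:C : CC R) != 0.
    by rewrite -cabs_gt0 cabsR normr_gt0 mulf_neq0 // ?gt_eqF ?pi_gt0 // N0 // D3.
  rewrite D3 /csinh -/w.
  have -> : (4 * pi * N : R) = 2 * (2 * (pi * N)) by ring.
  have -> : (2 * pi * N : R) = 2 * (pi * N) by ring.
  rewrite !two.
  transitivity (- ('i ^+ 2) * ((2 * (pi * N)%:C)^-1 * ((cexp w - cexp (- w)) / 2))).
    by move: ((pi * N)%:C) nn => p nn; field; rewrite s0 nn.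
  by rewrite ii opprK mul1r.
Qed.

Section cauchy.
Variables (xi Y : R).
Hypothesis xi0 : 0 < xi.
Hypothesis Y0 : 0 < Y.

(** A half disc avoided by the squares of the contour points: on the closing side
    [|u|^2 >= corner_Re^2], and elsewhere [Re (u^2) <= 0]. It is open and will contain every
    spectrum that occurs. *)
Definition inner_region (l : CC R) := 0 < complex.Re l /\ cabs l < corner_Re xi Y ^+ 2.

Lemma keyhole_avoids (l u : CC R) : inner_region l -> on_contour (keyhole xi Y) u -> u ^+ 2 != l.
Proof.
move=> [l0 l1] /(keyhole_location xi0 Y0)[u0 [H|H]]; apply/eqP => E.
  move: l0; rewrite -E expr2 ReM subr_gt0 -!expr2 -[X in X < _]real_normK ?num_real//.
  by rewrite ltNge ler_sqr ?nnegrE// H.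
move: l1; rewrite -E cabsX -H ltNge ler_sqr ?nnegrE ?cabs_ge0//.
by rewrite (le_trans (ler_norm _))// cabs_Re.
Qed.

(** With [a] the square root of [l], split [1 / (u^2 - l)] into [1 / (u + a)], regular for
    [0 <= Re u], and [1 / (u - a)]. Then [cauchy_star] applies to [H = kfun / (u + a)], whose value
    at [a] is [K(l)]; the minus sign is the clockwise orientation. *)
Lemma Ktrans_cauchy (l : CC R) : inner_region l ->
  Ktrans l x = - (2 * 'i * (pi : R)%:C)^-1 *
    oint (keyhole xi Y) (fun u => kfun D (enorm x) u / (u ^+ 2 - l)).
Proof.
move=> reg; have [l0 l1] := reg; have gd := good_dim_enorm.
have sl : slit l by rewrite /slit ltr_wpDl ?cabs_ge0.
pose a := psqrt l; have a0 : 0 < complex.Re a := Re_psqrt_gt0 sl.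
have a2 : a ^+ 2 = l := psqrt_sqr l.
have aI : `|complex.Im a| < complex.Re a.
  rewrite -[ltRHS]gtr0_norm// -ltr_sqr ?nnegrE// !real_normK ?num_real//.
  by move: l0; rewrite -a2 expr2 ReM subr_gt0 -!expr2.
have X0 : 0 <= corner_Re xi Y by apply: Re_bpath_ge0 => //; exact: ltW.
have aX : complex.Re a < corner_Re xi Y.
  apply: (le_lt_trans (le_trans (ler_norm _) (cabs_Re a))).
  by rewrite -ltr_sqr ?nnegrE ?cabs_ge0// -cabsX a2.
have sum_neq0 u : 0 <= complex.Re u -> u + a != 0.
  move=> u0; apply: contraTneq (ltr_wpDl u0 a0) => E.
  by rewrite -ReD E ltxx.
have ccst k u := @cvgC_cst_at R k u.
have cadd u : (fun v => v + a) @ u --> u + a by apply: cvgCD_at; [exact: cvgC_id_at|exact: ccst].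
pose k := kfun D (enorm x); pose k' := kfun' D (enorm x).
pose H u := k u / (u + a).
pose H' u := k' u / (u + a) - k u / (u + a) ^+ 2.
have cH u : 0 <= complex.Re u -> H @ u --> H u.
  move=> u0; apply: cvgCM_at; first exact: (@kfun_cont R D _ u gd u0).
  by apply: cvgCV_at; [exact: sum_neq0|exact: cadd].
have dH u : 0 < complex.Re u -> cdiff H u (H' u).
  move=> u0; have ua := sum_neq0 u (ltW u0).
  have dA := cdiffD (cdiff_id u) (cdiff_cst a u).
  have dV := @cdiffV R (fun v => v + a) u _ ua dA.
  apply: cdiff_eq (cdiffM (kfun_cdiff gd u0) dV) _.
  by rewrite /H' -/k -/k'; move: (k u) (k' u) => p q; field.
have cH' u : 0 < complex.Re u -> H' @ u --> H' u.
  move=> u0; have ua := sum_neq0 u (ltW u0).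
  apply: cvgCB_at; apply: cvgCM_at.
  - exact: (@kfun'_cont R D _ u gd u0).
  - by apply: cvgCV_at; [exact: ua|exact: cadd].
  - exact: (@kfun_cont R D _ u gd (ltW u0)).
  - by apply: cvgCV_at; [rewrite expf_neq0|apply: cvgCX_at; exact: cadd].
have pos u : on_contour (keyhole xi Y) u -> 0 <= complex.Re u.
  by move=> /(keyhole_location xi0 Y0)[].
have av u : on_contour (keyhole xi Y) u -> u - a != 0.
  move=> uP; have := keyhole_avoids reg uP; rewrite -a2 -subr_eq0 subr_sqr mulf_eq0 negb_or.
  by case/andP.
have CS := cauchy_star (keyhole_piece xi0 Y0) (keyhole_closed Y xi0) a0 pos av cH dH cH'.
rewrite keyhole_winding// in CS.
have -> : oint (keyhole xi Y) (fun u => kfun D (enorm x) u / (u ^+ 2 - l)) =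
    oint (keyhole xi Y) (fun u => H u / (u - a)).
  apply: eq_oint => u uP; rewrite /H -/k -a2 subr_sqr invfM.
  by rewrite [in RHS]mulrAC mulrA.
have an : a != 0 by apply: contraTneq a0 => ->; rewrite ltxx.
rewrite CS Ktrans_Kside// /Kside -/a /H -/k.
have pn : ((pi : R)%:C : CC R) != 0 by rewrite -cabs_gt0 cabsR gtr0_norm ?pi_gt0.
have i0 := @i_neq0 R.
have -> : a + a = 2 * a by ring.
by move: (k a) ((pi : R)%:C) pn => p q pn; field; rewrite an pn i0.
Qed.

End cauchy.
End transfer_boundary.

(** * The convolution weights as contour integrals *)

Section omega_as_contour_integral.
Context {R : realType} (s : nat) (A : 'M[R]_s.+1) (b : 'rV[R]_s.+1).
Hypothesis HAstab : forall z : CC R, complex.Re z <= 0 ->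
  (1%:M - z *: Cmx A) \in unitmx /\ `|rk_r A b z| <= 1.
Hypothesis HAinv : A \in unitmx.
Hypothesis Hstiff : b *m invmx A = \row_(j < s.+1) (j == ord_max)%:R.

Definition rk_good (w : CC R) := (1%:M - w *: Cmx A) \in unitmx /\ cabs (rk_r A b w) <= 1.

Lemma rk_eE n (w : CC R) j : rk_e A b n w 0 j = rk_r A b w ^+ n * rk_q A b w 0 j.
Proof. by rewrite /rk_e mxE. Qed.

Lemma rk_good_left (w : CC R) : complex.Re w <= 0 -> rk_good w.
Proof. by move=> /HAstab[h1 h2]; split=> //; move: h2; rewrite normC_cabs lecR. Qed.

Lemma rk_good_far : exists2 rho : R, 0 < rho & forall w, rho <= cabs w -> rk_good w.
Proof.
have [rho [C [r0 C0 H]]] := rk_at_infinity HAinv Hstiff.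
exists (Num.max rho C); first by rewrite lt_max r0.
move=> w; rewrite ge_max => /andP[w1 w2]; have [h1 h2 _] := H w w1.
split=> //; rewrite (le_trans h2)// ler_pdivrMr ?mul1r//.
exact: lt_le_trans w1.
Qed.

Lemma ratfun_cdiff (p d : {poly CC R}) (w : CC R) : d.[w] != 0 ->
  exists e, cdiff (fun v => p.[v] / d.[v]) w e.
Proof. by move=> dw; eexists; exact: cdiffM (cdiff_horner p w) (cdiffV dw (cdiff_horner d w)). Qed.

Lemma horner_neq0_near (d : {poly CC R}) (w : CC R) : d.[w] != 0 -> \forall v \near w, d.[v] != 0.
Proof.
move=> dw; have c := cdiff_cont (cdiff_horner d w).
have d0 : 0 < cabs d.[w] by rewrite cabs_gt0.
have := (proj1 (@cvgCP R _ _ (nbhs_filter w) _ _) c) _ d0; apply: (@filterS _ (nbhs w) (nbhs_filter w)) => v.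
by apply: contraTneq => ->; rewrite subr0 ltxx.
Qed.

Lemma rk_cont (w : CC R) : (1%:M - w *: Cmx A) \in unitmx ->
  (rk_r A b @ w --> rk_r A b w) /\ forall j, (fun v => rk_q A b v 0 j) @ w --> rk_q A b w 0 j.
Proof.
move=> uw; have [d [r [Q H]]] := rk_rational A b.
have unitE v : ((1%:M - v *: Cmx A) \in unitmx) = (d.[v] != 0).
  by rewrite unitmxE unitfE; have [-> _] := H v.
have dw : d.[w] != 0 by rewrite -unitE.
have [e1 D1] := ratfun_cdiff r dw.
split=> [|j].
  suff : cdiff (rk_r A b) w e1 by exact: cdiff_cont.
  apply: (@cdiff_near R (fun v => r.[v] / d.[v])) D1.
  apply: (@filterS _ (nbhs w) (nbhs_filter w)) (horner_neq0_near dw) => v.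
  by rewrite -unitE => uv; have [_ /(_ uv)[-> _]] := H v.
have [e2 D2] := ratfun_cdiff (Q j) dw.
suff : cdiff (fun v => rk_q A b v 0 j) w e2 by exact: cdiff_cont.
apply: (@cdiff_near R (fun v => (Q j).[v] / d.[v])) D2.
apply: (@filterS _ (nbhs w) (nbhs_filter w)) (horner_neq0_near dw) => v.
by rewrite -unitE => uv; have [_ /(_ uv)[_ ->]] := H v.
Qed.

Variables (D : nat) (x : 'rV[R]_D).
Hypothesis HD : (1 <= D <= 3)%N.
Hypothesis Hx : (2 <= D)%N -> x != 0.
Variables (h xi Y : R).
Hypothesis h0 : 0 < h.
Hypothesis xi0 : 0 < xi.
Hypothesis Y0 : 0 < Y.
Hypothesis far : forall w : CC R, h * corner_Re xi Y ^+ 2 <= cabs w -> rk_good w.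

Let P := keyhole xi Y.
Let kf := kfun D (enorm x).
Let okP := keyhole_piece xi0 Y0.

Let hC_neq0 : (h%:C : CC R) != 0.
Proof. by rewrite -cabs_gt0 cabsR normr_gt0 gt_eqF. Qed.

Let cabs_h (w : CC R) : cabs (h%:C * w) = h * cabs w.
Proof. by rewrite cabsM cabsR gtr0_norm. Qed.

Lemma keyhole_good u : on_contour P u -> rk_good (h%:C * u ^+ 2).
Proof.
move=> /(keyhole_location xi0 Y0)[u0 [H|H]].
  apply: rk_good_left; rewrite Re_real_mul pmulr_rle0// expr2 ReM subr_le0 -!expr2.
  by rewrite -[leRHS]real_normK ?num_real// ler_sqr ?nnegrE.
apply: far; rewrite cabs_h ler_pM2l// cabsX -H ler_sqr ?nnegrE ?cabs_ge0//.
by rewrite (le_trans (ler_norm _))// cabs_Re.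
Qed.

Let hsq_cvg (u : CC R) : (fun u : CC R => (h%:C : CC R) * u ^+ 2) @ u --> (h%:C : CC R) * u ^+ 2.
Proof. by apply: cvgCM_at; [exact: cvgC_cst_at|apply: cvgCX_at; exact: cvgC_id_at]. Qed.

Let cont_r : cont_on P (fun u => rk_r A b (h%:C * u ^+ 2)).
Proof.
move=> u uP; apply: (cvgC_comp (nbhs_filter u) (@hsq_cvg u)).
by have [h1 _] := rk_cont (proj1 (keyhole_good uP)).
Qed.

Let cont_q j : cont_on P (fun u => rk_q A b (h%:C * u ^+ 2) 0 j).
Proof.
move=> u uP; apply: (@cvgC_comp R (fun v => rk_q A b v 0 j) _ _ (nbhs_filter u) _ _ _ (@hsq_cvg u)).
by have [_ h1] := rk_cont (proj1 (keyhole_good uP)); exact: h1.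
Qed.

Let cont_kf : cont_on P kf.
Proof.
move=> u uP; apply: (@kfun_cont R D (enorm x) u (good_dim_enorm HD Hx)).
by have [] := keyhole_location xi0 Y0 uP.
Qed.

Lemma contraction_neq1 (zeta r : CC R) : cabs zeta < 1 -> cabs r <= 1 -> zeta * r != 1.
Proof.
move=> z1 r1; apply: contraTneq z1 => E; rewrite -leNgt.
have /(congr1 (@cabs R)) := E; rewrite cabsM cabs1 => <-.
by rewrite ler_piMr ?cabs_ge0.
Qed.

Let zeta_neq1 (zeta : CC R) : cabs zeta < 1 -> zeta != 1.
Proof. by move=> z1; have := @contraction_neq1 zeta 1 z1; rewrite mulr1 cabs1 lexx => ->. Qed.

(** For an eigenvalue [l] outside the half disc, [|r(h l)| <= 1] holds, by A-stability on the left
    and by decay far out; then [zeta r(h l) = 1] is impossible for [|zeta| < 1]. *)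
Lemma rk_Delta_spectrum (zeta l : CC R) : cabs zeta < 1 ->
  root (char_poly ((h%:C)^-1 *: rk_Delta A b zeta)) l -> inner_region xi Y l.
Proof.
move=> z1 rl; pose M := (h%:C)^-1 *: rk_Delta A b zeta.
have bad : ~ rk_good (h%:C * l).
  move=> [U r1]; have U2 := rk_Delta_sub_unit HAinv Hstiff (zeta_neq1 z1) U (contraction_neq1 z1 r1).
  move: rl; rewrite -eigenvalue_root_char => /eigenvalueP[v vE vn].
  move/negP: vn; apply; apply/eqP.
  have : v *m (rk_Delta A b zeta - (h%:C * l)%:M) = 0.
    have -> : rk_Delta A b zeta = h%:C *: M by rewrite scalerA mulfV// scale1r.
    by rewrite mulmxBr -scalemxAr vE mul_mx_scalar scalerA subrr.
  by move=> /(congr1 (mulmxr (invmx (rk_Delta A b zeta - (h%:C * l)%:M)))) /=; rewrite mulmxK// mul0mx.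
split.
  by rewrite ltNge; apply/negP => l0; apply: bad; apply: rk_good_left; rewrite Re_real_mul pmulr_rle0.
rewrite ltNge; apply/negP => l0; apply: bad; apply: far.
by rewrite cabs_h ler_pM2l.
Qed.

Let inner_open : open (inner_region xi Y).
Proof.
rewrite openE => l [l0 l1]; apply/nbhsCP.
exists (Num.min (complex.Re l) (corner_Re xi Y ^+ 2 - cabs l)).
  by rewrite lt_min l0 subr_gt0.
move=> w; rewrite lt_min => /andP[w1 w2]; split.
  have := le_lt_trans (cabs_Re (w - l)) w1; rewrite ReD ReN ltr_norml => /andP[w3 _]; lra.
have := cabsD (w - l) l; rewrite subrK => w3; rewrite (le_lt_trans w3)//; lra.
Qed.

Let c0 : CC R := - (2 * 'i * (pi : R)%:C)^-1.

(** [rk_last_row] at [w = h u^2] supplies the row of [matfun_contour]; the factor [- h] comes from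
    [Delta - h u^2 = - h (u^2 - Delta / h)]. *)
Lemma matfun_resolvent (zeta : CC R) j : cabs zeta < 1 ->
  matfun (fun z => Ktrans z x) ((h%:C)^-1 *: rk_Delta A b zeta) ord_max j =
  (- h%:C * c0) * kernel_seq P (fun u => kf u * rk_q A b (h%:C * u ^+ 2) 0 j) (fun=> 1)
     (fun u => rk_r A b (h%:C * u ^+ 2)) 0 zeta.
Proof.
move=> z1; pose V (u : CC R) : 'rV[CC R]_s.+1 :=
  - h%:C *: ((1 - zeta * rk_r A b (h%:C * u ^+ 2))^-1 *: rk_q A b (h%:C * u ^+ 2)).
pose e : 'rV[CC R]_s.+1 := delta_mx 0 ord_max.
pose M := (h%:C)^-1 *: rk_Delta A b zeta.
have HK l : inner_region xi Y l -> Ktrans l x = c0 * oint P (fun u => kf u / (u ^+ 2 - l)).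
  exact: Ktrans_cauchy.
have HV u : on_contour P u -> V u *m ((u ^+ 2)%:M - M) = e.
  move=> uP; have [U r1] := keyhole_good uP.
  rewrite -[RHS](rk_last_row HAinv Hstiff (zeta_neq1 z1) U (contraction_neq1 z1 r1)).
  have -> : rk_Delta A b zeta - (h%:C * u ^+ 2)%:M = - h%:C *: ((u ^+ 2)%:M - M).
    rewrite scalerBr scalerA mulNr mulfV// scaleN1r opprK scale_scalar_mx mulNr.
    by rewrite raddfN addrC.
  by rewrite /V -[LHS]scalemxAl -[RHS]scalemxAr.
have av l u : inner_region xi Y l -> on_contour P u -> u ^+ 2 != l by exact: keyhole_avoids.
have H := matfun_contour okP inner_open av cont_kf HK j (@rk_Delta_spectrum zeta ^~ z1) HV.
have -> : matfun (fun z => Ktrans z x) M ord_max j = (e *m matfun (fun z => Ktrans z x) M) 0 j.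
  by rewrite -rowE mxE.
rewrite H /kernel_seq fact0 mul1r.
have cP : cont_on P (fun u => kf u * rk_q A b (h%:C * u ^+ 2) 0 j * rk_r A b (h%:C * u ^+ 2) ^+ 0 /
    (1 - rk_r A b (h%:C * u ^+ 2) * zeta) ^+ 1).
  move=> u uP; have [U r1] := keyhole_good uP.
  apply: cvgCM_at.
    apply: cvgCM_at; last by apply: cvgCX_at; exact: (cont_r uP).
    by apply: cvgCM_at; [exact: (cont_kf uP)|exact: (cont_q uP)].
  apply: cvgCV_at.
    by rewrite expr1 subr_eq0 eq_sym mulrC contraction_neq1.
  apply: cvgCX_at; apply: cvgCB_at; first exact: cvgC_cst_at.
  by apply: cvgCM_at; [exact: (cont_r uP)|exact: cvgC_cst_at].
rewrite [- h%:C * c0]mulrC -mulrA -(ointZ okP _ cP); congr (c0 * _).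
apply: eq_oint => u uP; rewrite /V mxE mxE expr0 expr1 mulr1 [zeta * _]mulrC.
by ring.
Qed.

(** As a function of [zeta] the integrand is a multiple of [1 / (1 - zeta r)], with Taylor
    coefficients [r^n]; the factor [n!] in [kernel_seq] is the one that [Wcoef] divides out. The
    signs of [- h] and of the clockwise orientation cancel. *)
Lemma omega_contour n j : omega A b x h n 0 j =
  h%:C / (2 * (pi : R)%:C * 'i) * oint P (fun u => kfun D (enorm x) u * rk_e A b n (h%:C * u ^+ 2) 0 j).
Proof.
pose U : set (CC R) := [set zeta | cabs zeta < 1].
have oU : open U.
  rewrite openE => z z1; apply/nbhsCP; exists (1 - cabs z); first by rewrite subr_gt0.
  move=> w wz; have := cabsD (w - z) z; rewrite subrK => w3.
  by rewrite /U /= (le_lt_trans w3)//; lra.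
pose F k zeta := (- h%:C * c0) * kernel_seq P (fun u => kf u * rk_q A b (h%:C * u ^+ 2) 0 j) (fun=> 1)
     (fun u => rk_r A b (h%:C * u ^+ 2)) k zeta.
have one : cont_on P (fun=> 1) by move=> u _; exact: cvgC_cst_at.
have cphi : cont_on P (fun u => kf u * rk_q A b (h%:C * u ^+ 2) 0 j).
  by move=> u uP; apply: cvgCM_at; [exact: (cont_kf uP)|exact: (cont_q uP)].
have dF k z : U z -> cdiff (F k) z (F k.+1 z).
  move=> Uz; apply: cdiffZ; apply: (@kernel_seq_cdiff R 6 P okP _ _ _ k z cphi one cont_r) => u uP.
  by have [_ r1] := keyhole_good uP; rewrite subr_eq0 eq_sym mulrC contraction_neq1.
have D0 := @derive1n_seq R U (fun zeta => matfun (fun z => Ktrans z x) ((h%:C)^-1 *: rk_Delta A b zeta) ord_max j)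
  F oU (fun z Uz => matfun_resolvent j Uz) dF n 0.
rewrite /omega /Wcoef mxE mxE D0; last by rewrite /U /= cabs0.
have -> : h%:C / (2 * (pi : R)%:C * 'i) = - h%:C * c0 by rewrite /c0 mulrNN; congr (_ / _); ring.
have f0 : ((n`!)%:R : CC R) != 0 by rewrite pnatr_eq0 -lt0n fact_gt0.
rewrite /F /kernel_seq; transitivity (- h%:C * c0 * oint P (fun u => kf u * rk_q A b (h%:C * u ^+ 2) 0 j
   * rk_r A b (h%:C * u ^+ 2) ^+ n / (1 - rk_r A b (h%:C * u ^+ 2) * 0) ^+ n.+1)).
  by move: (oint _ _) c0 (- h%:C) => t c k; field.
congr (_ * _); apply: eq_oint => u _; rewrite mulr0 subr0 expr1n divr1 rk_eE /kf.
by rewrite -mulrA; congr (_ * _); exact: mulrC.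
Qed.

End omega_as_contour_integral.

(** * Improper integrals *)

Section exhaustion.
Context {R : realType}.
Let mu := @lebesgue_measure R.
Implicit Types (g h m M : R -> R) (f : R -> CC R) (B : R).

Section increasing_sets.
Variable F : nat -> set R.
Hypothesis ndF : nondecreasing_seq F.
Hypothesis mF : forall k, measurable (F k : set (measurableTypeR R)).
Let U := \bigcup_k F k.
Let mU : measurable (U : set (measurableTypeR R)).
Proof. exact: bigcup_measurable. Qed.
Let FU k : F k `<=` U. Proof. exact: bigcup_sup. Qed.

Let integrableF h k : mu.-integrable U (EFin \o h) -> mu.-integrable (F k) (EFin \o h).
Proof. by move=> ih; exact: (integrableS mU (mF k) (@FU k) ih). Qed.

Lemma ge0_exhaust h : (forall s, 0 <= h s) -> mu.-integrable U (EFin \o h) ->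
  (fun k => \int[mu]_(s in F k) h s) @ \oo --> \int[mu]_(s in U) h s.
Proof.
move=> h0 ih; apply: fine_cvg; rewrite fineK; last exact: integrable_fin_num.
apply: ge0_nondecreasing_set_cvg_integral => // k.
  exact: (measurable_int _ (integrableF k ih)).
by move=> s _; rewrite lee_fin.
Qed.

Lemma exhaust_integrable g B : (forall k, mu.-integrable (F k) (EFin \o g)) ->
  (forall k, (\int[mu]_(s in F k) `|g s|%:E <= B%:E)%E) -> mu.-integrable U (EFin \o g).
Proof.
move=> ig gB; apply/integrableP; split => /=.
  by apply/(measurable_fun_bigcup _ mF) => k; exact: (measurable_int _ (ig k)).
have C : ((\int[mu]_(s in F i) `|g s|%:E) @[i --> \oo] --> \int[mu]_(s in U) `|g s|%:E)%E.
  apply: ge0_nondecreasing_set_cvg_integral => // k.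
  exact: (measurable_int _ (integrable_abse (ig k))).
apply: (@le_lt_trans _ _ B%:E); last exact: ltry.
rewrite -(cvg_lim _ C)//; apply: lime_le; first by apply/cvg_ex; eexists; exact: C.
by apply: nearW => k; exact: gB.
Qed.

(* Splitting [g] as [(|g| + g) - |g|] reduces to monotone convergence. *)
Lemma exhaust_cvg g : mu.-integrable U (EFin \o g) ->
  (fun k => \int[mu]_(s in F k) g s) @ \oo --> \int[mu]_(s in U) g s.
Proof.
move=> ig; have ia : mu.-integrable U (EFin \o (fun s => `|g s|)).
  by have := integrable_abse ig.
have iS : mu.-integrable U (EFin \o (fun s => `|g s| + g s)).
  by apply: (eq_integrable mU _ _ _ (integrableD mU ia ig)) => s _; rewrite /= EFinD.
have a0 s : 0 <= `|g s| by [].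
have s0 s : 0 <= `|g s| + g s.
  by have := ler_norm (- g s); rewrite normrN; lra.
have eI (E : set R) : measurable (E : set (measurableTypeR R)) -> 
   mu.-integrable E (EFin \o (fun s => `|g s|)) -> mu.-integrable E (EFin \o (fun s => `|g s| + g s)) ->
   \int[mu]_(s in E) g s = \int[mu]_(s in E) (`|g s| + g s) - \int[mu]_(s in E) `|g s|.
  move=> mE i1 i2; rewrite -RintegralB//; apply: eq_Rintegral => s _ /=; ring.
have H := cvgB (ge0_exhaust s0 iS) (ge0_exhaust a0 ia).
rewrite (eI U mU ia iS).
suff -> : (fun k => \int[mu]_(s in F k) g s) =
  (fun k => \int[mu]_(s in F k) (`|g s| + g s) - \int[mu]_(s in F k) `|g s|) by exact: H.
by apply/funext => k; apply: eI => //; exact: integrableF.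
Qed.

End increasing_sets.

Lemma int_abs_le_primitive (a b : R) g m M : a <= b ->
  (forall s, a <= s <= b -> is_derive s (1 : R) M (m s)) ->
  (forall s, a <= s <= b -> m @ s --> m s) ->
  mu.-integrable `[a, b] (EFin \o g) ->
  (forall s, a <= s <= b -> `|g s| <= m s) ->
  (\int[mu]_(s in `[a, b]) `|g s|%:E <= (M b - M a)%:E)%E.
Proof.
move=> ab dM cm ig gm.
have cmC : pcont a b (fun s => (m s)%:C) by move=> s /cm H; exact: cvg_real.
have [im _] := pcont_integrable cmC.
have E : \int[mu]_(s in `[a, b]) m s = M b - M a.
  have /(congr1 (@complex.Re R)) := cint_FTC (F := fun s => (M s)%:C) ab cmC
    (fun s sab => pder_real (dM s sab)).
  by rewrite ReD ReN.
rewrite -E fineK; last exact: integrable_fin_num.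
apply: ge0_le_integral => //.
- exact: (measurable_int _ (integrable_abse ig)).
- by have /integrableP[] := im.
Qed.

(** The majorant [m] comes with a primitive [M], so a bound on the increments of [M] gives
    integrability over the union without integrating [m] there. *)
Lemma cint_exhaust (a b : nat -> R) f m M B :
  (forall k, a k <= b k) -> nondecreasing_seq (fun k => `[a k, b k]%classic) ->
  (forall k, pcont (a k) (b k) f) ->
  (forall k s, a k <= s <= b k -> is_derive s (1 : R) M (m s)) ->
  (forall k s, a k <= s <= b k -> m @ s --> m s) ->
  (forall k s, a k <= s <= b k -> cabs (f s) <= m s) ->
  (forall k, M (b k) - M (a k) <= B) ->
  let U := \bigcup_k `[a k, b k]%classic in
  cintegrable U f /\ (fun k => cint `[a k, b k] f) @ \oo --> cint U f.
Proof.
move=> ab nd cf dM cm fm MB U.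
have mF k : measurable (`[a k, b k]%classic : set (measurableTypeR R)) by exact: measurable_itv.
have key (p : CC R -> R) : (forall z, `|p z| <= cabs z) ->
  (forall k, mu.-integrable `[a k, b k] (EFin \o (fun s => p (f s)))) ->
  mu.-integrable U (EFin \o (fun s => p (f s))).
  move=> pc ip; apply: (@exhaust_integrable _ nd mF _ B ip) => k.
  apply: (@le_trans _ _ (M (b k) - M (a k))%:E); last by rewrite lee_fin.
  apply: (int_abs_le_primitive (ab k) (dM k) (cm k) (ip k)) => s sk.
  exact: le_trans (pc _) (fm k s sk).
have fi k := pcont_integrable (cf k).
have I1 := key _ (@cabs_Re R) (fun k => proj1 (fi k)).
have I2 := key _ (@cabs_Im R) (fun k => proj2 (fi k)).
split; first by split.
apply/(@cvgC_ReIm R _ _ _); split => /=; exact: (exhaust_cvg nd mF).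
Qed.

End exhaustion.

(** * Reflection and square root substitution *)

Section change_of_variables.
Context {R : realType}.
Let mu := @lebesgue_measure R.
Implicit Types (f g G : R -> CC R) (a b c e s : R).

Lemma cint_opp c g : 0 <= c -> pcont (- c) 0 g ->
  cint `[- c, 0] g = cint `[0, c] (fun s => g (- s)).
Proof.
move=> c0 cg; have key (p : R -> R) : (forall s, - c <= s <= 0 -> p @ s --> p s) ->
    \int[mu]_(s in `[- c, 0]) p s = \int[mu]_(s in `[0, c]) p (- s).
  move=> cp; have H := @integration_by_substitution_oppr R p 0 c c0.
  rewrite oppr0 in H; rewrite /Rintegral H//.
  by apply: continuous_in_subspaceT => s /set_mem /=; rewrite in_itv /=; exact: cp.
by apply: complexP; apply: key => s /cg; [exact: cvg_Re|exact: cvg_Im].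
Qed.

(** The pull-back of [G(t) dt] under [t = sqrt l]; for bounded [G] its singularity at [0] is
    integrable. *)
Definition sqrt_pullback G (l : R) : CC R := G (Num.sqrt l) * ((2 * Num.sqrt l)^-1)%:C.

Lemma sqrt_pullback_cont G (l : R) : 0 < l -> G @ Num.sqrt l --> G (Num.sqrt l) ->
  sqrt_pullback G @ l --> sqrt_pullback G l.
Proof.
move=> l0 cG; have s0 : 0 < Num.sqrt l by rewrite sqrtr_gt0.
have cs : (@Num.sqrt R) @ l --> Num.sqrt l by exact: sqrt_continuous.
apply: cvgCM; first exact: cvg_comp cs cG.
apply: cvg_real; apply: cvgV; first by rewrite gt_eqF// mulr_gt0.
by apply: cvgM; [exact: cvg_cst|exact: cs].
Qed.

Let sqrt_bounds a b l : 0 < a -> a <= l <= b ->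
  0 < l /\ Num.sqrt a <= Num.sqrt l <= Num.sqrt b.
Proof.
move=> a0 /andP[al lb]; have l0 := lt_le_trans a0 al; split=> //.
by rewrite !ler_wsqrtr.
Qed.

Lemma sqrt_pullback_pcont a b G : 0 < a -> pcont (Num.sqrt a) (Num.sqrt b) G -> pcont a b (sqrt_pullback G).
Proof.
by move=> a0 cG l lab; have [l0 sl] := sqrt_bounds a0 lab; apply: sqrt_pullback_cont => //; exact: cG.
Qed.

Lemma cint_sqr_subst a b G : 0 < a -> a <= b -> pcont (Num.sqrt a) (Num.sqrt b) G ->
  cint `[a, b] (sqrt_pullback G) = cint `[Num.sqrt a, Num.sqrt b] G.
Proof.
move=> a0 ab cG; have b0 : 0 < b := lt_le_trans a0 ab.
have sa0 : 0 < Num.sqrt a by rewrite sqrtr_gt0.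
have sab : Num.sqrt a <= Num.sqrt b by rewrite ler_wsqrtr.
pose F (s : R) := s ^+ 2.
have dF s : is_derive s (1 : R) F (2 * s).
  apply: is_derive_eq (is_deriveX 2 (is_derive_id s (1 : R))) _.
  by rewrite /GRing.scale /= expr1 mulr1.
have F'E : derive1 F = (fun s : R => 2 * s) by apply/funext => s; rewrite derive1E; have [_ ->] := dF s.
have cF' s : (fun s : R => 2 * s) @ s --> 2 * s by apply: cvgM; [exact: cvg_cst|exact: cvg_id].
have cF s : F @ s --> F s by apply: cvgM; exact: cvg_id.
have Fa : F (Num.sqrt a) = a by rewrite /F sqr_sqrtr// ltW.
have Fb : F (Num.sqrt b) = b by rewrite /F sqr_sqrtr// ltW.
have cP := sqrt_pullback_pcont a0 cG.
have key (p : CC R -> R) : (forall z (r : R), p (z * r%:C) = p z * r) ->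
    (forall s, a <= s <= b -> (fun s => p (sqrt_pullback G s)) @ s --> p (sqrt_pullback G s)) ->
    \int[mu]_(s in `[a, b]) p (sqrt_pullback G s) = \int[mu]_(s in `[Num.sqrt a, Num.sqrt b]) p (G s).
  move=> pz cp.
  have H := @integration_by_substitution_increasing R F (fun s => p (sqrt_pullback G s)) _ _ sab.
  rewrite Fa Fb F'E in H; rewrite /Rintegral H.
  - congr fine; apply: eq_integral => s /set_mem /=; rewrite in_itv /= => /andP[s1 s2].
    have s0 : 0 < s by rewrite (lt_le_trans sa0).
    transitivity ((p (sqrt_pullback G (F s)) * (2 * s))%:E); first by [].
    congr EFin; rewrite /sqrt_pullback /F sqrtr_sqr gtr0_norm// pz -mulrA mulVf ?mulr1//.
    by rewrite gt_eqF// mulr_gt0.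
  - move=> s t; rewrite !in_itv /= => /andP[s1 _] /andP[t1 _] st.
    by rewrite /F ltr_sqr ?nnegrE// ltW// (lt_le_trans sa0).
  - by move=> s _; exact: cF'.
  - by apply/cvg_ex; eexists; apply: cvg_at_right_filter; exact: cF'.
  - by apply/cvg_ex; eexists; apply: cvg_at_left_filter; exact: cF'.
  - split.
    + by move=> s _; have [] := dF s.
    + by apply: cvg_at_right_filter; exact: cF.
    + by apply: cvg_at_left_filter; exact: cF.
  - by apply: continuous_in_subspaceT => s /set_mem /=; rewrite in_itv /=; exact: cp.
apply: complexP; apply: key.
- by move=> z r; rewrite ReM /= mulr0 subr0.
- by move=> s /cP; exact: cvg_Re.
- by move=> z r; rewrite ImM /= mulr0 add0r.
- by move=> s /cP; exact: cvg_Im.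
Qed.

Let shrink c k : R := c / k.+1%:R.

Let shrink_gt0 c k : 0 < c -> 0 < shrink c k.
Proof. by move=> c0; rewrite divr_gt0. Qed.

Let shrink_le c k : 0 < c -> shrink c k <= c.
Proof. by move=> c0; rewrite ler_pdivrMr// ler_peMr ?ler1n// ltW. Qed.

Let shrink_nd c : 0 < c -> nondecreasing_seq (fun k => `[shrink c k, c]%classic).
Proof.
move=> c0 i j ij; rewrite subsetEset => s; rewrite /= !in_itv /= => /andP[si ->].
rewrite andbT (le_trans _ si)// /shrink ler_pM2l// lef_pV2 ?posrE// ler_nat.
by rewrite ltnS.
Qed.

Let shrink_cup c : 0 < c -> \bigcup_k `[shrink c k, c]%classic = `]0, c]%classic.
Proof.
move=> c0; apply/seteqP; split=> s /=.
  by move=> [k _]; rewrite /= !in_itv /= => /andP[sk ->]; rewrite (lt_le_trans _ sk)// shrink_gt0.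
rewrite in_itv /= => /andP[s0 sc]; exists (Num.Def.truncn (c / s)) => //=.
rewrite in_itv /= sc andbT /shrink ler_pdivrMr// mulrC -ler_pdivrMr//.
by rewrite ltW// Num.Theory.truncnS_gt.
Qed.

(** The substitution is carried out on [[c / (k + 1), c]], away from its singular point. Both sides
    then converge, the left one by the majorant [M0 / (2 sqrt l)], whose primitive [M0 sqrt l] is
    bounded. *)
Lemma cint_sqrt_pullback c G : 0 < c -> pcont 0 (Num.sqrt c) G ->
  cintegrable `]0, c] (sqrt_pullback G) /\ cint `]0, c] (sqrt_pullback G) = cint `[0, Num.sqrt c] G.
Proof.
move=> c0 cG; have sc0 : 0 < Num.sqrt c by rewrite sqrtr_gt0.
have [M0 M00 HM] := pcont_bound cG.
have sub k : pcont (Num.sqrt (shrink c k)) (Num.sqrt c) G.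
  by move=> s /andP[s1 s2]; apply: cG; rewrite s2 (le_trans _ s1)// sqrtr_ge0.
have [I1 L1] : cintegrable (\bigcup_k `[shrink c k, c]%classic) (sqrt_pullback G) /\
    (fun k => cint `[shrink c k, c] (sqrt_pullback G)) @ \oo --> cint (\bigcup_k `[shrink c k, c]%classic) (sqrt_pullback G).
  apply: (@cint_exhaust R (shrink c) (fun=> c) (sqrt_pullback G) (fun l => M0 * (2 * Num.sqrt l)^-1)
     (fun l => M0 * Num.sqrt l) (M0 * Num.sqrt c)).
  - by move=> k; exact: shrink_le.
  - exact: shrink_nd.
  - by move=> k; apply: sqrt_pullback_pcont; [exact: shrink_gt0|exact: sub].
  - move=> k l lk; have [l0 _] := sqrt_bounds (shrink_gt0 k c0) lk.
    by apply: is_derive_eq (is_deriveZ M0 (is_derive1_sqrt l0)) _.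
  - move=> k l lk; have [l0 _] := sqrt_bounds (shrink_gt0 k c0) lk.
    apply: cvgM; first exact: cvg_cst.
    apply: cvgV; first by rewrite gt_eqF// mulr_gt0// sqrtr_gt0.
    by apply: cvgM; [exact: cvg_cst|exact: sqrt_continuous].
  - move=> k l lk; have [l0 /andP[l1 l2]] := sqrt_bounds (shrink_gt0 k c0) lk.
    have p0 : 0 < (2 * Num.sqrt l)^-1 by rewrite invr_gt0 mulr_gt0// sqrtr_gt0.
    rewrite /sqrt_pullback cabsM cabsR gtr0_norm//; apply: ler_wpM2r; first exact: ltW.
    by apply: HM; rewrite sqrtr_ge0.
  - by move=> k; rewrite gerBl mulr_ge0 ?sqrtr_ge0// ltW.
have nds : nondecreasing_seq (fun k => `[Num.sqrt (shrink c k), Num.sqrt c]%classic).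
  move=> i j ij; rewrite subsetEset => s; rewrite /= !in_itv /= => /andP[si ->].
  rewrite andbT (le_trans _ si)// ler_wsqrtr//.
  rewrite /shrink ler_pM2l// lef_pV2 ?posrE// ler_nat.
  by rewrite ltnS.
have [I2 L2] : cintegrable (\bigcup_k `[Num.sqrt (shrink c k), Num.sqrt c]%classic) G /\
    (fun k => cint `[Num.sqrt (shrink c k), Num.sqrt c] G) @ \oo -->
       cint (\bigcup_k `[Num.sqrt (shrink c k), Num.sqrt c]%classic) G.
  apply: (@cint_exhaust R (fun k => Num.sqrt (shrink c k)) (fun=> Num.sqrt c) G (fun=> M0)
     (fun l => M0 * l) (M0 * Num.sqrt c)).
  - by move=> k; rewrite ler_wsqrtr// shrink_le.
  - exact: nds.
  - exact: sub.
  - move=> k l _; apply: is_derive_eq (is_deriveZ M0 (is_derive_id l (1 : R))) _.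
    by rewrite /GRing.scale /= mulr1.
  - by move=> k l _; exact: cvg_cst.
  - by move=> k l /andP[l1 l2]; apply: HM; rewrite l2 (le_trans _ l1)// sqrtr_ge0.
  - by move=> k; rewrite gerBl mulr_ge0 ?sqrtr_ge0// ltW.
have cupS : \bigcup_k `[Num.sqrt (shrink c k), Num.sqrt c]%classic = `]0, Num.sqrt c]%classic.
  apply/seteqP; split=> s /=.
    move=> [k _]; rewrite /= !in_itv /= => /andP[sk ->]; rewrite (lt_le_trans _ sk)//.
    by rewrite sqrtr_gt0 shrink_gt0.
  rewrite in_itv /= => /andP[s0 sc].
  have : `]0, c]%classic (s ^+ 2).
    rewrite /= in_itv /= exprn_gt0//=.
    apply: (@le_trans _ _ (Num.sqrt c ^+ 2)); last by rewrite sqr_sqrtr// ltW.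
    by rewrite ler_sqr ?nnegrE ?sqrtr_ge0// ltW.
  rewrite -shrink_cup// => -[k _]; rewrite /= in_itv /= => /andP[h1 h2].
  by exists k => //=; rewrite in_itv /= sc andbT -[leRHS]gtr0_norm// -sqrtr_sqr ler_wsqrtr.
rewrite shrink_cup// in I1 L1; rewrite cupS in I2 L2; split=> //.
have E k : cint `[shrink c k, c] (sqrt_pullback G) = cint `[Num.sqrt (shrink c k), Num.sqrt c] G.
  by apply: cint_sqr_subst; [exact: shrink_gt0|exact: shrink_le|exact: sub].
have {}L1 : (fun k => cint `[Num.sqrt (shrink c k), Num.sqrt c] G) @ \oo --> cint `]0, c] (sqrt_pullback G).
  by under eq_fun do rewrite -E; exact: L1.
rewrite (cvg_unique (@norm_hausdorff _ (CC R)) L1 L2).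
by case: I2 => i1 i2; apply: complexP => /=; apply: Rintegral_itv_obnd_cbnd.
Qed.

End change_of_variables.

(** * Integrals over half lines and over the whole line *)

Section whole_line.
Context {R : realType}.
Let mu := @lebesgue_measure R.
Implicit Types (f : R -> CC R).

(** The weight [(1 + s)^(-3/2)] replaces [s^(-3/2)], which is not integrable at [0]; its primitive
    is [- 2 (1 + s)^(-1/2)]. *)
Let w (s : R) : R := ((1 + s) * Num.sqrt (1 + s))^-1.

Lemma decay_bound f (C S0 : R) : 0 < C -> 1 <= S0 -> (forall k, pcont 0 k f) ->
  (forall s, S0 <= s -> cabs (f s) <= C / (s * Num.sqrt s)) ->
  exists2 K : R, 0 < K & forall s, 0 <= s -> cabs (f s) <= K * w s.
Proof.
move=> C0 S1 cf fC; have S00 : 0 < S0 by rewrite (lt_le_trans _ S1).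
have [M M0 HM] := pcont_bound (cf S0).
have pos (s : R) : 0 <= s -> 0 < (1 + s) * Num.sqrt (1 + s).
  by move=> s0; have s1 : 0 < 1 + s by [rewrite ltr_wpDr]; rewrite mulr_gt0// sqrtr_gt0.
(* The first summand serves for [S0 <= s], where [(1 + s)^(3/2) <= 4 s^(3/2)]; the second covers
   [[0, S0]] by compactness. *)
exists (4 * C + M * ((1 + S0) * Num.sqrt (1 + S0))).
  by apply: addr_gt0; [exact: mulr_gt0|apply: mulr_gt0 => //; exact: pos (ltW S00)].
move=> s s0; have p := pos s s0; have pS := pos S0 (ltW S00).
rewrite /w ler_pdivlMr//; have [sS|Ss] := leP S0 s.
  have sp : 0 < s by rewrite (lt_le_trans S00).
  have q0 : 0 < s * Num.sqrt s by rewrite mulr_gt0// sqrtr_gt0.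
  have B : (1 + s) * Num.sqrt (1 + s) <= 4 * (s * Num.sqrt s).
    have s1 : 1 <= s by rewrite (le_trans S1).
    have h1 : 1 + s <= 2 * s by lra.
    have h2 : Num.sqrt (1 + s) <= 2 * Num.sqrt s.
      have -> : 2 * Num.sqrt s = Num.sqrt (4 * s).
        have -> : (4 : R) = 2 ^+ 2 by ring.
        by rewrite sqrtrM ?sqr_ge0// sqrtr_sqr ger0_norm.
      by rewrite ler_wsqrtr//; lra.
    have -> : 4 * (s * Num.sqrt s) = 2 * s * (2 * Num.sqrt s) by ring.
    by apply: ler_pM => //; rewrite ?sqrtr_ge0 ?addr_ge0.
  apply: (@le_trans _ _ (C / (s * Num.sqrt s) * (4 * (s * Num.sqrt s)))).
    by apply: ler_pM => //; [exact: cabs_ge0|exact: ltW|exact: fC].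
  have -> : C / (s * Num.sqrt s) * (4 * (s * Num.sqrt s)) = 4 * C.
    by move: (s * _) q0 => q q0; field; rewrite gt_eqF.
  by rewrite lerDl mulr_ge0// ltW.
apply: (@le_trans _ _ (M * ((1 + S0) * Num.sqrt (1 + S0)))).
  apply: ler_pM; [exact: cabs_ge0|exact: ltW|by apply: HM; rewrite s0 ltW|].
  by apply: ler_pM; rewrite ?sqrtr_ge0 ?addr_ge0 ?lerD2l ?ler_wsqrtr ?lerD2l// ltW.
by rewrite lerDr mulr_ge0// ltW.
Qed.

Let der_w (s : R) : 0 <= s -> is_derive s (1 : R) (fun s => - (2 * (Num.sqrt (1 + s))^-1)) (w s).
Proof.
move=> s0; have s1 : 0 < 1 + s by rewrite ltr_wpDr.
have q0 : 0 < Num.sqrt (1 + s) by rewrite sqrtr_gt0.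
have d1 : is_derive s (1 : R) (fun s : R => 1 + s) 1.
  apply/is_deriveP => e e0; exists 1 => // k _.
  by have -> : 1 + (s + k) - (1 + s) - 1 * k = 0 by [ring]; rewrite normr0 mulr_ge0// ltW.
have d2 : is_derive s (1 : R) (fun s : R => Num.sqrt (1 + s)) ((2 * Num.sqrt (1 + s))^-1).
  by have := is_derive1_comp (is_derive1_sqrt s1) d1; rewrite mulr1.
have d3 := @is_deriveV R (fun s => Num.sqrt (1 + s)) s _ _ (lt0r_neq0 q0) d2.
apply: is_derive_eq (is_deriveN (is_deriveZ 2 d3)) _.
rewrite /GRing.scale /= /w -[X in _ = ((X) * _)^-1](sqr_sqrtr (ltW s1)).
by move: (Num.sqrt _) q0 => q q0; field; rewrite gt_eqF.
Qed.

Let cvg_w (s : R) : 0 <= s -> w @ s --> w s.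
Proof.
move=> s0; have s1 : 0 < 1 + s by rewrite ltr_wpDr.
have q0 : 0 < Num.sqrt (1 + s) by rewrite sqrtr_gt0.
have c1 : (fun s : R => 1 + s) @ s --> 1 + s by apply: cvgD; [exact: cvg_cst|exact: cvg_id].
apply: cvgV; first by rewrite gt_eqF// mulr_gt0.
apply: cvgM; first exact: c1.
by apply: (@cvg_cont_comp R _ _ (nbhs_filter s) (@Num.sqrt R) _ _ c1); exact: sqrt_continuous.
Qed.

Lemma cint_halfline_pos f K : 0 < K -> (forall k, pcont 0 k f) ->
  (forall s, 0 <= s -> cabs (f s) <= K * w s) ->
  cintegrable `[0, +oo[ f /\ (fun k => cint `[0, k.+1%:R] f) @ \oo --> cint `[0, +oo[ f.
Proof.
move=> K0 cf fK.
have <- : \bigcup_k `[0 : R, k.+1%:R]%classic = `[0, +oo[%classic.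
  apply/seteqP; split=> s /=; first by move=> [k _]; rewrite /= !in_itv /= => /andP[-> _].
  rewrite in_itv /= andbT => s0; exists (Num.Def.truncn s) => //=.
  by rewrite in_itv /= s0 ltW// Num.Theory.truncnS_gt.
apply: (@cint_exhaust R (fun=> 0) (fun k => k.+1%:R) f (fun s => K * w s)
   (fun s => K * - (2 * (Num.sqrt (1 + s))^-1)) (K * 2)).
- by [].
- move=> i j ij; rewrite subsetEset => s; rewrite /= !in_itv /= => /andP[-> si].
  by rewrite (le_trans si)// ler_nat ltnS.
- by move=> k; exact: cf.
- by move=> k s /andP[s0 _]; exact: is_deriveZ (der_w s0).
- by move=> k s /andP[s0 _]; apply: cvgM; [exact: cvg_cst|exact: cvg_w].
- by move=> k s /andP[s0 _]; exact: fK.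
- move=> k; rewrite addr0 sqrtr1 invr1 mulr1 -mulrBr opprK ler_pM2l// gerDr oppr_le0.
  by rewrite mulr_ge0// invr_ge0 sqrtr_ge0.
Qed.

Lemma cint_halfline_neg f K : 0 < K -> (forall k, pcont k 0 f) ->
  (forall s, s <= 0 -> cabs (f s) <= K * w (- s)) ->
  cintegrable `]-oo, 0] f /\ (fun k => cint `[- k.+1%:R, 0] f) @ \oo --> cint `]-oo, 0] f.
Proof.
move=> K0 cf fK.
have <- : \bigcup_k `[- k.+1%:R, 0 : R]%classic = `]-oo, 0]%classic.
  apply/seteqP; split=> s /=; first by move=> [k _]; rewrite /= !in_itv /= => /andP[_ ->].
  rewrite in_itv /= => s0; exists (Num.Def.truncn (- s)) => //=.
  by rewrite in_itv /= s0 andbT lerNl ltW// Num.Theory.truncnS_gt.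
have cN (s : R) : (fun s : R => - s) @ s --> - s by apply: cvgN; exact: cvg_id.
apply: (@cint_exhaust R (fun k => - k.+1%:R) (fun=> 0) f (fun s => K * w (- s))
   (fun s => K * (2 * (Num.sqrt (1 - s))^-1)) (K * 2)).
- by move=> k; rewrite oppr_le0.
- move=> i j ij; rewrite subsetEset => s; rewrite /= !in_itv /= => /andP[si ->].
  by rewrite andbT (le_trans _ si)// lerN2 ler_nat ltnS.
- by move=> k; exact: cf.
- move=> k s /andP[_ s0]; have s0' : 0 <= - s by rewrite oppr_ge0.
  have h := is_derive1_comp (der_w s0') (is_deriveN (is_derive_id s (1 : R))).
  have -> : (fun s : R => K * (2 * (Num.sqrt (1 - s))^-1)) = (fun s => - K * - (2 * (Num.sqrt (1 + - s))^-1)).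
    by apply/funext => t; rewrite mulrNN.
  have h2 : is_derive s (1 : R) (fun s : R => - K * - (2 * (Num.sqrt (1 + - s))^-1)) (- K * (w (- s) * -1)).
    exact: is_deriveZ h.
  by apply: is_derive_eq h2 _; ring.
- move=> k s /andP[_ s0]; have s0' : 0 <= - s by rewrite oppr_ge0.
  apply: cvgM; first exact: cvg_cst.
  exact: cvg_comp (cN s) (cvg_w s0').
- by move=> k s /andP[_ s0]; exact: fK.
- move=> k; rewrite subr0 sqrtr1 invr1 mulr1 gerBl.
  by rewrite mulr_ge0 ?(ltW K0)// mulr_ge0// invr_ge0 sqrtr_ge0.
Qed.

(** The two integrands may disagree at [0], where [f] follows [fp]; the closed end of the lower half
    line is dropped as a null set. *)
Lemma cint_setT_glue (f fp fn : R -> CC R) :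
  cintegrable `[0, +oo[ fp -> cintegrable `]-oo, 0] fn ->
  (forall s, 0 <= s -> f s = fp s) -> (forall s, s < 0 -> f s = fn s) ->
  cintegrable setT f /\ cint setT f = cint `[0, +oo[ fp + cint `]-oo, 0] fn.
Proof.
move=> [p1 p2] [n1 n2] fp_eq fn_eq.
pose A : set R := `[0, +oo[%classic; pose B : set R := `]-oo, 0[%classic.
have mA : measurable (A : set (measurableTypeR R)) by exact: measurable_itv.
have mB : measurable (B : set (measurableTypeR R)) by exact: measurable_itv.
have AB : A `|` B = setT.
  apply/seteqP; split=> // s _; rewrite /A /B /= !in_itv /= andbT.
  by have [|] := leP 0 s; [left|right].
have dAB : [disjoint A & B].
  apply/disj_setPS => s [] /=; rewrite /A /B /= !in_itv /= andbT => s0 s1.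
  by move: (lt_le_trans s1 s0); rewrite ltxx.
have BsubN : B `<=` `]-oo, 0]%classic by move=> s; rewrite /B /= !in_itv /=; exact: ltW.
have key (u up un : R -> R) : mu.-integrable `[0, +oo[ (EFin \o up) ->
   mu.-integrable `]-oo, 0] (EFin \o un) ->
   (forall s, 0 <= s -> u s = up s) -> (forall s, s < 0 -> u s = un s) ->
   mu.-integrable setT (EFin \o u) /\
   \int[mu]_(s in setT) u s = \int[mu]_(s in `[0, +oo[) up s + \int[mu]_(s in `]-oo, 0]) un s.
  move=> ip inn eqp eqn.
  have iB : mu.-integrable B (EFin \o un) by apply: (integrableS _ mB BsubN inn); exact: measurable_itv.
  have iuA : mu.-integrable A (EFin \o u).
    apply: (eq_integrable mA _ _ _ ip) => s /set_mem; rewrite /A /= in_itv /= andbT => s0.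
    by rewrite eqp.
  have iuB : mu.-integrable B (EFin \o u).
    apply: (eq_integrable mB _ _ _ iB) => s /set_mem; rewrite /B /= in_itv /= => s0.
    by rewrite eqn.
  have iT : mu.-integrable setT (EFin \o u).
    rewrite -AB; apply/integrableP; split.
      by apply/measurable_funU => //; split; [exact: (measurable_int _ iuA)|exact: (measurable_int _ iuB)].
    rewrite ge0_integral_setU//=.
    - by apply: lte_add_pinfty; [have /integrableP[] := iuA|have /integrableP[] := iuB].
    - by apply/measurable_funU => //; split;
        [exact: (measurable_int _ (integrable_abse iuA))|exact: (measurable_int _ (integrable_abse iuB))].
  split=> //; rewrite -[in LHS]AB Rintegral_setU//; last by rewrite AB.
  congr (_ + _).
    by apply: eq_Rintegral => s /set_mem; rewrite /A /= in_itv /= andbT; exact: eqp.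
  rewrite -Rintegral_itv_bndo_bndc//.
  by apply: eq_Rintegral => s /set_mem; rewrite /B /= in_itv /=; exact: eqn.
have [k1 k2] := key _ _ _ p1 n1 (fun s s0 => congr1 (@complex.Re R) (fp_eq s s0))
  (fun s s0 => congr1 (@complex.Re R) (fn_eq s s0)).
have [k3 k4] := key _ _ _ p2 n2 (fun s s0 => congr1 (@complex.Im R) (fp_eq s s0))
  (fun s s0 => congr1 (@complex.Im R) (fn_eq s s0)).
split; first by split.
by apply: complexP; rewrite ?ReD ?ImD /=.
Qed.

End whole_line.

(** * Passage to the limit *)

Section integral_formula.
Context {R : realType} (s : nat) (A : 'M[R]_s.+1) (b : 'rV[R]_s.+1).
Hypothesis HAstab : forall z : CC R, complex.Re z <= 0 ->
  (1%:M - z *: Cmx A) \in unitmx /\ `|rk_r A b z| <= 1.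
Hypothesis HAinv : A \in unitmx.
Hypothesis Hstiff : b *m invmx A = \row_(j < s.+1) (j == ord_max)%:R.
Variables (D : nat) (x : 'rV[R]_D).
Hypothesis HD : (1 <= D <= 3)%N.
Hypothesis Hx : (2 <= D)%N -> x != 0.
Variables (h xi : R) (n : nat) (j : 'I_s.+1).
Hypothesis h0 : 0 < h.
Hypothesis xi0 : 0 < xi.
Hypothesis n1 : (1 <= n)%N.
Implicit Types (u : CC R) (y t : R).

Let Ej u := kfun D (enorm x) u * rk_e A b n (h%:C * u ^+ 2) 0 j.
Let gd := good_dim_enorm HD Hx.

Let Ej_cont u : 0 <= complex.Re u -> (1%:M - (h%:C * u ^+ 2) *: Cmx A) \in unitmx -> Ej @ u --> Ej u.
Proof.
move=> u0 U; have [c1 c2] := rk_cont b U.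
have hc : (fun v : CC R => (h%:C : CC R) * v ^+ 2) @ u --> (h%:C : CC R) * u ^+ 2.
  by apply: cvgCM_at; [exact: cvgC_cst_at|apply: cvgCX_at; exact: cvgC_id_at].
have c3 := @cvgC_comp R _ _ _ (nbhs_filter u) _ _ _ hc c1.
have c4 := @cvgC_comp R (fun v => rk_q A b v 0 j) _ _ (nbhs_filter u) _ _ _ hc (c2 j).
have -> : Ej = fun u => kfun D (enorm x) u * (rk_r A b (h%:C * u ^+ 2) ^+ n * rk_q A b (h%:C * u ^+ 2) 0 j).
  by apply/funext => v; rewrite /Ej rk_eE.
apply: cvgCM_at; first exact: (@kfun_cont R D _ u gd u0).
by apply: cvgCM_at; [apply: cvgCX_at; exact: c3|exact: c4].
Qed.

Let Ej_left u : 0 <= complex.Re u -> complex.Re (u ^+ 2) <= 0 -> Ej @ u --> Ej u.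
Proof.
move=> u0 u2; apply: Ej_cont => //.
by have [] := HAstab (_ : complex.Re (h%:C * u ^+ 2) <= 0); rewrite ?Re_real_mul ?pmulr_rle0.
Qed.

(** [kfun] is [O(|u|^2)]. Far out [|r| <= 1], so [1 <= n] gives [|r|^n <= |r| = O(1 / |w|)], and
    [q = O(1 / |w|)] with [w = h u^2]; together these two give [O(|u|^-4)]. *)
Let Ej_bound : exists C rho : R, [/\ 0 < C, 1 <= rho &
  forall u, 0 <= complex.Re u -> complex.Im u ^+ 2 <= complex.Re u ^+ 2 + xi -> rho <= cabs u ->
    cabs (Ej u) <= C / cabs u ^+ 2].
Proof.
have [C1 [r1 [C10 r10 B1]]] := kfun_bound gd xi0.
have [r2 [C2 [r20 C20 B2]]] := rk_at_infinity HAinv Hstiff.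
have [r3 r30 B3] := rk_good_far HAinv Hstiff.
pose rho := Num.max (Num.max r1 1) (Num.max (r2 / h) (r3 / h)).
exists (C1 * (C2 / h) ^+ 2), rho; split.
- by rewrite mulr_gt0// exprn_gt0// divr_gt0.
- by rewrite /rho !le_max lexx orbT.
move=> u u0 I2; rewrite /rho !ge_max => /andP[/andP[u1 ua] /andP[u2 u3]].
have a0 : 0 < cabs u by rewrite (lt_le_trans ltr01).
have wE : cabs (h%:C * u ^+ 2) = h * cabs u ^+ 2 by rewrite cabsM cabsX cabsR gtr0_norm.
have big t : t / h <= cabs u -> t <= cabs (h%:C * u ^+ 2).
  rewrite ler_pdivrMr// => /le_trans; apply; rewrite wE mulrC ler_pM2l// expr2.
  by rewrite ler_peMr// ltW.
have [U Br Bq] := B2 _ (big _ u2); have [_ Bg] := B3 _ (big _ u3).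
rewrite /Ej rk_eE !cabsM cabsX.
have Brn : cabs (rk_r A b (h%:C * u ^+ 2)) ^+ n <= C2 / cabs (h%:C * u ^+ 2).
  apply: le_trans Br; rewrite -(prednK n1) exprS ler_piMr ?cabs_ge0//.
  by rewrite exprn_ile1 ?cabs_ge0.
have H : cabs (rk_r A b (h%:C * u ^+ 2)) ^+ n * cabs (rk_q A b (h%:C * u ^+ 2) 0 j) <=
    (C2 / cabs (h%:C * u ^+ 2)) * (C2 / cabs (h%:C * u ^+ 2)).
  by apply: ler_pM => //; rewrite ?exprn_ge0 ?cabs_ge0.
apply: (le_trans (ler_pM (cabs_ge0 _) _ (B1 u u0 I2 u1) H)).
  by rewrite mulr_ge0 ?exprn_ge0 ?cabs_ge0.
rewrite wE le_eqVlt; apply/orP; left; apply/eqP; field.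
by rewrite !gt_eqF.
Qed.

(** The integrands on the two rays in the parameter [y]. Since [2 u du = i dy], they agree with
    [K e_n i]; [fp] is meant for [0 <= y] and [fn] for [y <= 0], where [- bpath xi y] is the root
    with nonnegative real part. *)
Let fp y : CC R := Ej (bpath xi y) * ('i / (2 * bpath xi y)).
Let fn y : CC R := Ej (- bpath xi y) * - ('i / (2 * bpath xi y)).

Let Re_bsq y : complex.Re (bpath xi y ^+ 2) <= 0.
Proof. by rewrite bpath_sqr ReD Re_imul /= oppr0 addr0 oppr_le0 ltW. Qed.

Let bcvg y : bpath xi @ y --> bpath xi y.
Proof. exact: pder_cont (pder_bpath xi0 y). Qed.

Let fp_cont y : 0 <= y -> fp @ y --> fp y.
Proof.
move=> y0; apply: cvgCM; last exact: (bvel_cvg xi0).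
by apply: (cvgC_comp (nbhs_filter y) (@bcvg y)); apply: Ej_left; [exact: Re_bpath_ge0|exact: Re_bsq].
Qed.

Let fn_cont y : y <= 0 -> fn @ y --> fn y.
Proof.
move=> y0; apply: cvgCM; last by apply: cvgCN; exact: (bvel_cvg xi0).
apply: (cvgC_comp (nbhs_filter y) (cvgCN (@bcvg y))); apply: Ej_left; last by rewrite sqrrN; exact: Re_bsq.
by rewrite ReN oppr_ge0 Re_bpath_le0.
Qed.

Let babs y : 0 <= y -> Num.sqrt y <= cabs (bpath xi y).
Proof.
move=> y0; rewrite -ler_sqr ?nnegrE ?sqrtr_ge0 ?cabs_ge0// sqr_sqrtr// -cabsX bpath_sqr.
apply: le_trans (le_trans (ler_norm _) (cabs_Im _)).
by rewrite ImD Im_imul /= add0r.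
Qed.

Let babsN y : cabs (bpath xi (- y)) = cabs (bpath xi y).
Proof. by have [h1 h2] := bpath_opp xi0 y; rewrite /cabs h1 h2 sqrrN. Qed.

(** The velocity contributes a further [1 / (2 |u|)] to [Ej_bound], and [|u| >= sqrt y]; the
    resulting exponent [3/2] is integrable at infinity. *)
Let side_bound : exists C S0 : R, [/\ 0 < C, 1 <= S0 &
   forall y, S0 <= y -> cabs (fp y) <= C / (y * Num.sqrt y) /\ cabs (fn (- y)) <= C / (y * Num.sqrt y)].
Proof.
have [C [rho [C0 rho1 B]]] := Ej_bound.
exists C, (rho ^+ 2); split=> //; first by rewrite expr_ge1// (le_trans ler01).
move=> y ry; have rho0 : 0 < rho by rewrite (lt_le_trans ltr01).
have y0 : 0 < y by rewrite (lt_le_trans _ ry)// exprn_gt0.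
have q0 : 0 < Num.sqrt y by rewrite sqrtr_gt0.
have ba := babs (ltW y0); have b0 := lt_le_trans q0 ba.
have rb : rho <= cabs (bpath xi y).
  by apply: le_trans ba; rewrite -[leLHS]gtr0_norm// -sqrtr_sqr ler_wsqrtr.
have two : (2 : CC R) = (2 : R)%:C by rewrite rmorph_nat.
have fin (v : R) : v <= C / cabs (bpath xi y) ^+ 2 ->
    v * cabs ('i / (2 * bpath xi y)) <= C / (y * Num.sqrt y).
  move=> vC; rewrite cabsM cabsi mul1r cabsV cabsM two cabsR gtr0_norm//.
  have p : 0 <= (2 * cabs (bpath xi y))^-1 by rewrite invr_ge0 mulr_ge0 ?cabs_ge0.
  apply: (le_trans (ler_wpM2r p vC)).
  rewrite -mulrA; apply: ler_wpM2l; first exact: ltW.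
  rewrite -invfM lef_pV2 ?posrE ?mulr_gt0 ?exprn_gt0//.
  rewrite -{1}(sqr_sqrtr (ltW y0)); apply: ler_pM => //; rewrite ?sqr_ge0//.
    by rewrite ler_sqr ?nnegrE ?cabs_ge0// ltW.
  by apply: (le_trans ba); rewrite ler_peMl ?cabs_ge0// ler1n.
have Im2 : complex.Im (bpath xi y) ^+ 2 <= complex.Re (bpath xi y) ^+ 2 + xi.
  by rewrite bpath_Re subrK.
have [h1 h2] := bpath_opp xi0 y.
split; first by rewrite /fp cabsM; apply: fin; apply: B => //; apply: Re_bpath_ge0 => //; exact: ltW.
rewrite /fn cabsM cabsN.
have -> : cabs ('i / (2 * bpath xi (- y))) = cabs ('i / (2 * bpath xi y)).
  have vE (z : CC R) : cabs ('i / (2 * z)) = (2 * cabs z)^-1.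
    by rewrite cabsM cabsi mul1r cabsV cabsM two cabsR gtr0_norm.
  by rewrite !vE babsN.
have e : cabs (bpath xi y) = cabs (- bpath xi (- y)) by rewrite cabsN babsN.
apply: fin; rewrite e; apply: B.
- by rewrite ReN h1 opprK Re_bpath_ge0// ltW.
- by rewrite ReN ImN h1 h2 opprK sqrrN.
- by rewrite cabsN babsN.
Qed.

Lemma line_integral_pos : cintegrable `[0, +oo[ fp /\
  (fun k => cint `[0, k.+1%:R] fp) @ \oo --> cint `[0, +oo[ fp.
Proof.
have [C [S0 [C0 S1 B]]] := side_bound.
have cP k : pcont 0 k fp by move=> y /andP[y0 _]; exact: fp_cont.
have [K K0 HK] := decay_bound C0 S1 cP (fun y yS => proj1 (B y yS)).
exact: (cint_halfline_pos K0 cP HK).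
Qed.

Lemma line_integral_neg : cintegrable `]-oo, 0] fn /\
  (fun k => cint `[- k.+1%:R, 0] fn) @ \oo --> cint `]-oo, 0] fn.
Proof.
have [C [S0 [C0 S1 B]]] := side_bound.
have cN k : pcont k 0 fn by move=> y /andP[_ y0]; exact: fn_cont.
have cP k : pcont 0 k (fun y => fn (- y)).
  move=> y /andP[y0 _]; have c1 : (fun y : R => - y) @ y --> - y by apply: cvgN; exact: cvg_id.
  by apply: cvg_comp c1 _; apply: fn_cont; rewrite oppr_le0.
have [K K0 HK] := decay_bound C0 S1 cP (fun y yS => proj2 (B y yS)).
apply: (cint_halfline_neg K0 cN) => y y0.
by have := HK (- y); rewrite opprK oppr_ge0 => /(_ y0).
Qed.

Definition F1 y : CC R := Ktrans ((- xi)%:C + 'i * y%:C) x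
         * rk_e A b n (h%:C * ((- xi)%:C + 'i * y%:C)) 0 j * 'i.

Lemma F1_integral : cintegrable setT F1 /\ cint setT F1 = cint `[0, +oo[ fp + cint `]-oo, 0] fn.
Proof.
have [ip _] := line_integral_pos; have [iN _] := line_integral_neg.
apply: cint_setT_glue => // y y0.
  rewrite /F1 Ktrans_upper// /fp /Ej bpath_sqr /Kside.
  by move: (bpath_neq0 xi0 y) (kfun _ _ _) (rk_e _ _ _ _ _ _) => bn p q; field.
rewrite /F1 Ktrans_lower// /fn /Ej sqrrN bpath_sqr /Kside.
by move: (bpath_neq0 xi0 y) (kfun _ _ _) (rk_e _ _ _ _ _ _) => bn p q; field.
Qed.

Let g t : CC R := Ej ('i * t%:C) * 'i.
Let G t : CC R := g t + g (- t).

Let g_cont t : g @ t --> g t.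
Proof.
apply: cvgCM; last exact: cvgC_cst.
have c1 : (fun t : R => 'i * t%:C : CC R) @ t --> ('i * t%:C : CC R).
  by apply: cvgCM; [exact: cvgC_cst|apply: cvg_real; exact: cvg_id].
apply: (cvgC_comp (nbhs_filter t) c1); apply: Ej_left; first by rewrite Re_imul /= oppr0.
by rewrite exprMn i_sqr mulN1r ReN expr2 ReM /= mulr0 subr0 -expr2 oppr_le0 sqr_ge0.
Qed.

Let gN_cont t : (fun t => g (- t)) @ t --> g (- t).
Proof.
have c1 : (fun y : R => - y) @ t --> - t by apply: cvgN; exact: cvg_id.
exact: cvg_comp c1 (@g_cont _).
Qed.

Definition F2 l : CC R := (Kdown x l - Kup x l) * rk_e A b n (- (h * l)%:C) 0 j.

(** The points [i sqrt l] and [- i sqrt l] have the same square [- l], hence the same value of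
    [e_n]; the opposite signs of [2 u] turn the sum of the two sides of the slit into the jump of
    [K]. *)
Let F2_pullback l : 0 < l -> F2 l = sqrt_pullback G l.
Proof.
move=> l0; rewrite /F2 /sqrt_pullback /G /g /Ej /Kdown /Kup /Kside.
have e1 : (h%:C : CC R) * ('i * (Num.sqrt l)%:C) ^+ 2 = - (h * l)%:C.
  by rewrite exprMn i_sqr -rmorphXn /= sqr_sqrtr ?(ltW l0)// mulN1r mulrN -rmorphM.
have -> : 'i * (- Num.sqrt l)%:C = - ('i * (Num.sqrt l)%:C) :> CC R by rewrite rmorphN mulrN.
rewrite sqrrN e1; set e := rk_e _ _ _ _ _ _.
have sn : ((Num.sqrt l)%:C : CC R) != 0.
  by rewrite -cabs_gt0 cabsR gtr0_norm sqrtr_gt0.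
have -> : (2 * Num.sqrt l)^-1%:C = (2 * (Num.sqrt l)%:C)^-1 :> CC R.
  by rewrite fmorphV /= rmorphM rmorph_nat.
have i0 := @i_neq0 R; have ii := @i_sqr R.
set p := kfun D (enorm x) (- ('i * (Num.sqrt l)%:C)); set q := kfun D (enorm x) ('i * (Num.sqrt l)%:C).
move: p q sn; move: ((Num.sqrt l)%:C) => r p q rn.
transitivity (- ('i ^+ 2) * ((p / (2 * - ('i * r)) - q / (2 * ('i * r))) * e)).
  by rewrite ii opprK mul1r.
by field; rewrite rn i0.
Qed.

Lemma F2_integral : cintegrable [set l | 0 < l < xi] F2 /\
  cint [set l | 0 < l < xi] F2 = cint `[- Num.sqrt xi, 0] g + cint `[0, Num.sqrt xi] g.
Proof.
have cG : pcont 0 (Num.sqrt xi) G by move=> t _; apply: cvgCD; [exact: g_cont|exact: gN_cont].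
have [[i1 i2] E] := cint_sqrt_pullback xi0 cG.
have EU : [set l | 0 < l < xi] = `]0, xi[%classic by apply/seteqP; split=> l; rewrite /= in_itv.
have sub : `]0, xi[ `<=` `]0, xi]%classic by move=> l; rewrite /= !in_itv /= => /andP[-> /ltW].
have mo : measurable (`]0, xi[%classic : set (measurableTypeR R)) by exact: measurable_itv.
have mc : measurable (`]0, xi]%classic : set (measurableTypeR R)) by exact: measurable_itv.
have j1 := integrableS mc mo sub i1; have j2 := integrableS mc mo sub i2.
have eqF l : l \in `]0, xi[%classic -> F2 l = sqrt_pullback G l.
  by move=> /set_mem; rewrite /= in_itv /= => /andP[l0 _]; exact: F2_pullback.
rewrite EU; split.
  by split; [apply: (eq_integrable mo _ _ _ j1)|apply: (eq_integrable mo _ _ _ j2)] => l lx /=; rewrite eqF.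
have -> : cint `]0, xi[ F2 = cint `]0, xi] (sqrt_pullback G).
  rewrite (eq_cint (g := sqrt_pullback G)); last by move=> l; exact: eqF.
  by apply: complexP => /=; apply: Rintegral_itv_bndo_bndc.
have sx := sqrtr_ge0 xi.
have cg a c : pcont a c g by move=> t _; exact: g_cont.
have cgN a c : pcont a c (fun t => g (- t)) by move=> t _; exact: gN_cont.
rewrite E (cint_opp sx (cg _ _)) addrC.
exact: (cintD (measurable_itv _) (pcont_integrable (cg _ _)) (pcont_integrable (cgN _ _))).
Qed.

Let X k := corner_Re xi k.+1%:R.
Let B k := corner_Im xi k.+1%:R.

Let XB k : B k ^+ 2 = X k ^+ 2 + xi.
Proof. by rewrite /X /B /corner_Re /corner_Im bpath_Re subrK. Qed.

Let X_ge0 k : 0 <= X k.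
Proof. exact: Re_bpath_ge0. Qed.

Let B_gt0 k : 0 < B k.
Proof. exact: Im_bpath_gt0. Qed.

(** At the corner [|u|^2 = |- xi + i (k + 1)| >= k + 1], while [|u|^2 = 2 X^2 + xi]. *)
Let X_large (M : R) : \forall k \near \oo, M <= X k.
Proof.
have [N _ HN] := nbhs_infty_ger (2 * M ^+ 2 + xi).
exists N => // k /HN Nk; apply: (le_trans (ler_norm M)).
rewrite -ler_sqr ?nnegrE ?X_ge0// real_normK ?num_real//.
have Y : k.+1%:R <= X k ^+ 2 + B k ^+ 2.
  rewrite /X /B /corner_Re /corner_Im -cabs_sqr -cabsX bpath_sqr.
  apply: le_trans (le_trans (ler_norm _) (cabs_Im _)).
  by rewrite ImD Im_imul /= add0r.
have : k%:R <= k.+1%:R :> R by rewrite ler_nat.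
by move: Nk Y; rewrite XB /= => h1 h2 h3; lra.
Qed.

Let side k : R -> CC R := fun t => Ej ((X k)%:C - 'i * t%:C) * - 'i.

(** The integrand is [O(X^-2)] and each half of the closing side has length [B <= X (1 + sqrt xi)],
    which follows from [B^2 = X^2 + xi] and [1 <= X]. *)
Let side_small : exists C rho : R, [/\ 0 < C, 1 <= rho &
  forall k, rho <= X k ->
  cabs (cint `[- B k, 0] (side k)) <= C / X k /\ cabs (cint `[0, B k] (side k)) <= C / X k].
Proof.
have [C [rho [C0 rho1 Bd]]] := Ej_bound.
have [r3 r30 B3] := rk_good_far HAinv Hstiff.
have sx := sqrtr_ge0 xi.
exists (2 * (C * (1 + Num.sqrt xi))), (Num.max rho (r3 / h)); split.
- by rewrite !mulr_gt0// ltr_pwDl.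
- by rewrite le_max rho1.
move=> k; rewrite ge_max => /andP[rX r3X]; have X1 : 1 <= X k by rewrite (le_trans rho1).
have X0 : 0 < X k by rewrite (lt_le_trans ltr01).
have BX : B k <= X k * (1 + Num.sqrt xi).
  have nn : 0 <= X k * (1 + Num.sqrt xi) by exact: (mulr_ge0 (X_ge0 k) (addr_ge0 ler01 sx)).
  rewrite -(@ler_sqr R (B k) (X k * (1 + Num.sqrt xi))) ?nnegrE; [|exact: ltW (B_gt0 k)|exact: nn].
  rewrite XB.
  have gen (a q : R) : (a * (1 + q)) ^+ 2 = a ^+ 2 + (a ^+ 2 * q ^+ 2 + 2 * a ^+ 2 * q) by ring.
  rewrite gen (sqr_sqrtr (ltW xi0)) lerD2l; apply: (@le_trans _ _ (X k ^+ 2 * xi)).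
    by rewrite ler_peMl ?(ltW xi0)// expr_ge1// ltW.
  by rewrite lerDl; apply: mulr_ge0 => //; rewrite mulr_ge0 ?sqr_ge0.
have Reu t : complex.Re ((X k)%:C - 'i * t%:C : CC R) = X k.
  by rewrite ReD ReN Re_imul /= oppr0 oppr0 addr0.
have Imu t : complex.Im ((X k)%:C - 'i * t%:C : CC R) = - t.
  by rewrite ImD ImN Im_imul /= add0r.
have absu t : X k <= cabs ((X k)%:C - 'i * t%:C : CC R).
  by apply: le_trans (le_trans (ler_norm _) (cabs_Re _)); rewrite Reu.
have bound t : - B k <= t <= B k -> cabs (side k t) <= C / X k ^+ 2.
  move=> tB; rewrite /side cabsM cabsN cabsi mulr1.
  apply: (@le_trans _ _ (C / cabs ((X k)%:C - 'i * t%:C : CC R) ^+ 2)).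
    apply: Bd; rewrite ?Reu ?Imu ?sqrrN; [exact: ltW| |exact: le_trans (absu t)].
    by rewrite -XB -[leLHS]real_normK ?num_real// ler_sqr ?nnegrE ?(ltW (B_gt0 k))// ler_norml.
  apply: ler_wpM2l; first exact: ltW.
  rewrite lef_pV2 ?posrE ?exprn_gt0// ?(lt_le_trans X0)//.
  by rewrite ler_sqr ?nnegrE ?cabs_ge0// ltW.
have cs a c : pcont a c (side k).
  move=> t _; apply: cvgCM; last exact: cvgC_cst.
  have c1 : (fun t : R => (X k)%:C - 'i * t%:C : CC R) @ t --> ((X k)%:C - 'i * t%:C : CC R).
    apply: cvgCB; first exact: cvgC_cst.
    by apply: cvgCM; [exact: cvgC_cst|apply: cvg_real; exact: cvg_id].
  apply: (cvgC_comp (nbhs_filter t) c1); apply: Ej_cont; first by rewrite Reu ltW.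
  suff [] : rk_good A b (h%:C * ((X k)%:C - 'i * t%:C) ^+ 2) by [].
  apply: B3; rewrite cabsM cabsX cabsR gtr0_norm//.
  move: r3X; rewrite ler_pdivrMr// mulrC => /le_trans; apply; rewrite ler_pM2l//.
  by apply: (le_trans (absu t)); rewrite expr2 ler_peMl ?cabs_ge0// (le_trans X1).
have fin : 2 * (C / X k ^+ 2 * B k) <= 2 * (C * (1 + Num.sqrt xi)) / X k.
  rewrite -[leRHS]mulrA ler_pM2l//.
  apply: (@le_trans _ _ (C / X k ^+ 2 * (X k * (1 + Num.sqrt xi)))).
    by apply: ler_wpM2l => //; rewrite divr_ge0 ?sqr_ge0// ltW.
  by rewrite le_eqVlt; apply/orP; left; apply/eqP; field; rewrite gt_eqF.
split.
  have H := @cint_bound R (- B k) 0 (side k) (C / X k ^+ 2) _ (cs _ _) _.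
  rewrite sub0r opprK in H; apply: le_trans fin; apply: H; first by rewrite oppr_le0 ltW.
  by move=> t /andP[t1 t2]; apply: bound; rewrite t1 (le_trans t2)// ltW.
have H := @cint_bound R 0 (B k) (side k) (C / X k ^+ 2) _ (cs _ _) _.
rewrite subr0 in H; apply: le_trans fin; apply: H; first exact: ltW.
by move=> t /andP[t1 t2]; apply: bound; rewrite t2 andbT (le_trans _ t1)// oppr_le0 ltW.
Qed.

(** The closing side has to lie far enough out for [|r| <= 1] on it, hence the restriction to large
    [k]; the left-hand side does not depend on [k]. *)
Let omega_split : \forall k \near \oo, omega A b x h n 0 j = h%:C / (2 * (pi : R)%:C * 'i) *
  (cint `[- k.+1%:R, 0] fn + (cint `[- Num.sqrt xi, 0] g + (cint `[0, Num.sqrt xi] g +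
   (cint `[0, k.+1%:R] fp + (cint `[- B k, 0] (side k) + cint `[0, B k] (side k)))))).
Proof.
have [r3 r30 B3] := rk_good_far HAinv Hstiff.
have [N _ HN] := X_large (Num.max 1 (r3 / h)).
exists N => // k /HN /=; rewrite ge_max => /andP[X1 X3].
have k0 : 0 < (k.+1%:R : R) by [].
have far (w : CC R) : h * corner_Re xi k.+1%:R ^+ 2 <= cabs w -> rk_good A b w.
  move=> hw; apply: B3; apply: le_trans hw; move: X3; rewrite ler_pdivrMr// mulrC => /le_trans; apply.
  by rewrite ler_pM2l// expr2 ler_peMr// (le_trans ler01).
rewrite (omega_contour HAstab HAinv Hstiff HD Hx h0 xi0 k0 far); congr (_ * _).
by rewrite /oint sum6 /keyhole !inordK.
Qed.

Lemma omega_formula : omega A b x h n 0 j =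
  h%:C / (2 * (pi : R)%:C * 'i) * cint setT F1
  + h%:C / (2 * (pi : R)%:C * 'i) * cint [set l | 0 < l < xi] F2.
Proof.
set c := h%:C / _; rewrite -mulrDr.
have pn : ((pi : R)%:C : CC R) != 0 by rewrite -cabs_gt0 cabsR gtr0_norm ?pi_gt0.
have hn : (h%:C : CC R) != 0 by rewrite -cabs_gt0 cabsR gtr0_norm.
have cn : c != 0.
  by rewrite /c mulf_neq0// invr_neq0// !mulf_neq0// ?pnatr_eq0// i_neq0.
have [_ LP] := line_integral_pos; have [_ LN] := line_integral_neg.
have [_ ->] := F1_integral; have [_ ->] := F2_integral.
have -> : cint `[0, +oo[ fp + cint `]-oo, 0] fn + (cint `[- Num.sqrt xi, 0] g + cint `[0, Num.sqrt xi] g) =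
   cint `]-oo, 0] fn + (cint `[- Num.sqrt xi, 0] g + cint `[0, Num.sqrt xi] g) + cint `[0, +oo[ fp by ring.
set S := cint `[- Num.sqrt xi, 0] g + _.
pose a (k : nat) := cint `[- k.+1%:R, 0] fn + S + cint `[0, k.+1%:R] fp.
have La : a @ \oo --> cint `]-oo, 0] fn + S + cint `[0, +oo[ fp.
  by apply: cvgnD LP; apply: cvgnD LN _; exact: cvgn_cst.
rewrite -[LHS](mulfVK cn) mulrC; congr (_ * _).
(* The quotient of [omega] by [c] is constant in [k], so it suffices that [a] converges to it as
   well: the difference is the integral over the closing side, at most [2 C / X k]. *)
apply: (cvg_unique (@norm_hausdorff _ (CC R)) _ La).
have [C [rho [C0 rho1 HC]]] := side_small.
apply/(@cvgCP R nat \oo _ a) => e e0.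
near=> k.
have X1 : rho <= X k by near: k; exact: X_large.
have X2 : 2 * C / e + 1 <= X k by near: k; exact: X_large.
have X0 : 0 < X k by rewrite (lt_le_trans _ X1)// (lt_le_trans ltr01).
have [S1 S2] := HC k X1.
have -> : omega A b x h n 0 j / c - a k = cint `[- B k, 0] (side k) + cint `[0, B k] (side k).
  have -> : omega A b x h n 0 j = c * (a k + (cint `[- B k, 0] (side k) + cint `[0, B k] (side k))).
    have -> : omega A b x h n 0 j = c * (cint `[- k.+1%:R, 0] fn + (cint `[- Num.sqrt xi, 0] g + (cint `[0, Num.sqrt xi] g +
   (cint `[0, k.+1%:R] fp + (cint `[- B k, 0] (side k) + cint `[0, B k] (side k)))))).
      by near: k; exact: omega_split.
    by congr (_ * _); rewrite /a /S; ring.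
  by rewrite mulrC mulKf// addrC addKr.
apply: (le_lt_trans (cabsD _ _)); apply: (le_lt_trans (lerD S1 S2)).
have -> : C / X k + C / X k = 2 * C / X k by ring.
rewrite ltr_pdivrMr// -ltr_pdivrMl// mulrC (lt_le_trans _ X2)// ltrDl//.
Unshelve. all: by end_near. Qed.

End integral_formula.

Theorem theorem3p3
  (R : realType) (s : nat) (A : 'M[R]_s.+1) (b : 'rV[R]_s.+1)
  (* order p >= 1 (first order condition: sum of weights equals 1) *)
  (Horder : \sum_(j < s.+1) b 0 j = 1)
  (* A-stability *)
  (HAstab : forall z : CC R, complex.Re z <= 0 ->
     (1%:M - z *: Cmx A) \in unitmx /\ `|rk_r A b z| <= 1)
  (* |r(iy)| < 1 for real y <> 0 *)
  (Himag : forall y : R, y != 0 -> `|rk_r A b ('i * y%:C)| < 1)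
  (* A invertible *)
  (HAinv : A \in unitmx)
  (* stiffly accurate: b^T A^{-1} = (0,...,0,1) *)
  (Hstiff : b *m invmx A = \row_(j < s.+1) (j == ord_max)%:R)
  (D : nat) (HD : (1 <= D <= 3)%N) (x : 'rV[R]_D)
  (Hx : (2 <= D)%N -> x != 0)
  (h xi : R) (Hh : 0 < h) (Hxi : 0 < xi) (n : nat) (Hn : (1 <= n)%N) :
  exists Kup Kdown : R -> CC R,
    (* Kup l = K(l e^{i pi}, x),  Kdown l = K(l e^{-i pi}, x) *)
    (forall l : R, 0 < l ->
       (fun eps : R => Ktrans ((- l)%:C + 'i * eps%:C) x) @ 0^'+ --> Kup l) /\
    (forall l : R, 0 < l ->
       (fun eps : R => Ktrans ((- l)%:C - 'i * eps%:C) x) @ 0^'+ --> Kdown l) /\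
    (forall l : R, 0 < l -> Kdown l - Kup l = Gjump l x) /\
    (forall j : 'I_s.+1,
       let F1 := fun y : R =>
         Ktrans ((- xi)%:C + 'i * y%:C) x
         * rk_e A b n (h%:C * ((- xi)%:C + 'i * y%:C)) 0 j * 'i in
       let F2 := fun l : R =>
         (Kdown l - Kup l) * rk_e A b n (- (h * l)%:C) 0 j in
       cintegrable setT F1 /\
       cintegrable [set l | 0 < l < xi] F2 /\
       omega A b x h n 0 j
         = h%:C / (2 * (pi : R)%:C * 'i) * cint setT F1
         + h%:C / (2 * (pi : R)%:C * 'i) * cint [set l | 0 < l < xi] F2).
Proof.
exists (Kup x), (Kdown x); split; first by move=> l l0; exact: Kup_cvg.
split; first by move=> l l0; exact: Kdown_cvg.
split; first by move=> l l0; exact: Gjump_eq.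
move=> j /=; split.
  exact: (proj1 (F1_integral HAstab HAinv Hstiff HD Hx j Hh Hxi Hn)).
split; first exact: (proj1 (F2_integral HAstab HD Hx n j Hh Hxi)).
exact: (omega_formula HAstab HAinv Hstiff HD Hx j Hh Hxi Hn).
Qed.
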